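(* There exists a one-to-one correspondence between the set of isomorphism classes of the simple Lie algebras $\mathcal{B}(\Gamma,J)$ of Xu type (where $\Gamma$ ranges over $\Omega$ and $J$ over the 16 products $J_1\times J_2\times J_3\times J_4$ with $J_p\in\{\{0\},\mathbb{N}\}$) and the set $$\mathcal{M}=\{(m_1,m_2,m_3,m_4,\omega)\mid \vec m=(m_1,m_2,m_3,m_4)\in M,\ \omega\in\overline{\Omega}_{\vec m}\}.$$ In other words, $\mathcal{M}$ is the structure space of the simple Lie algebras $\mathcal{B}(\Gamma,J)$ of Xu type.
   Context: $\mathbb{F}$ is an algebraically closed field of characteristic $0$; all vector spaces are over $\mathbb{F}$; $\mathbb{N}=\{0,1,2,\dots\}$. For $a\in\mathbb{F}$ and $p\in\{1,2,3,4\}$, $a_{[p]}\in\mathbb{F}^4$ denotes the vector with $a$ in position $p$ and $0$ elsewhere. Elements of $\mathbb{F}^4$ are row vectors $\alpha=(\alpha_1,\alpha_2,\alpha_3,\alpha_4)$. Let $\Omega$ be the set of additive subgroups $\Gamma\subseteq\mathbb{F}^4$ such that $\sigma:=(1,0,1,0)\in\Gamma$; $\Gamma\cap\mathbb{F}1_{[p]}\neq\{0\}$ for $p=1,2,3,4$; and $\Gamma\cap(1_{[q]}+\mathbb{F}1_{[q+1]})\neq\emptyset$ for $q=1,3$. Construction of $\mathcal{B}(\Gamma,J)$ for $\Gamma\in\Omega$ and $J=J_1\times J_2\times J_3\times J_4$, $J_p\in\{\{0\},\mathbb{N}\}$. Elements of $J$ are written $\mathbf{i}=(i_1,i_2,i_3,i_4)$.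 $\mathcal{A}_4=\mathcal{A}_4(\Gamma,J)$ is the commutative associative semigroup algebra of $\Gamma\times J$ with basis $\{x^{\alpha,\mathbf{i}}\mid(\alpha,\mathbf{i})\in\Gamma\times J\}$ and product $x^{\alpha,\mathbf{i}}\cdot x^{\beta,\mathbf{j}}=x^{\alpha+\beta,\mathbf{i}+\mathbf{j}}$. Write $x^\alpha=x^{\alpha,0}$. Convention: any technically appearing but undefined expression (e.g. $x^{\alpha,\mathbf{i}}$ with some $i_p<0$, or $x^\alpha$ with $\alpha\notin\Gamma$) is treated as zero. For $p=1,\dots,4$ let $\partial_p$ be the derivation of $\mathcal{A}_4$ with $\partial_p(x^{\alpha,\mathbf{i}})=\alpha_px^{\alpha,\mathbf{i}}+i_px^{\alpha,\mathbf{i}-1_{[p]}}$. The Lie bracket on $\mathcal{A}_4$ is $$[u,v]=x^{\sigma}\big(\partial_1(u)\partial_2(v)-\partial_1(v)\partial_2(u)\big)+(u+\partial_3(u))\partial_4(v)-(v+\partial_3(v))\partial_4(u).$$ Put $\sigma_1=(0,0,-1,0)$ and $\sigma_2=(1,0,-2,0)$, with $x^{\sigma_i}$ treated as $0$ if $\sigma_i\notin\Gamma$. The element $x^{\sigma_1}$ is central; let $\mathcal{B}_4=\mathcal{A}_4/\mathbb{F}x^{\sigma_1}$ with the induced bracket. The Lie algebra of Xu type is $\mathcal{B}(\Gamma,J)=[\mathcal{B}_4,\mathcal{B}_4]$; it is simple, and equals $\mathcal{B}_4$ if $J\neq\{0\}$ or $\sigma_2\notin\Gamma$. Let $M=\{\vec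 m=(m_1,m_2,m_3,m_4)\mid m_p\in\{0,1\}\}$, corresponding to the 16 possible choices of $J$ ($m_p=0$ corresponding to $J_p=\{0\}$ and $m_p=1$ to $J_p=\mathbb{N}$). For $\vec m\in M$, let $G_{\vec m}$ be the subgroup of $GL_4(\mathbb{F})$ generated by all matrices $\begin{pmatrix} A & B \\ C & D \end{pmatrix}$ (with $2\times2$ blocks) such that either $B=C=0$ and $A,D$ have the form $A=\begin{pmatrix} 1 & 0 \\ a_1 & a_2 \end{pmatrix}$, $D=\begin{pmatrix} 1 & 0 \\ a_3 & a_4 \end{pmatrix}$; or else $(m_1,m_2)=(m_3,m_4)$, $A=D=0$ and $B,C$ have the form $B=\begin{pmatrix} 1 & 0 \\ a_1 & a_2 \end{pmatrix}$, $C=\begin{pmatrix} 1 & 0 \\ a_3 & a_4 \end{pmatrix}$; where in all cases $a_1,a_2,a_3,a_4\in\mathbb{F}$, $a_2,a_4\neq0$, $a_1=0$ if $m_1=0\neq m_2$, and $a_3=0$ if $m_3=0\neq m_4$. The group $G_{\vec m}$ acts on $\mathbb{F}^4$ by $g(\alpha)=\alpha g^{-1}$, hence on additive subgroups of $\mathbb{F}^4$ by $g(\Gamma)=\{g(\alpha)\mid\alpha\in\Gamma\}$. $\overline{\Omega}_{\vec m}$ denotes the quotient set of $\Omega$ by the equivalence relation $\Gamma\sim\Gamma'$ if and only if $\Gamma'=g(\Gamma)$ for some $g\in G_{\vec m}$.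
   Formalization: Sending (m,ω) to its algebra is not injective: exchanging coordinate blocks (1,2),(3,4) gives isomorphic algebras for m and swapped m. Proved: a bijection with M exists, and B(Γ,J)≅B(Γ',J') iff m=m' and Γ~Γ', except when m' is the swap of m and differs from m. *)

(* Defs.v *)
From HB Require Import structures.
From mathcomp Require Import all_boot all_order all_algebra.
From mathcomp Require Import finmap.
From mathcomp Require Import boolp classical_sets functions.
From mathcomp Require Import generic_quotient ring_quotient monalg.

Set Implicit Arguments.
Unset Strict Implicit.
Unset Printing Implicit Defensive.

Import GRing.Theory.
Local Open Scope classical_set_scope.
Local Open Scope ring_scope.

Section LineQuotient.
Variables (F : fieldType) (V : lmodType F) (z : V).

Definition line : {pred V} := fun u => `[< exists a : F, u = a *: z >].

Lemma lineP u : reflect (exists a : F, u = a *: z) (u \in line).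
Proof. exact: asboolP. Qed.

Lemma line_zmod_closed : zmod_closed line.
Proof.
split; first by apply/lineP; exists 0; rewrite scale0r.
move=> _ _ /lineP[a ->] /lineP[b ->].
by apply/lineP; exists (a - b); rewrite scalerBl.
Qed.

HB.instance Definition _ := GRing.isZmodClosed.Build V line line_zmod_closed.

(* The quotient vector space V / F z. *)
Definition line_quot : Type := Quotient.quot line.
HB.instance Definition _ := GRing.Zmodule.on line_quot.

Definition lpi (u : V) : line_quot := (\pi_(Quotient.quot line) u)%qT.
Definition lrepr (x : line_quot) : V := repr (x : Quotient.quot line).

Lemma lreprK x : lpi (lrepr x) = x.
Proof. exact: reprK. Qed.

Lemma lpi_eqP u v : lpi u = lpi v <-> exists a : F, u - v = a *: z.
Proof.
have E : (lpi u == lpi v) = (u - v \in line).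
  by rewrite (Quotient.idealrBE line u v).
split; first by move=> /eqP; rewrite E => /lineP.
by move=> /lineP; rewrite -E => /eqP.
Qed.

Lemma lpiD u v : lpi (u + v) = lpi u + lpi v.
Proof. exact: (@Quotient.pi_add V line). Qed.

Definition line_quot_scale (a : F) (x : line_quot) : line_quot :=
  lpi (a *: lrepr x).

Lemma lpiZ a u : lpi (a *: u) = line_quot_scale a (lpi u).
Proof.
have [b Eb] : exists b : F, u - lrepr (lpi u) = b *: z.
  by apply/lpi_eqP; rewrite lreprK.
by apply/lpi_eqP; exists (a * b); rewrite -scalerBr Eb scalerA.
Qed.

Fact line_quot_scaleA a b x :
  line_quot_scale a (line_quot_scale b x) = line_quot_scale (a * b) x.
Proof. by rewrite -[x]lreprK -!lpiZ scalerA. Qed.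

Fact line_quot_scale1 : left_id 1 line_quot_scale.
Proof. by move=> x; rewrite -[x]lreprK -!lpiZ scale1r. Qed.

Fact line_quot_scaleDr : right_distributive line_quot_scale +%R.
Proof.
by move=> a x y; rewrite -[x]lreprK -[y]lreprK -!lpiZ -!lpiD -lpiZ scalerDr.
Qed.

Fact line_quot_scaleDl x : {morph line_quot_scale^~ x : a b / a + b}.
Proof. by move=> a b; rewrite -[x]lreprK -!lpiZ -lpiD scalerDl. Qed.

HB.instance Definition _ := GRing.Zmodule_isLmodule.Build F line_quot
  line_quot_scaleA line_quot_scale1 line_quot_scaleDr line_quot_scaleDl.
End LineQuotient.

Definition lin_span (F : fieldType) (V : lmodType F) (X : set V) : set V :=
  [set v | exists (n : nat) (a : 'I_n -> F) (x : 'I_n -> V),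
     (forall i, X (x i)) /\ v = \sum_(i < n) a i *: x i].

(* L and L' are subspaces of V and V', closed under the brackets br and br'. *)
Definition lie_isomorphic (F : fieldType) (V V' : lmodType F)
    (br : V -> V -> V) (br' : V' -> V' -> V') (L : set V) (L' : set V') : Prop :=
  exists f : V -> V',
    [/\ set_bij L L' f,
        forall (a : F) x y, L x -> L y -> f (a *: x + y) = a *: f x + f y
      & forall x y, L x -> L y -> f (br x y) = br' (f x) (f y)].

Section BilinearBracket.
Variables (F : fieldType) (V : lmodType F) (mul : V -> V -> V) (s : V).
Variables d1 d2 d3 d4 : {linear V -> V}.
Hypothesis mulDl : forall a u v w, mul (a *: u + v) w = a *: mul u w + mul v w.
Hypothesis mulDr : forall a u v w, mul w (a *: u + v) = a *: mul w u + mul w v.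

Let br u v := mul s (mul (d1 u) (d2 v) - mul (d1 v) (d2 u))
  + mul (u + d3 u) (d4 v) - mul (v + d3 v) (d4 u).

Lemma bilinear_bracketC u v : br u v = - br v u.
Proof.
have mulN w t : mul t (- w) = - mul t w.
  have mul0 : mul t 0 = 0.
    by have := mulDr (-1) 0 0 t; rewrite scaler0 addr0 scaleN1r addNr.
  by rewrite -[- w]addr0 -scaleN1r mulDr mul0 addr0 scaleN1r.
by rewrite /br -[mul (d1 u) _ - _]opprB mulN !opprD !opprK addrAC.
Qed.

Lemma bilinear_bracketDl a u v w : br (a *: u + v) w = a *: br u w + br v w.
Proof.
have DD (x y x' y' : V) :
  a *: x + y + (a *: x' + y') = a *: (x + x') + (y + y').
  by rewrite scalerDr addrACA.
have DB (x y x' y' : V) :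
  a *: x + y - (a *: x' + y') = a *: (x - x') + (y - y').
  by rewrite scalerBr opprD addrACA.
by rewrite /br !linearP DD !mulDl !mulDr DB mulDr DD DB.
Qed.

Lemma bilinear_bracket0 c v :
  d1 c = 0 -> d2 c = 0 -> d3 c = - c -> d4 c = 0 -> br c v = 0.
Proof.
have mul0 t : (mul 0 t = 0) * (mul t 0 = 0).
  split; first by have := mulDl (-1) 0 0 t;
    rewrite scaler0 addr0 scaleN1r addNr.
  by have := mulDr (-1) 0 0 t; rewrite scaler0 addr0 scaleN1r addNr.
by rewrite /br => -> -> -> ->; rewrite subrr !mul0 !subr0 mul0 addr0.
Qed.
End BilinearBracket.

Definition p1 : 'I_4 := @Ordinal 4 0 isT.
Definition p2 : 'I_4 := @Ordinal 4 1 isT.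
Definition p3 : 'I_4 := @Ordinal 4 2 isT.
Definition p4 : 'I_4 := @Ordinal 4 3 isT.

Section Vectors.
Variable F : fieldType.

Definition at_pos (a : F) (p : 'I_4) : 'rV[F]_4 := a *: delta_mx 0 p.

Definition sigma : 'rV[F]_4 := at_pos 1 p1 + at_pos 1 p3.
Definition sigma1 : 'rV[F]_4 := at_pos (-1) p3.

Definition add_subgroup (Gam : set 'rV[F]_4) : Prop :=
  Gam 0 /\ forall a b, Gam a -> Gam b -> Gam (a - b).

Definition Omega : set (set 'rV[F]_4) :=
  [set Gam | [/\ add_subgroup Gam,
     Gam sigma,
     forall p : 'I_4, Gam `&` [set at_pos a p | a in setT] <> [set 0],
     Gam `&` [set at_pos 1 p1 + at_pos a p2 | a in setT] <> set0
   & Gam `&` [set at_pos 1 p3 + at_pos a p4 | a in setT] <> set0]].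

End Vectors.

(* m p = false encodes J_p = {0}, m p = true encodes J_p = nat. *)
Definition Mvec := {ffun 'I_4 -> bool}.

Definition Jset (m : Mvec) : set {ffun 'I_4 -> nat} :=
  [set i | forall p, (if m p then setT else [set 0%N]) (i p)].

(* All A_4(Gam, J) are realized inside the semigroup algebra [Amb F] of
   F^4 x nat^4; the monomial algebras of multinomials exclude monoids with
   nontrivial units, so only their module structure is used here. *)
Definition index (F : fieldType) := ('rV[F]_4 * {ffun 'I_4 -> nat})%type.
Definition Amb (F : fieldType) := {malg F[index F]}.

HB.lock Definition monom (F : fieldType) (k : index F) : Amb F := mkmalgU k 1.

HB.lock Definition linear_ext (F : fieldType) (f : index F -> Amb F)
    (u : Amb F) : Amb F :=
  \sum_(k <- msupp u) mcoeff k u *: f k.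

Section XuAlgebra.
Variable F : fieldType.
Local Notation index := (index F).
Local Notation Amb := (Amb F).

Definition exp0 : {ffun 'I_4 -> nat} := [ffun=> 0%N].
Definition xpow (al : 'rV[F]_4) : Amb := monom (al, exp0).

Lemma linear_ext_sub (f : index -> Amb) (u : Amb) (D : {fset index}) :
  (msupp u `<=` D)%fset -> linear_ext f u = \sum_(k <- D) mcoeff k u *: f k.
Proof.
move=> sD; rewrite unlock (big_fset_incl _ sD) //= => k _ kN.
by rewrite mcoeff_outdom ?scale0r.
Qed.

Lemma linear_ext_is_linear (f : index -> Amb) : linear (linear_ext f).
Proof.
move=> a u v.
pose D := (msupp (a *: u + v) `|` msupp u `|` msupp v)%fset.
rewrite !(@linear_ext_sub f _ D); first last.
- by rewrite /D -fsetUA fsubsetUl.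
- by rewrite /D fsetUAC fsubsetUr.
- by rewrite /D fsubsetUr.
rewrite scaler_sumr -big_split /=; apply: eq_bigr => k _.
by rewrite mcoeffD mcoeffZ scalerDl scalerA.
Qed.

HB.instance Definition _ f := GRing.isLinear.Build F Amb Amb _ (linear_ext f)
  (linear_ext_is_linear f).

Lemma linear_ext_monom (f : index -> Amb) (k : index) :
  linear_ext f (monom k) = f k.
Proof.
rewrite (@linear_ext_sub f _ [fset k]%fset) [monom]unlock ?msuppU_le //.
by rewrite big_seq_fset1 mcoeffUU scale1r.
Qed.

Definition index_add (k l : index) : index :=
  (k.1 + l.1, [ffun p => (k.2 p + l.2 p)%N]).

Definition amul (u v : Amb) : Amb :=
  linear_ext (fun k => linear_ext (fun l => monom (index_add k l)) v) u.

Lemma amulDl a u v w : amul (a *: u + v) w = a *: amul u w + amul v w.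
Proof. exact: linear_ext_is_linear. Qed.

Lemma amulDr a u v w : amul w (a *: u + v) = a *: amul w u + amul w v.
Proof.
have lin f g : linear_ext (fun k => a *: f k + g k) w
               = a *: linear_ext f w + linear_ext g w.
  rewrite unlock scaler_sumr -big_split /=; apply: eq_bigr => k _.
  by rewrite scalerDr !scalerA mulrC.
pose L v' k := linear_ext (fun l => monom (index_add k l)) v'.
rewrite /amul -[RHS](lin (L u) (L v)); congr linear_ext.
by apply: funext => k; exact: linear_ext_is_linear.
Qed.

(* The subtraction is truncated, but the term with i p = 0 has coefficient 0. *)
Definition exp_dec (p : 'I_4) (i : {ffun 'I_4 -> nat}) : {ffun 'I_4 -> nat} :=
  [ffun q => (i q - (q == p))%N].

Definition pd (p : 'I_4) : Amb -> Amb :=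
  linear_ext (fun k => k.1 0 p *: monom k
                       + (k.2 p)%:R *: monom (k.1, exp_dec p k.2)).

Definition abracket (u v : Amb) : Amb :=
  amul (xpow (sigma F))
    (amul (pd p1 u) (pd p2 v) - amul (pd p1 v) (pd p2 u))
  + amul (u + pd p3 u) (pd p4 v) - amul (v + pd p3 v) (pd p4 u).

Fact pd_is_linear p : linear (pd p).
Proof. exact: linear_ext_is_linear. Qed.

HB.instance Definition _ p := GRing.isLinear.Build F Amb Amb _ (pd p)
  (pd_is_linear p).

Lemma abracketC u v : abracket u v = - abracket v u.
Proof.
exact: (@bilinear_bracketC _ _ amul _ (pd p1) (pd p2) (pd p3) (pd p4) amulDr).
Qed.

Lemma abracketDl a u v w :
  abracket (a *: u + v) w = a *: abracket u w + abracket v w.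
Proof.
exact: (@bilinear_bracketDl _ _ amul _ (pd p1) (pd p2) (pd p3) (pd p4)
          amulDl amulDr).
Qed.

Lemma abracket_sigma1 v : abracket (xpow (sigma1 F)) v = 0.
Proof.
have pdx p : pd p (xpow (sigma1 F)) = sigma1 F 0 p *: xpow (sigma1 F).
  by rewrite /pd linear_ext_monom /= ffunE scale0r addr0.
have [s1 s2 s3 s4] : [/\ sigma1 F 0 p1 = 0, sigma1 F 0 p2 = 0,
    sigma1 F 0 p3 = -1 & sigma1 F 0 p4 = 0].
  by rewrite !mxE /= !mulr0 mulr1.
apply: (@bilinear_bracket0 _ _ amul _ (pd p1) (pd p2) (pd p3) (pd p4)
          amulDl amulDr); apply: etrans (pdx _) _.
- by rewrite s1 scale0r.
- by rewrite s2 scale0r.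
- by rewrite s3 scaleN1r.
- by rewrite s4 scale0r.
Qed.

Definition A4 (m : Mvec) (Gam : set 'rV[F]_4) : set Amb :=
  [set u | forall k, k \in msupp u -> Gam k.1 /\ Jset m k.2].

Definition central_elt (Gam : set 'rV[F]_4) : Amb :=
  if `[< Gam (sigma1 F) >] then xpow (sigma1 F) else 0.

Definition Quo (Gam : set 'rV[F]_4) := line_quot (central_elt Gam).

(* Well defined on the quotient, see qbracket_lpi below. *)
Definition qbracket (Gam : set 'rV[F]_4) (x y : Quo Gam) : Quo Gam :=
  lpi (central_elt Gam) (abracket (lrepr x) (lrepr y)).

Lemma qbracket_lpi Gam u v :
  qbracket (lpi (central_elt Gam) u) (lpi (central_elt Gam) v)
  = lpi (central_elt Gam) (abracket u v).
Proof.
have cent w : abracket (central_elt Gam) w = 0.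
  rewrite /central_elt; case: ifP => _; first exact: abracket_sigma1.
  by have := abracketDl (-1) 0 0 w; rewrite scaler0 addr0 scaleN1r addNr.
have cl x y a w : x - y = a *: central_elt Gam -> abracket x w = abracket y w.
  by move=> e; rewrite -[x](subrK y) e abracketDl cent scaler0 add0r.
have rep x : exists a, lrepr (lpi (central_elt Gam) x) - x
                       = a *: central_elt Gam.
  by apply/lpi_eqP; rewrite lreprK.
rewrite /qbracket; have [a ea] := rep u; have [b eb] := rep v.
by rewrite (cl _ _ _ _ ea) abracketC (cl _ _ _ _ eb) -abracketC.
Qed.

Definition B4 (m : Mvec) (Gam : set 'rV[F]_4) : set (Quo Gam) :=
  [set lpi (central_elt Gam) u | u in A4 m Gam].
Arguments B4 : clear implicits.

Definition xu_algebra (m : Mvec) (Gam : set 'rV[F]_4) : set (Quo Gam) :=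
  lin_span [set qbracket x y | x in B4 m Gam & y in B4 m Gam].
Arguments xu_algebra : clear implicits.

Definition xu_isomorphic (m : Mvec) (Gam : set 'rV[F]_4)
    (m' : Mvec) (Gam' : set 'rV[F]_4) : Prop :=
  lie_isomorphic (@qbracket Gam) (@qbracket Gam')
                 (xu_algebra m Gam) (xu_algebra m' Gam').

(* The isomorphism class of B(Gam, J), represented by the set of all the
   parameters of the algebras of Xu type isomorphic to it. *)
Definition iso_class (m : Mvec) (Gam : set 'rV[F]_4) :
    set (Mvec * set 'rV[F]_4) :=
  [set x | Omega x.2 /\ xu_isomorphic m Gam x.1 x.2].

Definition iso_classes : set (set (Mvec * set 'rV[F]_4)) :=
  [set C | exists m Gam, Omega Gam /\ C = iso_class m Gam].

End XuAlgebra.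

Section StructureSpace.
Variable F : fieldType.

Definition mx22 (a b : F) : 'M[F]_2 :=
  \matrix_(i, j) (if i == 0 then (if j == 0 then 1 else 0)
                  else (if j == 0 then a else b)).

Definition gen_params (m : Mvec) (a1 a2 a3 a4 : F) : Prop :=
  [/\ a2 != 0, a4 != 0, (m p1 = false -> m p2 = true -> a1 = 0)
    & (m p3 = false -> m p4 = true -> a3 = 0)].

Inductive Ggroup (m : Mvec) : 'M[F]_(2 + 2) -> Prop :=
| Ggroup_diag a1 a2 a3 a4 : gen_params m a1 a2 a3 a4 ->
    Ggroup m (block_mx (mx22 a1 a2) 0 0 (mx22 a3 a4))
| Ggroup_anti a1 a2 a3 a4 :
    (m p1, m p2) = (m p3, m p4) -> gen_params m a1 a2 a3 a4 ->
    Ggroup m (block_mx 0 (mx22 a1 a2) (mx22 a3 a4) 0)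
| Ggroup1 : Ggroup m 1%:M
| GgroupM g h : Ggroup m g -> Ggroup m h -> Ggroup m (g *m h)
| GgroupV g : Ggroup m g -> Ggroup m (invmx g).

Definition gact (g : 'M[F]_(2 + 2)) (Gam : set 'rV[F]_4) : set 'rV[F]_4 :=
  [set (al : 'rV[F]_(2 + 2)) *m invmx g | al in Gam].

Definition Gequiv (m : Mvec) (Gam Gam' : set 'rV[F]_4) : Prop :=
  exists g, Ggroup m g /\ Gam' = gact g Gam.

Definition Gclass (m : Mvec) (Gam : set 'rV[F]_4) : set (set 'rV[F]_4) :=
  [set Gam' | Omega Gam' /\ Gequiv m Gam Gam'].

Definition Omega_bar (m : Mvec) : set (set (set 'rV[F]_4)) :=
  [set Gclass m Gam | Gam in @Omega F].

Definition structure_space : set (Mvec * set (set 'rV[F]_4)) :=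
  [set x | Omega_bar x.1 x.2].

End StructureSpace.

(* For every m, the map x^{al, i} |-> (-1)^|i| x^{- al' - sigma, i'}, with '
   exchanging the coordinate pairs (1, 2) and (3, 4), is an isomorphism from
   the algebra with parameters (m, Gam) to the one with parameters
   (m', Gam'), for m' the block swap of m and Gam' the set of the al' with
   al in Gam.  When m' <> m, the group of m does not account for it. *)
Definition block_swap (m m' : Mvec) : Prop :=
  [/\ m' p1 = m p3, m' p2 = m p4, m' p3 = m p1 & m' p4 = m p2].

Arguments iso_classes F : clear implicits.
Arguments structure_space F : clear implicits.

(* Main.v *)
Require Import Defs.
From HB Require Import structures.
From mathcomp Require Import all_boot all_order all_algebra ring zify.
From mathcomp Require Import finmap boolp classical_sets functions cardinality monalg.
Import GRing.Theory.
Set Implicit Arguments.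
Unset Strict Implicit.
Unset Printing Implicit Defensive.
Local Open Scope ring_scope.
Local Notation index := Defs.index.

(** The semigroup algebra carries total orders of its monomials compatible with
    multiplication (monomial_order_exists); so it is a domain, and its units are
    the multiples of the monomials X a (unit_monomial).  An isomorphism is a map
    f on representatives modulo the central line (niso).

    From isomorphisms to parameters.  The elements with locally finite bracket
    are spanned by 1, X (- s) and the centre (locfin_torus).  Hence f preserves
    the plane of 1 and X (- s), which acts by the derivations D p4 and - D p2,
    and f maps weight vectors to weight vectors.  Moreover f preserves or
    exchanges the two lines of 1 and X (- s) (torus_axis).  The block swap
    x^(a, i) -> (-1)^|i| x^(- a' - s, i') is an isomorphism (sw_niso); composing
    with it, one may assume that the lines are preserved.  For exponents a with
    a4 = 0 and a2 nonzero, the bracket relations imply that the image of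
    X (a + b + s) is a multiple of the product of X s and the images of X a and
    X b.  Applied to a and - a - 2s this makes the image of X a a unit, thus a
    monomial, and its exponent depends linearly on a, with matrix as in the
    group of the theorem (g_monomial, g_exponent1).  The block swap gives the
    same for a2 = 0 and a4 nonzero.  Monomials of weight zero act on both kinds
    of weight spaces and tie the two halves together (shift_generic); this makes
    the images of X a joint eigenvectors when a2 and a4 are both nonzero
    (mixing).  Finally, the variables of the polynomial part are visible as
    Jordan blocks of the derivations, and the block of the second variable
    forces the off-diagonal parameter to vanish when the first variable is
    missing (half_linear).

    From parameters to isomorphisms.  A block diagonal matrix acts by a
    substitution of exponents and variables.  It respects the bracket after the
    monomials have been rescaled by a character with a prescribed value at s
    (subst_br), which exists as the multiplicative group of F is divisible
    (character_exists).  The antidiagonal generators are compositions with the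
    block swap.

    The correspondence.  The first part of the theorem identifies isomorphism
    and equivalence of parameters, except that m may be replaced by its block
    swap.  Thus the isomorphism classes embed into the structure space, and the
    structure space embeds into the product of the isomorphism classes with a
    set of two elements.  The classes being infinite in number, the theorem of
    Cantor and Bernstein provides the bijection (bij_of_double). *)

(** * The semigroup algebra as a commutative algebra *)

(** The ambient algebra with its product as a ring multiplication.  The
    operations are sealed: conversion would otherwise unfold finitely supported
    functions. *)
Record salg (F : fieldType) : Type := Salg { to_amb : Amb F }.

HB.lock Definition szero (F : fieldType) : salg F := Salg 0.
HB.lock Definition sopp (F : fieldType) (u : salg F) : salg F := Salg (- to_amb u).
HB.lock Definition sadd (F : fieldType) (u v : salg F) : salg F := Salg (to_amb u + to_amb v).
HB.lock Definition sscale (F : fieldType) (a : F) (u : salg F) : salg F := Salg (a *: to_amb u).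
HB.lock Definition smul (F : fieldType) (u v : salg F) : salg F := Salg (amul (to_amb u) (to_amb v)).
HB.lock Definition x (F : fieldType) (k : index F) : salg F := Salg (monom k).
HB.lock Definition co (F : fieldType) (k : index F) (u : salg F) : F := mcoeff k (to_amb u).
HB.lock Definition lext (F : fieldType) (f : index F -> salg F) (u : salg F) : salg F :=
  Salg (linear_ext (fun k => to_amb (f k)) (to_amb u)).

Lemma mcoeff_monom (F : fieldType) (k l : index F) :
  mcoeff l (monom k) = (k == l)%:R :> F.
Proof. by rewrite monom.unlock mcoeffU. Qed.

Section Basics.
Variable F : fieldType.
Local Notation A := (salg F).
Local Notation index := (index F).
Implicit Types (u v w : A) (k l : index).

HB.instance Definition _ := gen_eqMixin A.
HB.instance Definition _ := gen_choiceMixin A.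

Lemma to_amb_inj : injective (@to_amb F).
Proof. by move=> [u] [v] /= ->. Qed.

Fact saddA : associative (@sadd F).
Proof. by move=> u v w; apply: to_amb_inj; rewrite sadd.unlock /= addrA. Qed.
Fact saddC : commutative (@sadd F).
Proof. by move=> u v; apply: to_amb_inj; rewrite sadd.unlock /= addrC. Qed.
Fact sadd0 : left_id (szero F) (@sadd F).
Proof. by move=> u; apply: to_amb_inj; rewrite sadd.unlock szero.unlock /= add0r. Qed.
Fact saddN : left_inverse (szero F) (@sopp F) (@sadd F).
Proof.
by move=> u; apply: to_amb_inj; rewrite sadd.unlock szero.unlock sopp.unlock /= addNr.
Qed.
HB.instance Definition _ := GRing.isZmodule.Build A saddA saddC sadd0 saddN.

Lemma to_ambD u v : to_amb (u + v) = to_amb u + to_amb v.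
Proof. by have -> : u + v = sadd u v :> A by []; rewrite sadd.unlock. Qed.
Lemma to_amb0 : to_amb (0 : A) = 0.
Proof. by have -> : 0 = szero F :> A by []; rewrite szero.unlock. Qed.
Lemma to_ambN u : to_amb (- u) = - to_amb u.
Proof. by have -> : - u = sopp u :> A by []; rewrite sopp.unlock. Qed.

Fact sscaleA a b u : sscale a (sscale b u) = sscale (a * b) u.
Proof. by apply: to_amb_inj; rewrite sscale.unlock /= scalerA. Qed.
Fact sscale1 : left_id 1 (@sscale F).
Proof. by move=> u; apply: to_amb_inj; rewrite sscale.unlock /= scale1r. Qed.
Fact sscaleDr : right_distributive (@sscale F) +%R.
Proof. by move=> a u v; apply: to_amb_inj; rewrite to_ambD sscale.unlock /= to_ambD scalerDr. Qed.
Fact sscaleDl u : {morph (@sscale F)^~ u : a b / a + b}.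
Proof. by move=> a b; apply: to_amb_inj; rewrite to_ambD sscale.unlock /= scalerDl. Qed.
HB.instance Definition _ := GRing.Zmodule_isLmodule.Build F A
  sscaleA sscale1 sscaleDr sscaleDl.

Lemma to_ambZ a u : to_amb (a *: u) = a *: to_amb u.
Proof. by have -> : a *: u = sscale a u :> A by []; rewrite sscale.unlock. Qed.
Lemma to_ambB u v : to_amb (u - v) = to_amb u - to_amb v.
Proof. by rewrite to_ambD to_ambN. Qed.

Lemma coD k u v : co k (u + v) = co k u + co k v.
Proof. by rewrite co.unlock to_ambD mcoeffD. Qed.
Lemma co0 k : co k (0 : A) = 0.
Proof. by rewrite co.unlock to_amb0 mcoeff0. Qed.
Lemma coN k u : co k (- u) = - co k u.
Proof. by rewrite co.unlock to_ambN mcoeffN. Qed.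
Lemma coB k u v : co k (u - v) = co k u - co k v.
Proof. by rewrite coD coN. Qed.
Lemma coZ k a u : co k (a *: u) = a * co k u.
Proof. by rewrite co.unlock to_ambZ mcoeffZ. Qed.
Lemma cox k l : co k (x l) = (l == k)%:R :> F.
Proof. by rewrite co.unlock x.unlock /= monom.unlock mcoeffU. Qed.

Lemma salg_eqP u v : (forall k, co k u = co k v) -> u = v.
Proof. by rewrite co.unlock => h; apply: to_amb_inj; apply/malgP. Qed.

Lemma co_finite u : exists s : seq index, forall k, co k u != 0 -> k \in s.
Proof.
by exists (msupp (to_amb u)) => k; rewrite co.unlock -mcoeff_neq0.
Qed.

Lemma monom_ind (Q : A -> Prop) :
  Q 0 -> (forall a k u, Q u -> Q (a *: x k + u)) -> forall u, Q u.
Proof.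
move=> Q0 QD u.
have -> : u = \sum_(k <- msupp (to_amb u)) co k u *: x k.
  apply: to_amb_inj; rewrite (big_morph _ to_ambD to_amb0) [LHS]monalgE.
  apply: eq_bigr => k _; apply/malgP => l.
  rewrite to_ambZ co.unlock x.unlock /= mcoeffZ mcoeff_monom.
  by rewrite mcoeffU mulr_natr.
elim: (X in \sum_(k <- X) _) => [|k s IH]; first by rewrite big_nil.
by rewrite big_cons; apply: QD.
Qed.

Lemma linear_ind (Q : A -> Prop) : (forall k, Q (x k)) -> Q 0 ->
  (forall a u v, Q u -> Q v -> Q (a *: u + v)) -> forall u, Q u.
Proof. by move=> Qx Q0 QD; apply: monom_ind => // a k u; apply: QD. Qed.

Fact lext_is_linear f : linear (@lext F f).
Proof.
move=> a u v; apply: to_amb_inj; rewrite to_ambD to_ambZ lext.unlock /= to_ambD to_ambZ.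
exact: linear_ext_is_linear.
Qed.
HB.instance Definition _ f := GRing.isLinear.Build F A A _ (lext f)
  (lext_is_linear f).
Lemma lextx f k : lext f (x k) = f k.
Proof. by apply: to_amb_inj; rewrite lext.unlock x.unlock /= linear_ext_monom. Qed.

Lemma linear_eq (f g : {linear A -> A}) : (forall k, f (x k) = g (x k)) -> f =1 g.
Proof.
move=> fg; apply: linear_ind => //; first by rewrite !linear0.
by move=> a u v fu fv; rewrite !linearP fu fv.
Qed.

Definition index0 : index := (0, exp0).

Lemma index_addC : commutative (@index_add F).
Proof.
by move=> k l; rewrite /index_add addrC; congr pair; apply/ffunP => p; rewrite !ffunE addnC.
Qed.

Lemma index_addA : associative (@index_add F).
Proof.
move=> k l n; rewrite /index_add addrA; congr pair.
by apply/ffunP => p; rewrite !ffunE addnA.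
Qed.

Lemma index_add0 : left_id index0 (@index_add F).
Proof.
case=> a i; rewrite /index_add add0r; congr pair.
by apply/ffunP => p; rewrite !ffunE.
Qed.

Lemma smulxx k l : smul (x k) (x l) = x (index_add k l).
Proof. by apply: to_amb_inj; rewrite smul.unlock x.unlock /= /amul !linear_ext_monom. Qed.
Lemma smulPl a u v w : smul (a *: u + v) w = a *: smul u w + smul v w.
Proof.
by apply: to_amb_inj; rewrite to_ambD to_ambZ smul.unlock /= to_ambD to_ambZ amulDl.
Qed.
Lemma smulPr a u v w : smul w (a *: u + v) = a *: smul w u + smul w v.
Proof.
by apply: to_amb_inj; rewrite to_ambD to_ambZ smul.unlock /= to_ambD to_ambZ amulDr.
Qed.
Lemma smul0l u : smul 0 u = 0.
Proof. by have := smulPl (-1) 0 0 u; rewrite scaler0 addr0 scaleN1r addNr. Qed.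
Lemma smul0r u : smul u 0 = 0.
Proof. by have := smulPr (-1) 0 0 u; rewrite scaler0 addr0 scaleN1r addNr. Qed.

Fact smulC : commutative (@smul F).
Proof.
move=> u v; elim/linear_ind: u => [k||a u w]; last first.
- by rewrite smulPl smulPr => -> ->.
- by rewrite smul0l smul0r.
elim/linear_ind: v => [l||a u w]; last first.
- by rewrite smulPl smulPr => -> ->.
- by rewrite smul0l smul0r.
by rewrite !smulxx index_addC.
Qed.

Fact smulA : associative (@smul F).
Proof.
move=> u v w; elim/linear_ind: u => [k||a u u' IH IH']; last first.
- by rewrite !smulPl IH IH'.
- by rewrite !smul0l.
elim/linear_ind: v => [l||a v v' IH IH']; last first.
- by rewrite !(smulPl, smulPr) IH IH'.
- by rewrite !(smul0l, smul0r).
elim/linear_ind: w => [n||a w w' IH IH']; last first.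
- by rewrite !(smulPl, smulPr) IH IH'.
- by rewrite !(smul0l, smul0r).
by rewrite !smulxx index_addA.
Qed.

Fact smul1 : left_id (x index0) (@smul F).
Proof.
move=> u; elim/linear_ind: u => [k||a u v IH IH'].
- by rewrite smulxx index_add0.
- by rewrite smul0r.
by rewrite smulPr IH IH'.
Qed.

Fact smulDl : left_distributive (@smul F) +%R.
Proof. by move=> u v w; have := smulPl 1 u v w; rewrite !scale1r. Qed.

Fact smul10 : x index0 != 0 :> A.
Proof.
apply/eqP => /(congr1 (co index0)).
by rewrite cox eqxx co0 => /eqP; rewrite oner_eq0.
Qed.

HB.instance Definition _ := GRing.Zmodule_isComNzRing.Build A
  smulA smulC smul1 smulDl smul10.

Fact smulZl (a : F) (u v : A) : a *: (u * v) = a *: u * v.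
Proof. by have := smulPl a u 0 v; rewrite smul0l !addr0 => /esym. Qed.
HB.instance Definition _ := GRing.Lmodule_isLalgebra.Build F A smulZl.
Fact smulZr (a : F) (u v : A) : a *: (u * v) = u * (a *: v).
Proof. by rewrite mulrC smulZl mulrC. Qed.
HB.instance Definition _ := GRing.Lalgebra_isAlgebra.Build F A smulZr.

Lemma mulxx k l : x k * x l = x (index_add k l).
Proof. exact: smulxx. Qed.
Lemma x1 : x index0 = 1 :> A.
Proof. by []. Qed.
Lemma to_ambM u v : to_amb (u * v) = amul (to_amb u) (to_amb v).
Proof. by have -> : u * v = smul u v :> A by []; rewrite smul.unlock. Qed.

End Basics.

Section Scalars.
Variable F : fieldType.
Local Notation A := (salg F).
(** With the scalars embedded as constants, identities between combinations of
    products become ring identities. *)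
Definition scal (a : F) : A := a *: 1.
Fact scal_zmod_morphism : zmod_morphism scal.
Proof. by move=> a b; rewrite /scal scalerBl. Qed.
Fact scal_monoid_morphism : monoid_morphism scal.
Proof.
by split=> [|a b]; rewrite /scal ?scale1r // -scalerAl mul1r scalerA.
Qed.
HB.instance Definition _ := GRing.isZmodMorphism.Build F A scal scal_zmod_morphism.
HB.instance Definition _ := GRing.isMonoidMorphism.Build F A scal scal_monoid_morphism.
Lemma scaE a (u : A) : a *: u = scal a * u.
Proof. by rewrite /scal mulr_algl. Qed.
End Scalars.

(** * Derivations and the bracket *)

Definition D (F : fieldType) (p : 'I_4) : salg F -> salg F :=
  lext (fun k => k.1 0 p *: x k + (k.2 p)%:R *: x (k.1, exp_dec p k.2)).
HB.instance Definition _ (F : fieldType) p :=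
  GRing.isLinear.Build F (salg F) (salg F) _ (@D F p) (lext_is_linear _).

Definition X (F : fieldType) (a : 'rV[F]_4) : salg F := x (a, exp0).

Section Derivations.
Variable F : fieldType.
Local Notation A := (salg F).
Local Notation index := (index F).
Implicit Types (u v w : A) (k l : index) (a b : 'rV[F]_4) (p q : 'I_4).
Local Notation s := (sigma F).

Lemma Dx p k :
  D p (x k) = k.1 0 p *: x k + (k.2 p)%:R *: x (k.1, exp_dec p k.2).
Proof. exact: lextx. Qed.

Lemma DX p a : D p (X a) = a 0 p *: X a.
Proof. by rewrite Dx /= ffunE scale0r addr0. Qed.

Lemma mulXX a b : X a * X b = X (a + b).
Proof.
by rewrite mulxx /index_add /=; congr (x (_, _)); apply/ffunP => p; rewrite !ffunE.
Qed.

Lemma X0 : X 0 = 1 :> A. Proof. by []. Qed.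

Lemma mulXN a : X a * X (- a) = 1.
Proof. by rewrite mulXX subrr. Qed.

Lemma DZ p (c : F) u : D p (c *: u) = c *: D p u. Proof. exact: linearZ. Qed.
Lemma DD p u v : D p (u + v) = D p u + D p v. Proof. exact: linearD. Qed.
Lemma DB p u v : D p (u - v) = D p u - D p v. Proof. exact: linearB. Qed.

Lemma D1 p : D p (1 : A) = 0.
Proof. by rewrite -X0 DX mxE scale0r. Qed.

Lemma DM p u v : D p (u * v) = D p u * v + u * D p v.
Proof.
elim/linear_ind: u => [k||a u u' IH IH']; last first.
- by rewrite mulrDl -scalerAl !linearP /= IH IH' !scaE; ring.
- by rewrite !(mul0r, linear0) addr0.
elim/linear_ind: v => [l||a v v' IH IH']; last first.
- by rewrite mulrDr -scalerAr !linearP /= IH IH' !scaE; ring.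
- by rewrite !(mulr0, linear0) addr0.
rewrite mulxx !Dx mulrDl mulrDr -!scalerAl -!scalerAr !mulxx /index_add /=.
rewrite mxE ffunE natrD !scalerDl addrACA; congr (_ + _ + (_ + _)).
  case: (posnP (k.2 p)) => [->|kp]; first by rewrite !scale0r.
  congr (_ *: x (_, _)); apply/ffunP => q; rewrite !ffunE.
  by case: eqP => [->|_]; rewrite ?subn0 // addnBAC.
case: (posnP (l.2 p)) => [->|kp]; first by rewrite !scale0r.
congr (_ *: x (_, _)); apply/ffunP => q; rewrite !ffunE.
by case: eqP => [->|_]; rewrite ?subn0 // addnBA.
Qed.

Lemma D_scal p c : D p (scal c : A) = 0.
Proof. by rewrite /scal linearZ /= D1 scaler0. Qed.

Lemma Dcomm p q u : D p (D q u) = D q (D p u).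
Proof.
apply: (linear_eq (f := D p \o D q) (g := D q \o D p)) => k /=.
rewrite !Dx !linearP /= !linearZ /= !Dx /=.
rewrite !scalerDr !scalerA (mulrC (k.1 0 q)) -!addrA; congr (_ + _).
rewrite [in RHS]addrCA; congr (_ + _); first by rewrite mulrC.
rewrite [in LHS]mulrC; congr (_ + _).
case: (eqVneq p q) => [->//|npq].
rewrite !ffunE (negPf npq) eq_sym (negPf npq) !subn0 mulrC.
congr (_ *: x (_, _)).
by apply/ffunP => r; rewrite !ffunE -!subnDA addnC.
Qed.

Definition exp_inc p (i : {ffun 'I_4 -> nat}) : {ffun 'I_4 -> nat} :=
  [ffun q => (i q + (q == p))%N].

Lemma co_D p k u :
  co k (D p u) = k.1 0 p * co k u + (k.2 p).+1%:R * co (k.1, exp_inc p k.2) u.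
Proof.
elim/monom_ind: u => [|a l u IH]; first by rewrite linear0 !co0 !mulr0 addr0.
rewrite linearP /= !(coD, coZ) IH !mulrDr addrACA; congr (_ + _).
rewrite Dx !(coD, coZ) !cox mulrDr; congr (_ + _).
  by case: eqP => [->|_]; rewrite !(mulr1, mulr0) // mulrC.
rewrite [RHS]mulrCA; congr (a * _).
case: (eqVneq l (k.1, exp_inc p k.2)) => [->/=|nl].
  rewrite !ffunE eqxx addn1; congr (_ * _).
  rewrite [X in X == _](_ : _ = k) ?eqxx //; rewrite [RHS]surjective_pairing; congr pair.
  by apply/ffunP => q; rewrite !ffunE addnK.
case: (posnP (l.2 p)) => [->|lp]; first by rewrite mul0r mulr0.
rewrite mulr0; case: eqP => [e|_]; last by rewrite mulr0.
case/eqP: nl; rewrite -e /= [LHS]surjective_pairing; congr pair.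
apply/ffunP => q; rewrite !ffunE; case: eqP => [->|_]; last by rewrite subn0 addn0.
by rewrite subnK.
Qed.

Definition br u v := X s * (D p1 u * D p2 v - D p1 v * D p2 u)
  + (u + D p3 u) * D p4 v - (v + D p3 v) * D p4 u.

Lemma to_amb_D p u : to_amb (D p u) = pd p (to_amb u).
Proof.
rewrite /D lext.unlock /=; congr (linear_ext _ _).
by apply: funext => k; rewrite to_ambD !to_ambZ x.unlock.
Qed.

Lemma to_amb_X a : to_amb (X a) = xpow a.
Proof. by rewrite /X x.unlock. Qed.

Lemma to_amb_br u v : to_amb (br u v) = abracket (to_amb u) (to_amb v).
Proof.
by rewrite /br /abracket !(to_ambB, to_ambD, to_ambM) !to_amb_D to_amb_X.
Qed.

Lemma brC u v : br u v = - br v u.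
Proof. by rewrite /br; ring. Qed.

Lemma brDl (a : F) u v w : br (a *: u + v) w = a *: br u w + br v w.
Proof. by rewrite /br !linearP /= !scaE; ring. Qed.

Lemma brDr (a : F) u v w : br w (a *: u + v) = a *: br w u + br w v.
Proof. by rewrite /br !linearP /= !scaE; ring. Qed.

Lemma br0l w : br 0 w = 0.
Proof. by have := brDl (-1) 0 0 w; rewrite scaler0 addr0 scaleN1r addNr. Qed.
Lemma br0r w : br w 0 = 0.
Proof. by rewrite brC br0l oppr0. Qed.
Lemma brZl c u v : br (c *: u) v = c *: br u v.
Proof. by have := brDl c u 0 v; rewrite br0l !addr0. Qed.
Lemma brZr c u v : br u (c *: v) = c *: br u v.
Proof. by have := brDr c v 0 u; rewrite br0r !addr0. Qed.
Lemma brAr u v w : br w (u + v) = br w u + br w v.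
Proof. by have := brDr 1 u v w; rewrite !scale1r. Qed.

End Derivations.

(** * Total orders on the monomials *)

(** A maximal additive cone avoiding 0 is total: if neither g nor -g could be
    adjoined, the cone would contain positive multiples of both, and hence a
    sum of such multiples equal to 0. *)
Lemma total_cone (G : zmodType)
    (tf : forall (g : G) n, g *+ n.+1 = 0 -> g = 0) (P0 : set G) :
  (forall a b, P0 a -> P0 b -> P0 (a + b)) -> ~ P0 0 ->
  exists P : set G, [/\ forall a, P0 a -> P a,
    forall a b, P a -> P b -> P (a + b), ~ P 0
    & forall g, g <> 0 -> P g \/ P (- g)].
Proof.
move=> P0D P00.
pose cone (C : set G) := (forall a b, C a -> C b -> C (a + b)) /\ ~ C 0.
have [C [[CD C0] Cmax]] : exists C, cone (C `|` P0)%classic /\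
    forall B, (C `<` B)%classic -> ~ cone (B `|` P0)%classic.
  apply: (@Zorn_bigcup _ (fun C => cone (C `|` P0)%classic)) => E EC Etot; split.
    move=> a b [[C EC1 Ca]|P0a] [[B EB Bb]|P0b].
    - have [CB|BC] := Etot _ _ EC1 EB.
        have [h|] := (EC _ EB).1 a b (or_introl (CB _ Ca)) (or_introl Bb); last by right.
        by left; exists B.
      have [h|] := (EC _ EC1).1 a b (or_introl Ca) (or_introl (BC _ Bb)); last by right.
      by left; exists C.
    - have [h|] := (EC _ EC1).1 a b (or_introl Ca) (or_intror P0b); last by right.
      by left; exists C.
    - have [h|] := (EC _ EB).1 a b (or_intror P0a) (or_introl Bb); last by right.
      by left; exists B.
    - by right; apply: P0D.
  by move=> [[C EC1 Ca]|//]; case: (EC _ EC1) => _; apply; left.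
pose P := (C `|` P0)%classic; exists P.
have PM a n : P a -> P (a *+ n.+1).
  by move=> Pa; elim: n => [|n IH]; rewrite ?mulr1n // mulrS; apply: CD.
have ext g : g <> 0 -> ~ P g -> exists n, P (- g *+ n.+1).
  move=> g0 nPg; apply: contrapT => nex.
  pose B : set G := fun a => P a \/ exists n b, a = b + g *+ n.+1 /\ (P b \/ b = 0).
  have CB : (C `<` B)%classic.
    split=> [a Ca|BC]; first by left; left.
    by apply: nPg; left; apply: BC; right; exists 0%N, 0; rewrite add0r; split; auto.
  apply: (Cmax _ CB).
  have -> : (B `|` P0)%classic = B.
    by apply/seteqP; split=> [a [//|P0a]|a Ba]; [left; right|left].
  split; last first.
    case=> [//|[n [b [e [Pb|b0]]]]]; last first.
      by move: e; rewrite b0 add0r => /esym /tf.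
    by apply: nex; exists n; rewrite mulNrn -[- _]add0r e addrK.
  move=> a b [Pa|[n [a' [-> Pa]]]] [Pb|[m [b' [-> Pb]]]].
  - by left; apply: CD.
  - right; exists m, (a + b'); rewrite addrA; split=> //; left.
    by case: Pb => [|->]; [apply: CD|rewrite addr0].
  - right; exists n, (a' + b); rewrite addrAC; split=> //; left.
    by case: Pa => [|->]; [move=> h; apply: CD|rewrite add0r].
  - right; exists (n + m.+1)%N, (a' + b').
    rewrite -addSn mulrnDr addrACA; split=> //.
    by case: Pa Pb => [h|->] [h'|->]; rewrite ?addr0 ?add0r; auto; left; apply: CD.
split=> //; first by move=> a; right.
move=> g g0; apply: contrapT => /not_orP[nP nPN].
have [n Pn] := ext _ g0 nP.
have [|m Pm] := ext (- g) _ nPN; first by move/eqP; rewrite oppr_eq0 => /eqP.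
apply: C0; have := CD _ _ (PM _ m Pn) (PM _ n Pm).
by rewrite opprK -!mulrnA mulNrn mulnC addNr.
Qed.

Section Order.
Variable F : fieldType.
Hypothesis char0 : [pchar F] =i pred0.
Local Notation A := (salg F).
Local Notation index := (index F).
Implicit Types (u v w : A) (k l : index).

Record monomial_order (lt : index -> index -> Prop) : Prop := MonomialOrder {
  lt_irr : forall k, ~ lt k k;
  lt_tr : forall k l n, lt k l -> lt l n -> lt k n;
  lt_tot : forall k l, k = l \/ lt k l \/ lt l k;
  lt_add : forall k l n, lt k l -> lt (index_add k n) (index_add l n) }.

Lemma natrF_eq0 n : (n%:R == 0 :> F) = (n == 0%N).
Proof. by rewrite (pcharf0P F).1. Qed.

(** Integer exponents make the indices a torsion-free group, whose total cones
    are total orders. *)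
Definition embed k : 'rV[F]_4 * {ffun 'I_4 -> int} :=
  (k.1, [ffun p => (k.2 p)%:Z]).

Lemma embedD k l : embed (index_add k l) = embed k + embed l.
Proof.
by rewrite /embed /index_add /=; congr pair; apply/ffunP => p; rewrite !ffunE.
Qed.

Lemma embed_inj : injective embed.
Proof.
case=> [a i] [b j] [/= -> e]; congr pair.
by apply/ffunP => p; move/ffunP/(_ p): e; rewrite !ffunE => -[].
Qed.

(** Besides being compatible with multiplication, the order can be chosen to
    make a prescribed monomial bigger than 1, as well as every polynomial
    variable; the second requirement makes differentiation lower polynomial
    degrees. *)
Lemma monomial_order_exists k0 : k0 <> index0 F ->
  exists lt, [/\ monomial_order lt, lt (index0 F) k0
    & forall k p, lt k (k.1, exp_inc p k.2)].
Proof.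
move=> nk0.
pose P0 : set ('rV[F]_4 * {ffun 'I_4 -> int}) := fun g => g <> 0 /\
  exists n (j : {ffun 'I_4 -> nat}), g = (k0.1 *+ n, [ffun p => (j p)%:Z]).
have tfV (a : 'rV[F]_4) n : a *+ n.+1 = 0 -> a = 0.
  move=> /rowP h; apply/rowP => p; have := h p.
  by rewrite mulmxnE mxE => /eqP; rewrite -mulr_natr mulf_eq0 natrF_eq0 orbF => /eqP.
have tf (g : 'rV[F]_4 * {ffun 'I_4 -> int}) n : g *+ n.+1 = 0 -> g = 0.
  case: g => a i; rewrite [LHS]surjective_pairing.
  rewrite (raddfMn fst) (raddfMn snd) /= => -[/tfV -> h]; congr pair.
  apply/ffunP => p; move/ffunP/(_ p): h; rewrite ffunMnE !ffunE => /eqP.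
  by rewrite Num.Theory.mulrn_eq0 => /eqP.
have [||P [P0P PD P'0 Ptot]] := total_cone tf (P0 := P0).
- move=> g g' [g0 [n [j eg]]] [g1 [m [j' eg']]]; rewrite {g' g1}eg' {}eg in g0 *.
  split; last first.
    exists (n + m)%N, [ffun p => (j p + j' p)%N]; rewrite mulrnDr.
    by congr pair; apply/ffunP => p; rewrite !ffunE.
  move=> [e1 /ffunP e2].
  have j0 p : j p = 0%N /\ j' p = 0%N.
    have := e2 p; rewrite !ffunE => -[/eqP].
    by rewrite addn_eq0 => /andP[/eqP -> /eqP ->].
  have e2' : [ffun p => Posz (j p)] = 0.
    by apply/ffunP => p; rewrite !ffunE (j0 p).1.
  case: n g0 e1 => [|n] g0 e1; first by apply: g0; rewrite e2'.
  by move: e1 g0; rewrite -mulrnDr addSn => /tfV ->; rewrite mul0rn e2'; apply.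
- by case.
exists (fun k l => P (embed l - embed k)); split; first split.
- by move=> k; rewrite subrr.
- move=> k l n kl ln.
  by rewrite -[embed n](subrK (embed l)) -addrA; apply: PD.
- move=> k l; have [/embed_inj|] := pselect (embed k = embed l); first by left.
  move=> n; right; have [|h|h] := Ptot (embed l - embed k).
  + by move/eqP; rewrite subr_eq0 => /eqP /esym.
  + by left.
  + by right; rewrite -opprB.
- by move=> k l n; rewrite !embedD opprD addrACA subrr addr0.
- apply: P0P; rewrite [embed (index0 F)](_ : _ = 0) ?subr0; last first.
    by rewrite /embed /=; congr pair; apply/ffunP => p; rewrite !ffunE.
  split; last by exists 1%N, k0.2; rewrite mulr1n.
  move=> h; apply: nk0; apply: embed_inj; rewrite h; rewrite /embed; congr pair.
  by apply/ffunP => p; rewrite !ffunE.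
move=> k p; apply: P0P.
have -> : embed (k.1, exp_inc p k.2) - embed k
    = (k0.1 *+ 0, [ffun q => (q == p)%:Z]) :> ('rV[F]_4 * {ffun 'I_4 -> int}).
  rewrite /embed /= mulr0n [LHS]surjective_pairing /= subrr; congr pair.
  by apply/ffunP => q; rewrite !ffunE PoszD addrC addKr.
split; last by exists 0%N, [ffun q => nat_of_bool (q == p)]; congr pair;
  apply/ffunP => q; rewrite !ffunE.
by move/(congr1 snd)/ffunP/(_ p); rewrite !ffunE eqxx.
Qed.

Lemma index_addI k : injective (index_add k).
Proof.
move=> l n /(congr1 embed); rewrite !embedD => /addrI; exact: embed_inj.
Qed.

(** * Supports *)

Definition supp_in (Q : index -> Prop) u := forall k, co k u != 0 -> Q k.

Lemma supp_ind (Q : index -> Prop) (R : A -> Prop) : R 0 ->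
  (forall a k u, Q k -> R u -> R (a *: x k + u)) ->
  forall u, supp_in Q u -> R u.
Proof.
move=> R0 RD u.
have [s su] := co_finite u; elim: s u su => [|k s IH] u su Qu.
  suff -> : u = 0 by [].
  by apply: salg_eqP => k; rewrite co0; apply/eqP/negPn/negP => /su.
have [k0|k0] := eqVneq (co k u) 0.
  apply: IH => // l lu; have := su l lu; rewrite inE => /orP[/eqP e|//].
  by rewrite e k0 eqxx in lu.
rewrite -[u](subrK (co k u *: x k)) addrC; apply: RD; first exact: Qu.
have h l : co l (u - co k u *: x k) != 0 -> l != k /\ co l u != 0.
  rewrite coB coZ cox; case: (eqVneq k l) => [->|nkl]; first by rewrite mulr1 subrr eqxx.
  by rewrite mulr0 subr0.
apply: IH => l /h[lk lu]; last exact: Qu.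
by have := su l lu; rewrite inE (negPf lk).
Qed.

Lemma supp_inP u Q a v : supp_in Q u -> supp_in Q v -> supp_in Q (a *: u + v).
Proof.
move=> Qu Qv k; rewrite coD coZ; have [->|/Qu//] := eqVneq (co k u) 0.
by rewrite mulr0 add0r => /Qv.
Qed.

Lemma supp_in0 Q : supp_in Q 0.
Proof. by move=> k; rewrite co0 eqxx. Qed.

Lemma supp_inx (Q : index -> Prop) k : Q k -> supp_in Q (x k).
Proof. by move=> Qk l; rewrite cox; case: (eqVneq k l) => [<-//|_]; rewrite eqxx. Qed.

Lemma supp_inW (Q R : index -> Prop) u :
  (forall k, Q k -> R k) -> supp_in Q u -> supp_in R u.
Proof. by move=> QR Qu k /Qu/QR. Qed.

Lemma supp_inD u Q v : supp_in Q u -> supp_in Q v -> supp_in Q (u + v).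
Proof. by move=> Qu Qv; rewrite -[u]scale1r; apply: supp_inP. Qed.
Lemma supp_inZ u Q a : supp_in Q u -> supp_in Q (a *: u).
Proof. by move=> Qu; rewrite -[a *: u]addr0; apply: supp_inP => //; apply: supp_in0. Qed.
Lemma supp_inN u Q : supp_in Q u -> supp_in Q (- u).
Proof. by move=> Qu; rewrite -scaleN1r; apply: supp_inZ. Qed.
Lemma supp_inB u Q v : supp_in Q u -> supp_in Q v -> supp_in Q (u - v).
Proof. by move=> Qu /supp_inN; apply: supp_inD. Qed.

Lemma supp_inM (Q R T : index -> Prop) u v :
  (forall k l, Q k -> R l -> T (index_add k l)) ->
  supp_in Q u -> supp_in R v -> supp_in T (u * v).
Proof.
move=> QRT + Rv; elim/supp_ind => [|a k {}u Qk IH].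
  by rewrite mul0r; apply: supp_in0.
rewrite mulrDl -scalerAl; apply: supp_inP => // {IH}.
elim/supp_ind: Rv => [|b l {}v Rl IH']; first by rewrite mulr0; apply: supp_in0.
by rewrite mulrDr -scalerAr mulxx; apply: supp_inP => //; apply: supp_inx; apply: QRT.
Qed.

Lemma supp_in_D (Q : index -> Prop) p u :
  (forall k, Q k -> k.2 p <> 0%N -> Q (k.1, exp_dec p k.2)) ->
  supp_in Q u -> supp_in Q (D p u).
Proof.
move=> Qd; elim/supp_ind => [|a k {}u Qk IH]; first by rewrite linear0; apply: supp_in0.
rewrite linearP /=; apply: supp_inP => //; rewrite Dx.
apply: supp_inP; first exact: supp_inx.
have [->|kp] := eqVneq (k.2 p) 0%N; first by rewrite scale0r; apply: supp_in0.
by apply: supp_inZ; apply: supp_inx; apply: Qd => //; apply/eqP.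
Qed.

Section Leading.
Variable lt : index -> index -> Prop.
Hypothesis ltO : monomial_order lt.
Definition le k l := k = l \/ lt k l.
Definition bnd k u := supp_in (fun l => le l k) u.

Lemma le_tr k l n : le k l -> le l n -> le k n.
Proof.
by case=> [->//|kl] [<-|ln]; right=> //; apply: lt_tr kl ln.
Qed.

Lemma le_add k l n : le k l -> le (index_add k n) (index_add l n).
Proof. by case=> [->|h]; [left|right; apply: lt_add]. Qed.

Lemma le_add2 k l n m : le k l -> le n m -> le (index_add k n) (index_add l m).
Proof.
move=> kl nm; apply: (le_tr (le_add n kl)).
by rewrite ![index_add l _]index_addC; apply: le_add.
Qed.

Lemma lt_nle k l : lt k l -> ~ le l k.
Proof.
move=> h [e|h']; apply: (lt_irr ltO (k := k)); last exact: lt_tr h h'.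
by rewrite -{2}e.
Qed.

Lemma bnd_top u : u <> 0 -> exists k, co k u != 0 /\ bnd k u.
Proof.
move=> u0; have [s su] := co_finite u.
have {u0} [k ku ks] : exists2 k, co k u != 0 & k \in s.
  apply: contrapT => h; apply: u0; apply: salg_eqP => k; rewrite co0.
  by apply/eqP/negPn/negP => ku; apply: h; exists k => //; apply: su.
suff [m [mu mtop]] : exists m, co m u != 0 /\
    forall l, l \in s -> co l u != 0 -> le l m.
  by exists m; split=> // l lu; apply: mtop => //; apply: su.
elim: s k {su} ks ku => [//|l s IH] k; rewrite inE => ks ku.
have [[k' [k's k'u]]|nex] := pselect (exists k', k' \in s /\ co k' u != 0).
  have [m [mu mtop]] := IH _ k's k'u.
  have [e|[h|h]] := lt_tot ltO m l.
  - by exists m; split=> // n; rewrite inE => /orP[/eqP->|]; [rewrite e; left|apply: mtop].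
  - have [lu|lu] := eqVneq (co l u) 0.
      exists m; split=> // n; rewrite inE => /orP[/eqP->|]; last exact: mtop.
      by rewrite lu eqxx.
    exists l; split=> // n; rewrite inE => /orP[/eqP->|ns nu]; first by left.
    by apply: (le_tr (mtop _ ns nu)); right.
  - exists m; split=> // n; rewrite inE => /orP[/eqP->|]; last exact: mtop.
    by right.
case/orP: ks => [/eqP e|ks]; last by case: nex; exists k.
exists k; split=> // n; rewrite inE => /orP[/eqP->|ns nu]; first by left.
by case: nex; exists n.
Qed.

Lemma bnd0 k u : bnd k u -> forall l, lt k l -> co l u = 0.
Proof. by move=> ku l kl; apply/eqP/negPn/negP => /ku /(lt_nle kl). Qed.

(** Leading terms multiply: no other pair of monomials reaches the sum of the
    two leading indices. *)
Lemma bndM k l u v : bnd k u -> bnd l v ->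
  bnd (index_add k l) (u * v) /\ co (index_add k l) (u * v) = co k u * co l v.
Proof.
move=> ku lv; split.
  by apply: supp_inM ku lv => n m nk ml; apply: le_add2.
elim/supp_ind: ku => [|a n {}u nk IH]; first by rewrite mul0r !co0 mul0r.
rewrite mulrDl -scalerAl !(coD, coZ) IH mulrDl -mulrA; congr (a * _ + _).
elim/supp_ind: lv {IH} => [|b m {}v ml IH]; first by rewrite mulr0 !co0 mulr0.
rewrite mulrDr -scalerAr mulxx !(coD, coZ) IH mulrDr mulrCA; congr (b * _ + _).
rewrite !cox; case: (eqVneq n k) => [->|nk'].
  by rewrite mul1r; congr (nat_of_bool _)%:R; apply/eqP/eqP => [/index_addI|->].
rewrite mul0r; case: eqP => // e; case: nk => [e'|nk]; first by rewrite e' eqxx in nk'.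
have /lt_nle := lt_add ltO m nk; rewrite e; case.
by rewrite ![index_add k _]index_addC; apply: le_add.
Qed.

End Leading.

Lemma salg_mul_neq0 u v : u <> 0 -> v <> 0 -> u * v <> 0.
Proof.
move=> u0 v0.
have [|lt [ltO _ _]] := @monomial_order_exists (delta_mx 0 ord0, exp0).
  by case=> /rowP/(_ ord0)/eqP; rewrite !mxE eqxx oner_eq0.
have [k [ku kb]] := bnd_top ltO u0; have [l [lv lb]] := bnd_top ltO v0.
have [_ e] := bndM ltO kb lb => uv0.
by move/eqP: e; rewrite uv0 co0 eq_sym mulf_eq0 (negPf ku) (negPf lv).
Qed.

Lemma salg_mulI u v w : u <> 0 -> u * v = u * w -> v = w.
Proof.
move=> u0 e; apply: contrapT => vw.
apply: (salg_mul_neq0 u0 (v := v - w)); last by rewrite mulrBr e subrr.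
by move/eqP; rewrite subr_eq0 => /eqP.
Qed.

(** The top terms of the two factors of 1 multiply to 1, and so do their bottom
    terms; hence top and bottom agree. *)
Lemma unit_monomial u v : u * v = 1 -> exists c a, c != 0 /\ u = c *: X a.
Proof.
move=> uv.
have u0 : u <> 0 by move=> u0; move/eqP: uv; rewrite u0 mul0r eq_sym oner_eq0.
have v0 : v <> 0 by move=> v0; move/eqP: uv; rewrite v0 mulr0 eq_sym oner_eq0.
have [|lt [ltO _ _]] := @monomial_order_exists (delta_mx 0 ord0, exp0).
  by case=> /rowP/(_ ord0)/eqP; rewrite !mxE eqxx oner_eq0.
have gtO : monomial_order (fun k l => lt l k).
  split; [exact: lt_irr|by move=> k l n kl ln; apply: lt_tr ln kl| |].
    by move=> k l; have [->|[]] := lt_tot ltO k l; auto.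
  by move=> k l n; apply: lt_add.
have [k [ku kb]] := bnd_top ltO u0; have [l [lv lb]] := bnd_top ltO v0.
have [k' [ku' kb']] := bnd_top gtO u0; have [l' [lv' lb']] := bnd_top gtO v0.
have [_ e] := bndM ltO kb lb; have [_ e'] := bndM gtO kb' lb'.
have kl0 : index_add k l = index0 F.
  have [//|n0] := eqVneq (index_add k l) (index0 F).
  move: e; rewrite uv -x1 cox eq_sym (negPf n0) => /esym/eqP.
  by rewrite mulf_eq0 (negPf ku) (negPf lv).
have kl0' : index_add k' l' = index0 F.
  have [//|n0] := eqVneq (index_add k' l') (index0 F).
  move: e'; rewrite uv -x1 cox eq_sym (negPf n0) => /esym/eqP.
  by rewrite mulf_eq0 (negPf ku') (negPf lv').
have ek : k' = k.
  case: (kb k' ku') => // kk'; have := lb l' lv' => ll'.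
  have := lt_add ltO l' kk'; rewrite kl0' -kl0 => /lt_nle; case => //.
  by rewrite ![index_add k _]index_addC; apply: le_add.
have k2 : k.2 = exp0.
  apply/ffunP => p; have := congr1 (fun k : index => k.2 p) kl0.
  by rewrite /= !ffunE => /eqP; rewrite addn_eq0 => /andP[/eqP].
exists (co k u), k.1; split=> //; apply: salg_eqP => n; rewrite coZ cox /X -k2 -surjective_pairing.
case: eqP => [->|nk]; first by rewrite mulr1.
rewrite mulr0; apply/eqP/negPn/negP => nu.
have := kb' n nu; rewrite ek => -[/esym//|h].
by apply: (lt_nle ltO h); apply: kb.
Qed.

(** * Joint eigenvectors of the derivations *)

(** In characteristic 0, a term of the wrong weight would entail terms of
    unbounded degree, and a term of the right weight and positive degree has a
    nonzero derivative of smaller degree. *)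
Lemma D_eigen p e u : D p u = e *: u ->
  supp_in (fun k => k.1 0 p = e /\ k.2 p = 0%N) u.
Proof.
move=> Du.
have rec k : (e - k.1 0 p) * co k u = (k.2 p).+1%:R * co (k.1, exp_inc p k.2) u.
  by rewrite mulrBl -coZ -Du co_D addrC addKr.
have inc1 k : (k.1, exp_inc p k.2).2 p = (k.2 p).+1 by rewrite ffunE eqxx addn1.
have H1 k : co k u != 0 -> k.1 0 p = e.
  move=> ku; apply/eqP; apply: contraTT isT => ke.
  pose it n := iter n (fun k : index => (k.1, exp_inc p k.2)) k.
  have it1 n : (it n).1 = k.1 by elim: n => //.
  have itu n : co (it n) u != 0.
    elim: n => // n IH; apply: contraNneq IH => h.
    have := rec (it n); rewrite h mulr0 it1 => /eqP.
    by rewrite mulf_eq0 subr_eq0 eq_sym (negPf ke).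
  have it2 n : (it n).2 p = (k.2 p + n)%N.
    by elim: n => [|n IH]; rewrite ?addn0 // /it iterS inc1 -/(it n) IH addnS.
  have [s su] := co_finite u.
  have : {subset [seq it n | n <- iota 0 (size s).+1] <= s}.
    by move=> _ /mapP[n _ ->]; apply: su.
  move/uniq_leq_size; rewrite map_inj_in_uniq ?iota_uniq; last first.
    move=> n m _ _ /(congr1 (fun k : index => k.2 p)); rewrite !it2; exact: addnI.
  by move/(_ isT); rewrite size_map size_iota ltnn.
move=> k ku; split; first exact: H1.
apply/eqP; apply: contraTT ku => k2; rewrite negbK.
have e2 : k = (k.1, exp_inc p (exp_dec p k.2)).
  rewrite [LHS]surjective_pairing; congr pair; apply/ffunP => q; rewrite !ffunE.
  by case: eqP => [->|_]; rewrite ?subn0 ?addn0 // subnK // lt0n.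
have [//|ku] := eqVneq (co k u) 0.
have := rec (k.1, exp_dec p k.2); rewrite /= -e2 (H1 _ ku) subrr mul0r => /esym/eqP.
by rewrite mulf_eq0 natrF_eq0 (negPf ku).
Qed.

Lemma joint_eigen u (a : 'rV[F]_4) : (forall p, D p u = a 0 p *: u) ->
  exists c, u = c *: X a.
Proof.
move=> Du; exists (co (a, exp0) u); apply: salg_eqP => k; rewrite coZ cox.
case: eqP => [->|nk]; first by rewrite mulr1.
rewrite mulr0; apply/eqP/negPn/negP => ku; apply: nk.
rewrite [RHS]surjective_pairing; congr pair; first apply/rowP => p.
  by have [-> _] := D_eigen (Du p) ku.
by apply/ffunP => p; have [_ ->] := D_eigen (Du p) ku; rewrite ffunE.
Qed.

End Order.

(** * Locally finite elements *)

Section LocallyFinite.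
Variable F : fieldType.
Hypothesis char0 : [pchar F] =i pred0.
Local Notation A := (salg F).
Local Notation index := (index F).
Implicit Types (u v w : A) (k l : index).
Local Notation s := (sigma F).
Local Notation s1 := (sigma1 F).

Lemma at_posE (a : F) p q : at_pos a p 0 q = a * (p == q)%:R.
Proof. by rewrite !mxE eqxx /= eq_sym. Qed.

Lemma sigmaE : (s 0 p1 = 1) * (s 0 p2 = 0) * (s 0 p3 = 1) * (s 0 p4 = 0).
Proof. by rewrite !mxE /= !(mulr0, mulr1, addr0, add0r). Qed.

Lemma sigma1E : (s1 0 p1 = 0) * (s1 0 p2 = 0) * (s1 0 p3 = -1) * (s1 0 p4 = 0).
Proof. by rewrite !mxE /= !(mulr0, mulr1, addr0, add0r). Qed.

Lemma ord4P (P : 'I_4 -> Prop) : P p1 -> P p2 -> P p3 -> P p4 -> forall p, P p.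
Proof.
move=> h1 h2 h3 h4 [[|[|[|[|//]]]] i].
- by rewrite (_ : Ordinal i = p1) //; apply: val_inj.
- by rewrite (_ : Ordinal i = p2) //; apply: val_inj.
- by rewrite (_ : Ordinal i = p3) //; apply: val_inj.
- by rewrite (_ : Ordinal i = p4) //; apply: val_inj.
Qed.

Lemma rV4P (a b : 'rV[F]_4) : a 0 p1 = b 0 p1 -> a 0 p2 = b 0 p2 ->
  a 0 p3 = b 0 p3 -> a 0 p4 = b 0 p4 -> a = b.
Proof. by move=> h1 h2 h3 h4; apply/rowP; apply: ord4P. Qed.

Lemma intrF_eq0 (z : int) : (z%:~R == 0 :> F) = (z == 0).
Proof.
by case: z => n; rewrite ?NegzE ?rmorphN /= ?oppr_eq0 -pmulrn natrF_eq0.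
Qed.

(** The values of the functional along a line have the form w - r B with r a
    natural number.  If it were not constant, they would form a progression
    unbounded in both directions, which the bound below on r excludes. *)
Lemma nat_values_const (L B w : F) :
  (forall z : int, exists r : nat, z%:~R * L + r%:R * B = w) -> L = 0.
Proof.
move=> h; have [r0 e0] := h 0; have [r1 e1] := h 1.
have eL : L = (r0%:R - r1%:R) * B.
  by move: e1; rewrite -e0 mul0r add0r mul1r mulrBl => /(canRL (addrK _)).
have [B0|B0] := eqVneq B 0; first by rewrite eL B0 mulr0.
pose q := (r0%:Z - r1%:Z)%R.
have eq : r0%:R - r1%:R = q%:~R :> F by rewrite rmorphB /= -!pmulrn.
have [r e] := h (q * r0.+1%:Z).
have {}e : (q * r0.+1%:Z * q + r%:Z - r0%:Z)%:~R = 0 :> F.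
  rewrite rmorphB rmorphD rmorphM /= -!pmulrn; apply/eqP; rewrite subr_eq0; apply/eqP.
  apply: (mulIf B0); rewrite mulrDl -mulrA -eq -eL e -e0; by rewrite mul0r add0r.
move/eqP: e; rewrite intrF_eq0 => /eqP e.
have : q = 0.
  apply/eqP; apply: contraTT isT => q0.
  have : (1 <= q * q) by rewrite -gtz0_ge1 -expr2 Num.Theory.exprn_even_gt0.
  nia.
by rewrite eL eq => ->; rewrite mul0r.
Qed.

(** Over an algebraically closed field this says that v lies in a
    finite-dimensional subspace stable under f. *)
Definition locfin (f : A -> A) v :=
  exists cs : seq F, foldr (fun c w => f w - c *: w) v cs = 0.

(** The shape of the operators br u; it treats uniformly the four coefficients
    built from u. *)
Definition hamil (W : 'I_4 -> A) v := W p1 * D p2 v - W p2 * D p1 v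
  + W p3 * D p4 v - W p4 * D p3 v - W p4 * v.

Lemma brE u v : br u v = hamil (fun p => if p == p1 then X s * D p1 u
  else if p == p2 then X s * D p2 u else if p == p3 then u + D p3 u
  else D p4 u) v.
Proof. by rewrite /br /hamil /=; ring. Qed.

Section Leading.
Variable lt : index -> index -> Prop.
Hypothesis ltO : monomial_order lt.
Hypothesis lt_inc : forall k p, lt k (k.1, exp_inc p k.2).

Lemma bnd_D k p v : bnd lt k v ->
  bnd lt k (D p v) /\ co k (D p v) = k.1 0 p * co k v.
Proof.
move=> kv; split; last first.
  by rewrite co_D (bnd0 ltO kv (lt_inc k p)) mulr0 addr0.
apply: supp_in_D kv => l lk lp; apply: (le_tr ltO _ lk); right.
have := lt_inc (l.1, exp_dec p l.2) p.
rewrite /= [X in lt _ X](_ : _ = l) // [RHS]surjective_pairing; congr pair; apply/ffunP => q; rewrite !ffunE.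
by case: eqP => [->|_]; rewrite ?subn0 ?addn0 // subnK // lt0n; apply/eqP.
Qed.

Lemma bnd_hamil W b k v : (forall p, bnd lt b (W p)) -> bnd lt k v ->
  bnd lt (index_add b k) (hamil W v) /\
  co (index_add b k) (hamil W v) =
    (co b (W p1) * k.1 0 p2 - co b (W p2) * k.1 0 p1 + co b (W p3) * k.1 0 p4
     - co b (W p4) * k.1 0 p3 - co b (W p4)) * co k v.
Proof.
move=> bW kv.
have h p q : bnd lt (index_add b k) (W p * D q v) /\
    co (index_add b k) (W p * D q v) = co b (W p) * (k.1 0 q * co k v).
  by have [h1 <-] := bnd_D q kv; apply: bndM.
have [h4 e4] := bndM ltO (bW p4) kv.
split; last first.
  rewrite /hamil !(coB, coD) e4 !(h _ _).2; ring.
by rewrite /hamil; do ?[apply: supp_inB|apply: supp_inD] => //; apply: (h _ _).1.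
Qed.

Lemma common_top (us : seq A) : (exists2 u, u \in us & u <> 0) ->
  exists k, (exists2 u, u \in us & co k u != 0) /\ forall u, u \in us -> bnd lt k u.
Proof.
elim: us => [[]//|u us IH] [v + v0]; rewrite inE => vus.
have [[v' v'us v'0]|nex] := pselect (exists2 u, u \in us & u <> 0); last first.
  have {}vus : v = u by case/orP: vus => [/eqP//|vus]; case: nex; exists v.
  rewrite {v}vus in v0.
  have [k [ku kb]] := bnd_top ltO v0.
  exists k; split; first by exists u; rewrite ?mem_head.
  move=> u'; rewrite inE => /orP[/eqP-> //|u'us].
  suff -> : u' = 0 by apply: supp_in0.
  by apply: contrapT => u'0; apply: nex; exists u'.
have [|k [[w wus wk] kb]] := IH; first by exists v'.
have [u0|/eqP u0] := eqVneq u 0.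
  exists k; split; first by exists w => //; rewrite inE wus orbT.
  by move=> u'; rewrite inE => /orP[/eqP->|/kb//]; rewrite u0; apply: supp_in0.
have [l [lu lb]] := bnd_top ltO u0.
have up k' l' u' : le lt k' l' -> bnd lt k' u' -> bnd lt l' u'.
  by move=> kl; apply: supp_inW => n; move=> h; apply: (le_tr ltO h kl).
have [kl|lk] : le lt k l \/ le lt l k.
  by have [->|[]] := lt_tot ltO k l; [left; left|left; right|right; right].
- exists l; split; first by exists u; rewrite ?mem_head.
  by move=> u'; rewrite inE => /orP[/eqP->//|/kb]; apply: up.
- exists k; split; first by exists w => //; rewrite inE wus orbT.
  by move=> u'; rewrite inE => /orP[/eqP->|/kb//]; apply: up lb.
Qed.

End Leading.

(** If some coefficient is not constant, the order may be chosen so that the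
    largest leading monomial b of the coefficients is bigger than 1.  Then the
    operator moves the leading monomial of any element by b, unless a scalar
    factor vanishes, and so does any of its translates by scalars.  Local
    finiteness on the monomials of a coordinate axis thus makes that factor
    vanish all along the axis, up to a multiple of the shift, and
    nat_values_const kills the leading coefficients. *)
Lemma locfin_constant W :
  (forall p, exists2 a : F, a != 0 &
    forall z : int, locfin (hamil W) (X (at_pos (z%:~R * a) p))) ->
  forall p, supp_in (fun k => k = index0 F) (W p).
Proof.
move=> lf p0 k0 k0W; apply: contrapT => nk0.
have [lt [ltO lt0k0 lt_inc]] := monomial_order_exists char0 nk0.
have [|b [[u + bu] bb]] := @common_top lt ltO [:: W p1; W p2; W p3; W p4].
  exists (W p0); last by move=> h; move: k0W; rewrite h co0 eqxx.
  by elim/ord4P: p0 {k0W}; rewrite !inE eqxx ?orbT.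
have {}bb p : bnd lt b (W p).
  by apply: bb; elim/ord4P: p; rewrite !inE eqxx ?orbT.
have lt0b : lt (index0 F) b.
  by case: (bb p0 _ k0W) => [<-//|]; apply: lt_tr.
pose lam (a : 'rV[F]_4) := co b (W p1) * a 0 p2 - co b (W p2) * a 0 p1
  + co b (W p3) * a 0 p4 - co b (W p4) * a 0 p3.
have lamD a a' : lam (a + a') = lam a + lam a' by rewrite /lam !mxE; ring.
have lamZ c a : lam (c *: a) = c * lam a by rewrite /lam !mxE; ring.
pose it g n := iter n (index_add b) (g, exp0).
have it1 g n : (it g n).1 = b.1 *+ n + g.
  by elim: n => [|n IH]; rewrite ?add0r // mulrS -addrA -IH.
(* After n steps the factor is lam g + n lam b - co b (W p4). *)
have key g : locfin (hamil W) (X g) -> exists r : nat, lam g + r%:R * lam b.1 = co b (W p4).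
  case=> cs cs0; apply: contrapT => nex.
  suff [_] : bnd lt (it g (size cs)) (foldr (fun c w => hamil W w - c *: w) (X g) cs) /\
      co (it g (size cs)) (foldr (fun c w => hamil W w - c *: w) (X g) cs) != 0.
    by rewrite cs0 co0 eqxx.
  elim: cs {cs0} => [|c cs [IH1 IH2]] /=.
    by split; [apply: supp_inx; left|rewrite cox eqxx oner_eq0].
  rewrite -/(it g (size cs)); set w := foldr _ _ _ in IH1 IH2 *.
  have [h1 h2] := bnd_hamil ltO lt_inc bb IH1.
  have lti : lt (it g (size cs)) (index_add b (it g (size cs))).
    by have := lt_add ltO (it g (size cs)) lt0b; rewrite index_add0.
  split.
    apply: supp_inB => //; apply: supp_inZ; apply: supp_inW IH1 => k.
    by move=> h; apply: (le_tr ltO h); right.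
  rewrite coB coZ (bnd0 ltO IH1 lti) mulr0 subr0 h2 mulf_neq0 //.
  rewrite subr_eq0 -[X in X != _]/(lam (it g (size cs)).1) it1; apply/eqP => e; apply: nex.
  by exists (size cs); rewrite -e lamD -scaler_nat lamZ addrC.
have lam0 p : lam (at_pos 1 p) = 0.
  have [a a0 lfa] := lf p.
  have : lam (at_pos a p) = 0.
    apply: (@nat_values_const _ (lam b.1) (co b (W p4))) => z.
    have [r e] := key _ (lfa z); exists r; rewrite -e; congr (_ + _).
    by rewrite -lamZ /at_pos scalerA.
  rewrite /at_pos -[a]mulr1 -scalerA lamZ => /eqP.
  by rewrite mulf_eq0 (negPf a0) => /eqP.
have w2 : co b (W p2) = 0.
  by have := lam0 p1; rewrite /lam !at_posE /= !(mulr0, mulr1, subr0, addr0, add0r) => /eqP; rewrite oppr_eq0 => /eqP.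
have w1 : co b (W p1) = 0.
  by have := lam0 p2; rewrite /lam !at_posE /= !(mulr0, mulr1, subr0, addr0, add0r).
have w4 : co b (W p4) = 0.
  by have := lam0 p3; rewrite /lam !at_posE /= !(mulr0, mulr1, subr0, addr0, add0r, sub0r) => /eqP; rewrite oppr_eq0 => /eqP.
have w3 : co b (W p3) = 0.
  by have := lam0 p4; rewrite /lam !at_posE /= !(mulr0, mulr1, subr0, addr0, add0r).
by rewrite !inE => /or4P[] /eqP e; move: bu; rewrite e ?w1 ?w2 ?w3 ?w4 eqxx.
Qed.

Lemma supp_index0 u : supp_in (fun k => k = index0 F) u -> exists c, u = scal c.
Proof.
move=> h; exists (co (index0 F) u); apply: salg_eqP => k; rewrite /scal coZ -x1 cox.
case: eqP => [->|nk]; first by rewrite mulr1.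
by rewrite mulr0; apply/eqP/negPn/negP => /h /esym.
Qed.

Lemma scal_inj : injective (@scal F).
Proof.
move=> a b /(congr1 (co (index0 F))); rewrite /scal !coZ -x1 cox eqxx !mulr1; exact.
Qed.

Lemma torus_of_constants u c1 c3 : D p1 u = c1 *: X (- s) -> D p2 u = 0 ->
  u + D p3 u = scal c3 -> D p4 u = 0 ->
  exists c, u = c3 *: 1 - c1 *: X (- s) + c *: X s1.
Proof.
move=> e1 e2 e3 e4.
have [|c e] := @joint_eigen F char0 (u - scal c3 + c1 *: X (- s)) s1.
  have D3 : D p3 u = scal c3 - u by rewrite -e3 addrC addKr.
  apply: ord4P; rewrite sigma1E ?scale0r linearD linearB /= D_scal linearZ /= DX;
  rewrite mxE sigmaE ?(e1, e2, D3, e4) ?(oppr0, subr0, scale0r, scaler0, addr0) //.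
    by rewrite scaleN1r scalerN subrr.
  by rewrite !scaleN1r scalerN !opprD opprK [- u + _]addrC.
by exists c; rewrite -e -/(scal c3); ring.
Qed.

(** By locfin_constant the four coefficients of br u are constants.  That D p1
    and D p2 commute, and that D p4 kills constants, makes the second and fourth
    of them vanish; then u differs from an explicit solution by a joint
    eigenvector of weight s1. *)
Lemma locfin_torus u :
  (forall p, exists2 a : F, a != 0 &
    forall z : int, locfin (br u) (X (at_pos (z%:~R * a) p))) ->
  exists a b c, u = a *: 1 + b *: X (- s) + c *: X s1.
Proof.
set W := fun p => if p == p1 then X s * D p1 u
  else if p == p2 then X s * D p2 u else if p == p3 then u + D p3 u
  else D p4 u.
move=> lf; have lfW : forall p, exists2 a : F, a != 0 &
    forall z : int, locfin (hamil W) (X (at_pos (z%:~R * a) p)).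
  move=> p; have [a a0 h] := lf p; exists a => // z.
  by rewrite (_ : hamil W = br u) //; apply: funext => v; rewrite brE.
have cW p := supp_index0 (locfin_constant lfW (p := p)).
have XsI v c : X s * v = scal c -> v = c *: X (- s).
  by move=> e; rewrite -[v]mul1r -(mulXN (- s)) opprK -mulrA e scaE mulrC.
have [c1 /XsI e1] := cW p1; have [c2 /XsI e2] := cW p2.
have [c3 e3] := cW p3; have [c4 e4] := cW p4.
rewrite {cW lfW}/W /= in e1 e2 e3 e4.
have c20 : c2 = 0.
  have := Dcomm p1 p2 u; rewrite e1 e2 !linearZ /= !DX !mxE /=.
  rewrite !(mulr0, mulr1, addr0, oppr0, scale0r, scaler0) => /eqP.
  rewrite scalerA scaler_eq0 mulrN1 oppr_eq0 => /orP[/eqP//|/eqP X0'].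
  by have := mulXN s; rewrite X0' mulr0 => /eqP; rewrite eq_sym oner_eq0.
have c40 : c4 = 0.
  have : D p4 (u + D p3 u) = 0 by rewrite e3 D_scal.
  rewrite linearD /= Dcomm e4 D_scal addr0 -[0](rmorph0 (@scal F)); exact: scal_inj.
rewrite {}c20 {c2} scale0r in e2; rewrite {}c40 {c4} rmorph0 in e4.
have [c ->] := torus_of_constants e1 e2 e3 e4.
by exists c3, (- c1), c; rewrite scaleNr.
Qed.

End LocallyFinite.

(** * The simple Lie algebras inside the semigroup algebra *)

(** The representative without central component of a class modulo the line of
    X s1. *)
Definition nrm (F : fieldType) (u : salg F) : salg F :=
  u - co (sigma1 F, exp0) u *: X (sigma1 F).

Definition inA (F : fieldType) (m : Mvec) (G : set 'rV[F]_4) : set (salg F) :=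
  supp_in (fun k => G k.1 /\ Jset m k.2).

Inductive der (F : fieldType) (m : Mvec) (G : set 'rV[F]_4) : salg F -> Prop :=
| der0 : der m G 0
| derP a u v w : inA m G u -> inA m G v -> der m G w ->
    der m G (a *: br u v + w).

(** The preimage in the semigroup algebra of the derived algebra of the
    quotient by the central line. *)
Definition lie (F : fieldType) (m : Mvec) (G : set 'rV[F]_4) : set (salg F) :=
  [set u | inA m G u /\ exists2 w, der m G w & nrm u = nrm w].

(** Together with nonzero points on the four axes, this is the part of Omega
    on which the arguments rely. *)
Definition subgrp (F : fieldType) (G : set 'rV[F]_4) :=
  add_subgroup G /\ G (sigma F).

Section Coordinates.
Variable F : fieldType.
Implicit Types a b : 'rV[F]_4.
Lemma rvD a b p : (a + b) 0 p = a 0 p + b 0 p. Proof. by rewrite mxE. Qed.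
Lemma rvN a p : (- a) 0 p = - a 0 p. Proof. by rewrite mxE. Qed.
Lemma rvZ (c : F) a p : (c *: a) 0 p = c * a 0 p. Proof. by rewrite mxE. Qed.
Lemma rv0 p : (0 : 'rV[F]_4) 0 p = 0. Proof. by rewrite mxE. Qed.
End Coordinates.
Definition rvE := (sigmaE, sigma1E, at_posE, rvD, rvN, rvZ, rv0).
Definition simp01 := (mulr0, mul0r, mulr1, mul1r, subr0, sub0r, addr0, add0r, oppr0).

Section LieAlgebra.
Variable F : fieldType.
Hypothesis char0 : [pchar F] =i pred0.
Local Notation A := (salg F).
Local Notation index := (index F).
Implicit Types (u v w : A) (k l : index) (m : Mvec) (G : set 'rV[F]_4).
Local Notation s := (sigma F).
Local Notation s1 := (sigma1 F).

Lemma nrmP a u v : nrm (a *: u + v) = a *: nrm u + nrm v.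
Proof. by rewrite /nrm coD coZ scalerDl -scalerA scalerBr opprD addrACA. Qed.
HB.instance Definition _ := GRing.isLinear.Build F A A _ (@nrm F) nrmP.

Lemma nrmX1 : nrm (X s1) = 0.
Proof. by rewrite /nrm cox eqxx scale1r subrr. Qed.

Lemma nrmK u : nrm (nrm u) = nrm u.
Proof. by rewrite {2}/nrm linearB linearZ /= nrmX1 scaler0 subr0. Qed.

Lemma nrm_eq u v : nrm u = nrm v <-> exists a, u - v = a *: X s1.
Proof.
split=> [e|[a e]]; last first.
  by apply/eqP; rewrite -subr_eq0 -linearB /= e linearZ /= nrmX1 scaler0.
exists (co (s1, exp0) (u - v)); apply/eqP; rewrite -subr_eq0 -/(nrm _) linearB /=.
by rewrite e subrr.
Qed.

Lemma brX1 v : br (X s1) v = 0.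
Proof.
rewrite /br !DX !sigma1E !scale0r scaleN1r subrr; ring.
Qed.

Lemma br_nrml u v : br (nrm u) v = br u v.
Proof. by rewrite /nrm -scaleNr addrC brDl brX1 scaler0 add0r. Qed.
Lemma br_nrmr u v : br u (nrm v) = br u v.
Proof. by rewrite brC br_nrml -brC. Qed.

Lemma inAP m G a u v : inA m G u -> inA m G v -> inA m G (a *: u + v).
Proof. exact: supp_inP. Qed.
Lemma inAD m G u v : inA m G u -> inA m G v -> inA m G (u + v).
Proof. exact: supp_inD. Qed.
Lemma inA0 m G : inA m G 0. Proof. exact: supp_in0. Qed.
Lemma inAZ m G a u : inA m G u -> inA m G (a *: u).
Proof. exact: supp_inZ. Qed.

Lemma Jset0 m : Jset m exp0.
Proof. by move=> p; rewrite ffunE; case: (m p). Qed.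
Lemma JsetD m i j : Jset m i -> Jset m j -> Jset m [ffun p => (i p + j p)%N].
Proof.
by move=> hi hj p; move: (hi p) (hj p); rewrite ffunE; case: (m p) => //= -> ->.
Qed.
Lemma Jset_dec m p i : Jset m i -> Jset m (exp_dec p i).
Proof. by move=> hi q; move: (hi q); rewrite ffunE; case: (m q) => //= ->. Qed.

Lemma inAX m G a : G a -> inA m G (X a).
Proof. by move=> Ga; apply: supp_inx; split=> //; apply: Jset0. Qed.

Section Subgroup.
Variables (m : Mvec) (G : set 'rV[F]_4).
Hypothesis Ggrp : subgrp G.

Lemma subgrp0 : G 0. Proof. by case: Ggrp => -[]. Qed.
Lemma subgrpB a b : G a -> G b -> G (a - b).
Proof. by case: Ggrp => -[_ h] _; apply: h. Qed.
Lemma subgrpN a : G a -> G (- a).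
Proof. by move=> Ga; rewrite -[- a]add0r; apply: subgrpB => //; apply: subgrp0. Qed.
Lemma subgrpD a b : G a -> G b -> G (a + b).
Proof. by move=> Ga Gb; rewrite -[b]opprK; apply: subgrpB => //; apply: subgrpN. Qed.
Lemma subgrp_s : G s. Proof. by case: Ggrp. Qed.
Lemma subgrpMn a n : G a -> G (a *+ n).
Proof.
move=> Ga; elim: n => [|n IH]; first exact: subgrp0.
by rewrite mulrS; apply: subgrpD.
Qed.
Lemma subgrp_zmul a (z : int) : G a -> G (z%:~R *: a).
Proof.
move=> Ga; case: z => n.
  by have -> : n%:~R = n%:R :> F by []; rewrite scaler_nat; apply: subgrpMn.
have -> : (Negz n)%:~R = - n.+1%:R :> F by [].
by rewrite scaleNr scaler_nat; apply: subgrpN; apply: subgrpMn.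
Qed.

Lemma inAM u v : inA m G u -> inA m G v -> inA m G (u * v).
Proof.
apply: supp_inM => k l [Gk Jk] [Gl Jl]; split; first exact: subgrpD.
exact: JsetD.
Qed.

Lemma inA_D p u : inA m G u -> inA m G (D p u).
Proof. by apply: supp_in_D => k [Gk Jk] _; split=> //; apply: Jset_dec. Qed.

Lemma inA_br u v : inA m G u -> inA m G v -> inA m G (br u v).
Proof.
move=> Au Av; rewrite /br.
have AX : inA m G (X s) by apply: inAX; apply: subgrp_s.
by do ![apply: supp_inB | apply: inAD | apply: inAM | apply: inA_D].
Qed.

Lemma der_inA w : der m G w -> inA m G w.
Proof.
elim=> [|a u v {}w Au Av _ Aw]; first exact: inA0.
by apply: inAP => //; apply: inA_br.
Qed.

Lemma derL a u v : der m G u -> der m G v -> der m G (a *: u + v).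
Proof.
move=> du dv; elim: du => [|b {}u u' w Au Au' _ IH]; first by rewrite scaler0 add0r.
by rewrite scalerDr scalerA -addrA; apply: derP.
Qed.

Lemma lie_inA u : lie m G u -> inA m G u. Proof. by case. Qed.

Lemma lieP a u v : lie m G u -> lie m G v -> lie m G (a *: u + v).
Proof.
case=> Au [w dw e] [Av [w' dw' e']]; split; first exact: inAP.
by exists (a *: w + w'); [apply: derL|rewrite !nrmP e e'].
Qed.
Lemma lie0 : lie m G 0.
Proof. by split; [apply: inA0|exists 0 => //; apply: der0]. Qed.
Lemma lieZ a u : lie m G u -> lie m G (a *: u).
Proof. by move=> lu; rewrite -[a *: u]addr0; apply: lieP => //; apply: lie0. Qed.
Lemma lieB u v : lie m G u -> lie m G v -> lie m G (u - v).
Proof. by move=> lu lv; rewrite -scaleN1r addrC; apply: lieP. Qed.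

Lemma lie_br u v : inA m G u -> inA m G v -> lie m G (br u v).
Proof.
move=> Au Av; split; first exact: inA_br.
by exists (br u v) => //; rewrite -[br u v]scale1r -[_ *: _]addr0; apply: derP => //; apply: der0.
Qed.

Lemma inA_nrm u : inA m G u -> inA m G (nrm u).
Proof.
move=> Au k; rewrite coB coZ cox; have [<-|nk] := eqVneq (s1, exp0) k.
  by rewrite mulr1 subrr eqxx.
by rewrite mulr0 subr0 => /Au.
Qed.

Lemma lie_nrm u : lie m G u -> lie m G (nrm u).
Proof.
case=> Au [w dw e]; split; first exact: inA_nrm.
by exists w => //; rewrite nrmK.
Qed.

Lemma br1 v : br 1 v = D p4 v.
Proof. by rewrite /br !D1; ring. Qed.

Lemma brXs v : br (X (- s)) v = - D p2 v.
Proof.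
rewrite /br !DX !rvE oppr0 !scale0r !scaleN1r addrN mul0r mulr0 subr0 addr0.
by rewrite mulr0 subr0 mulNr mulrN mulrA mulXN mul1r.
Qed.

(** The two structure constants of the bracket on monomials. *)
Definition form12 (a b : 'rV[F]_4) := a 0 p1 * b 0 p2 - b 0 p1 * a 0 p2.
Definition form34 (a b : 'rV[F]_4) :=
  (a 0 p3 + 1) * b 0 p4 - (b 0 p3 + 1) * a 0 p4.

Lemma brXX a b : br (X a) (X b) = form12 a b *: X (a + b + s) + form34 a b *: X (a + b).
Proof.
rewrite /br !DX !scaE /form12 /form34 -!mulXX !(rmorphB, rmorphM, rmorphD, rmorph1) /=; ring.
Qed.

(** As br 1 is D p4, bracketing recovers u up to its deviation from being an
    eigenvector; lie_D2 uses br (X (- s)) = - D p2 in the same way. *)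
Lemma lie_D4 u b : inA m G u -> b != 0 -> lie m G (D p4 u - b *: u) -> lie m G u.
Proof.
move=> Au b0 h; have G0 := inAX m subgrp0.
have -> : u = b^-1 *: (br 1 u - (D p4 u - b *: u)).
  by rewrite br1 opprB addrC subrK scalerA mulVf // scale1r.
by apply: lieZ; apply: lieB => //; apply: lie_br.
Qed.

Lemma lie_D2 u b : inA m G u -> b != 0 -> lie m G (D p2 u - b *: u) -> lie m G u.
Proof.
move=> Au b0 h; have Gs := inAX m (subgrpN subgrp_s).
have -> : u = b^-1 *: ((-1) *: br (X (- s)) u - (D p2 u - b *: u)).
  by rewrite brXs scaleN1r opprK opprB addrC subrK scalerA mulVf // scale1r.
by apply: lieZ; apply: lieB => //; apply: lieZ; apply: lie_br.
Qed.

Lemma lieX2 a : G a -> a 0 p2 != 0 -> lie m G (X a).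
Proof.
move=> Ga a2; apply: (lie_D2 _ a2); first exact: inAX.
by rewrite DX subrr; apply: lie0.
Qed.

Lemma lieX4 a : G a -> a 0 p4 != 0 -> lie m G (X a).
Proof.
move=> Ga a4; apply: (lie_D4 _ a4); first exact: inAX.
by rewrite DX subrr; apply: lie0.
Qed.

Hypothesis Gaxis : forall p, exists2 a : F, a != 0 & G (at_pos a p).

(** A monomial of weight zero is a bracket of two monomials of opposite
    weights, taken on the second or on the fourth axis; only for the exponent
    (1, 0, -2, 0) do both structure constants vanish. *)
Lemma lieX0 a : G a -> a 0 p2 = 0 -> a 0 p4 = 0 ->
  (a 0 p1 != 1) || (a 0 p3 != -2) -> lie m G (X a).
Proof.
move=> Ga a2 a4 /orP[a1|a3].
  have [b b0 Gb] := Gaxis p2; pose c := a - s - at_pos b p2.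
  have Gc : G c by do !apply: subgrpB => //; apply: subgrp_s.
  have -> : X a = ((1 - a 0 p1) * b)^-1 *: br (X (at_pos b p2)) (X c).
    rewrite brXX /form12 /form34 /c !rvE /= a2 a4.
    rewrite !(mulr0, mul0r, mulr1, subr0, sub0r, addr0, add0r, subrr, oppr0, scale0r).
    rewrite -mulNr opprB scalerA mulVf ?scale1r; first by congr X; rewrite [at_pos b p2 + _]addrC !subrK.
    by rewrite mulf_neq0 // subr_eq0 eq_sym.
  by apply: lieZ; apply: lie_br; apply: inAX.
have [b b0 Gb] := Gaxis p4; pose c := a - at_pos b p4.
have Gc : G c by apply: subgrpB.
have -> : X a = (- (b * (a 0 p3 + 2)))^-1 *: br (X (at_pos b p4)) (X c).
  rewrite brXX /form12 /form34 /c !rvE /= a2 a4.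
  rewrite !(mulr0, mul0r, mulr1, subr0, sub0r, addr0, add0r, subrr, oppr0, scale0r).
  rewrite mul1r -[X in _ *: (X *: _)]/(_ : F) scalerA.
  rewrite [X in X *: _](_ : _ = 1) ?scale1r; first by congr X; rewrite addrC subrK.
  rewrite -[RHS](@mulVf _ (- (b * (a 0 p3 + 2)))) ?oppr_eq0 ?mulf_neq0 //.
    by congr (_ * _); ring.
  by rewrite addr_eq0.
by apply: lieZ; apply: lie_br; apply: inAX.
Qed.

Lemma lie_axis (z : int) a p : G (at_pos a p) -> lie m G (X (at_pos (z%:~R * a) p)).
Proof.
move=> Ga; have Gz : G (at_pos (z%:~R * a) p).
  by rewrite /at_pos -scalerA; apply: subgrp_zmul.
have [z0|z0] := eqVneq (z%:~R * a) 0.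
  rewrite z0 /at_pos scale0r; apply: lieX0; rewrite ?rvE //; first exact: subgrp0.
  by rewrite eq_sym oner_eq0.
elim/ord4P: p Ga Gz => _ Gz.
- apply: lieX0 => //; rewrite ?at_posE ?mulr0 //=; rewrite [0 == _]eq_sym.
  by rewrite oppr_eq0 natrF_eq0 // orbT.
- by apply: lieX2 => //; rewrite at_posE mulr1.
- by apply: lieX0 => //; rewrite ?at_posE ?mulr0 // eq_sym oner_eq0.
- by apply: lieX4 => //; rewrite at_posE mulr1.
Qed.

End Subgroup.

Lemma Omega_subgrp G : Omega G -> subgrp G.
Proof. by case. Qed.

Lemma Omega_axis G : Omega G -> forall p, exists2 a : F, a != 0 & G (at_pos a p).
Proof.
case=> -[G0 _] _ h _ _ p; apply: contrapT => nex; apply: (h p).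
apply/seteqP; split=> [v [Gv [a _ e]]|_ ->]; last first.
  by split=> //; exists 0 => //; rewrite /at_pos scale0r.
have [a0|a0] := eqVneq a 0; first by rewrite -e a0 /at_pos scale0r.
by case: nex; exists a => //; rewrite e.
Qed.

End LieAlgebra.

(** * Isomorphisms in terms of normalized representatives *)

(** An isomorphism between quotients by the central line, read on normalized
    representatives: niso_Z makes it well defined modulo that line, and niso_ker
    injective modulo it. *)
Record niso (F : fieldType) (P P' : set (salg F)) (f : salg F -> salg F) : Prop := {
  niso_in : forall u, P u -> P' (f u);
  niso_lin : forall a u v, P u -> P v -> f (a *: u + v) = a *: f u + f v;
  niso_br : forall u v, P u -> P v -> f (br u v) = nrm (br (f u) (f v));
  niso_nrm : forall u, P u -> nrm (f u) = f u;
  niso_ker : forall u, P u -> f u = 0 -> nrm u = 0;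
  niso_Z : P (X (sigma1 F)) -> f (X (sigma1 F)) = 0;
  niso_sur : forall v, P' v -> exists2 u, P u & f u = nrm v }.

Record lieclosed (F : fieldType) (P : set (salg F)) : Prop := {
  lieclosed0 : P 0;
  lieclosedP : forall a u v, P u -> P v -> P (a *: u + v);
  lieclosed_br : forall u v, P u -> P v -> P (br u v);
  lieclosed_nrm : forall u, P u -> P (nrm u) }.

Section LinSpan.
Variables (F : fieldType) (V : lmodType F) (Y : set V).

Lemma lin_span_lin a u v : lin_span Y u -> lin_span Y v -> lin_span Y (a *: u + v).
Proof.
move=> [n1 [a1 [x1 [h1 ->]]]] [n2 [a2 [x2 [h2 ->]]]].
exists (n1 + n2)%N,
  (fun i : 'I_(n1 + n2) => match fintype.split i with inl j => a * a1 j | inr j => a2 j end),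
  (fun i : 'I_(n1 + n2) => match fintype.split i with inl j => x1 j | inr j => x2 j end).
split; first by move=> i; case: fintype.split.
rewrite big_split_ord /= scaler_sumr; congr (_ + _); apply: eq_bigr => i _.
  by rewrite (unsplitK (inl i)) scalerA.
by rewrite (unsplitK (inr i)).
Qed.

Lemma lin_span0 : lin_span Y 0.
Proof. by exists 0%N, (fun=> 0), (fun=> 0); split; [case|rewrite big_ord0]. Qed.

Lemma lin_span_mem u : Y u -> lin_span Y u.
Proof.
by move=> Yu; exists 1%N, (fun=> 1), (fun=> u); rewrite big_ord1 scale1r.
Qed.

Lemma lin_span_ind (Q : V -> Prop) : Q 0 ->
  (forall a u v, Y u -> Q v -> Q (a *: u + v)) -> forall v, lin_span Y v -> Q v.
Proof.
move=> Q0 QD v [n [a [y [h ->]]]]; elim: n a y h => [|n IH] a y h.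
  by rewrite big_ord0.
rewrite big_ord_recl; apply: QD => //.
exact: (IH (fun i => a (lift ord0 i)) (fun i => y (lift ord0 i)) (fun i => h _)).
Qed.

Lemma lpi0 (z : V) : lpi z 0 = 0.
Proof. by apply: (addrI (lpi z 0)); rewrite -lpiD !addr0. Qed.
Lemma lpiZ' (z : V) a u : lpi z (a *: u) = a *: lpi z u.
Proof. exact: lpiZ. Qed.
End LinSpan.

Lemma linear_on0 (F : fieldType) (V V' : lmodType F) (P : set V) (g : V -> V') :
  (forall a u v, P u -> P v -> g (a *: u + v) = a *: g u + g v) -> P 0 -> g 0 = 0.
Proof.
by move=> glin P0; have := glin (-1) 0 0 P0 P0; rewrite scaler0 addr0 scaleN1r addNr.
Qed.

Section Niso.
Variable F : fieldType.
Local Notation A := (salg F).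
Implicit Types (u v w : A) (m : Mvec) (G : set 'rV[F]_4).
Local Notation s := (sigma F).
Local Notation s1 := (sigma1 F).

Section One.
Variables (P P' : set A) (f : A -> A).
Hypotheses (cP : lieclosed P) (cP' : lieclosed P') (nf : niso P P' f).

Lemma niso0 : f 0 = 0.
Proof.
have P0 := lieclosed0 cP.
by have := niso_lin nf (-1) P0 P0; rewrite scaler0 addr0 scaleN1r addNr.
Qed.
Lemma nisoZ a u : P u -> f (a *: u) = a *: f u.
Proof.
by move=> Pu; have := niso_lin nf a Pu (lieclosed0 cP); rewrite niso0 !addr0.
Qed.
Lemma nisoB u v : P u -> P v -> f (u - v) = f u - f v.
Proof.
by move=> Pu Pv; have := niso_lin nf (-1) Pv Pu; rewrite !scaleN1r ![- _ + _]addrC.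
Qed.

Lemma niso_nrmr u : P u -> f (nrm u) = f u.
Proof.
move=> Pu; have Pnu := lieclosed_nrm cP Pu.
have [c0|c0] := eqVneq (co (s1, exp0) u) 0.
  by congr f; rewrite /nrm c0 scale0r subr0.
have PZ : P (X s1).
  have -> : X s1 = (co (s1, exp0) u)^-1 *: ((-1) *: nrm u + u) + 0.
    by rewrite addr0 /nrm scaleN1r opprB subrK scalerA mulVf // scale1r.
  by do 2?[apply: (lieclosedP cP)] => //; apply: lieclosed0.
by rewrite /nrm nisoB ?nisoZ ?(niso_Z nf) ?scaler0 ?subr0 // -[_ *: _]addr0;
  apply: (lieclosedP cP) => //; apply: lieclosed0.
Qed.

Lemma niso_eq u v : P u -> P v -> f u = f v -> nrm u = nrm v.
Proof.
move=> Pu Pv e; apply/eqP; rewrite -subr_eq0 -linearB /=; apply/eqP.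
apply: (niso_ker nf); last by rewrite nisoB // e subrr.
by rewrite -scaleN1r addrC; apply: lieclosedP.
Qed.

Lemma niso_inv : exists g, [/\ niso P' P g, forall u, P u -> g (f u) = nrm u
  & forall v, P' v -> f (g v) = nrm v].
Proof.
have /choice[h hP] : forall v, exists u, P' v -> P u /\ f u = nrm v.
  move=> v; have [P'v|nP] := pselect (P' v); last by exists 0.
  by have [u Pu e] := niso_sur nf P'v; exists u.
pose g v := nrm (h v).
have gin v : P' v -> P (g v) by move=> /hP[Pu _]; apply: (lieclosed_nrm cP).
have fg v : P' v -> f (g v) = nrm v by move=> /hP[Pu e]; rewrite niso_nrmr.
have gn v : nrm (g v) = g v by rewrite nrmK.
have geq v w : P' v -> P w -> f w = nrm v -> g v = nrm w.
  by move=> P'v Pw e; rewrite -gn; apply: niso_eq; rewrite ?fg //; apply: gin.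
exists g; split=> //; last by move=> u Pu; apply: geq => //; [apply: niso_in nf _ Pu|rewrite (niso_nrm nf)].
split=> //.
- move=> a u v Pu Pv; rewrite -[g u]gn -[g v]gn -linearP.
  apply: geq; [exact: lieclosedP|by apply: lieclosedP => //; apply: gin|].
  by rewrite (niso_lin nf) ?fg ?linearP //; apply: gin.
- move=> u v Pu Pv; apply: geq; [exact: lieclosed_br|by apply: lieclosed_br => //; apply: gin|].
  by rewrite (niso_br nf) ?fg ?br_nrml ?br_nrmr //; apply: gin.
- by move=> u P'u gu0; rewrite -fg // gu0 niso0.
- move=> PZ; have := geq _ 0 PZ (lieclosed0 cP); rewrite linear0; apply.
  by rewrite niso0 nrmX1.
- move=> v Pv; exists (f v); first exact: niso_in nf _ Pv.
  by apply: geq => //; [apply: niso_in nf _ Pv|rewrite (niso_nrm nf)].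
Qed.

End One.

Lemma niso_comp (P P' P'' : set A) f g : lieclosed P' -> lieclosed P'' ->
  niso P P' f -> niso P' P'' g -> niso P P'' (g \o f).
Proof.
move=> cP' cP'' nf ng; split=> /=.
- by move=> u Pu; apply: (niso_in ng); apply: (niso_in nf).
- by move=> a u v Pu Pv; rewrite (niso_lin nf) // (niso_lin ng) //; apply: (niso_in nf).
- move=> u v Pu Pv; rewrite (niso_br nf) // (niso_nrmr cP' ng).
    by rewrite (niso_br ng) //; apply: (niso_in nf).
  by apply: (lieclosed_br cP'); apply: (niso_in nf).
- by move=> u Pu; rewrite (niso_nrm ng) //; apply: (niso_in nf).
- move=> u Pu e; apply: (niso_ker nf) => //.
  by rewrite -(niso_nrm nf) //; apply: (niso_ker ng) => //; apply: (niso_in nf).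
- by move=> PZ; rewrite (niso_Z nf) // (niso0 cP' ng).
- move=> v Pv; have [w Pw ew] := niso_sur ng Pv; have [u Pu eu] := niso_sur nf Pw.
  by exists u => //; rewrite eu (niso_nrmr cP' ng).
Qed.

Lemma lie_closed m G : subgrp G -> lieclosed (lie m G).
Proof.
move=> gG; split; [exact: lie0|exact: lieP| |exact: lie_nrm].
by move=> u v /lie_inA Au /lie_inA Av; apply: lie_br.
Qed.

Lemma A4P m G u : A4 m G (to_amb u) <-> inA m G u.
Proof.
split=> h k; first by rewrite co.unlock mcoeff_neq0; apply: h.
by rewrite -mcoeff_neq0 => hk; apply: h; rewrite co.unlock.
Qed.

Local Notation lp G := (lpi (central_elt G)).

(** The normalization is taken with respect to X s1 even if s1 is outside G,
    which is harmless, as elements supported on G then have no component to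
    remove. *)
Lemma lpi_nrm m G u v : inA m G u -> inA m G v ->
  (lp G (to_amb u) = lp G (to_amb v) <-> nrm u = nrm v).
Proof.
move=> Au Av; split.
  move/lpi_eqP => [a]; rewrite -to_ambB /central_elt; case: ifP => _ e; apply/nrm_eq.
    by exists a; apply: to_amb_inj; rewrite e to_ambZ to_amb_X.
  by exists 0; apply: to_amb_inj; rewrite e scaler0 scale0r to_amb0.
move/nrm_eq => [a e]; apply/lpi_eqP; exists a; rewrite -to_ambB e to_ambZ to_amb_X.
rewrite /central_elt; case: asboolP => [_|nG]; first by [].
have [->|a0] := eqVneq a 0; first by rewrite !scale0r.
case: nG; have : inA m G (u - v) by apply: supp_inB.
by rewrite e => /(_ (s1, exp0)); rewrite coZ cox eqxx mulr1 => /(_ a0)[].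
Qed.

Section Xu.
Variables (m : Mvec) (G : set 'rV[F]_4).
Hypothesis gG : subgrp G.

Lemma xu_algebraP (x y : Quo G) a :
  xu_algebra m x -> xu_algebra m y -> xu_algebra m (a *: x + y).
Proof. exact: lin_span_lin. Qed.

Lemma xu_algebra0 : xu_algebra m (0 : Quo G).
Proof. exact: lin_span0. Qed.

Lemma xu_der (x : Quo G) : xu_algebra m x -> exists2 w, der m G w & lp G (to_amb w) = x.
Proof.
elim/lin_span_ind => {x} [|a x y [_ [u1 Au1 <-] [_ [u2 Au2 <-] <-]] [w dw <-]].
  by exists 0; [apply: der0|rewrite to_amb0 lpi0].
exists (a *: br (Salg u1) (Salg u2) + w).
  by apply: derP => //; apply/A4P.
by rewrite to_ambD to_ambZ lpiD lpiZ' qbracket_lpi to_amb_br.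
Qed.

Lemma xu_lie u : inA m G u -> (xu_algebra m (lp G (to_amb u)) <-> lie m G u).
Proof.
move=> Au; split; last first.
  case=> _ [w dw e]; rewrite (_ : lp G (to_amb u) = lp G (to_amb w)); last first.
    by apply/(lpi_nrm Au (der_inA gG dw)).
  elim: dw {e} => [|a v v' {}w Av Av' _ IH]; first by rewrite to_amb0 lpi0; apply: xu_algebra0.
  rewrite to_ambD to_ambZ lpiD lpiZ'; apply: xu_algebraP => //.
  apply: lin_span_mem; exists (lp G (to_amb v)); first by exists (to_amb v) => //; apply/A4P.
  exists (lp G (to_amb v')); first by exists (to_amb v') => //; apply/A4P.
  by rewrite qbracket_lpi to_amb_br.
move=> /xu_der[w dw e]; split=> //; exists w => //.
by apply/(lpi_nrm Au (der_inA gG dw)); rewrite e.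
Qed.

Lemma xu_rep (x : Quo G) : xu_algebra m x -> exists2 u, lie m G u & lp G (to_amb u) = x.
Proof.
move=> h; have [w dw e] := xu_der h; exists w => //.
by apply/xu_lie; rewrite ?e //; apply: (der_inA gG).
Qed.

End Xu.

Lemma niso_of_iso m G m' G' : subgrp G -> subgrp G' ->
  xu_isomorphic m G m' G' -> exists f, niso (lie m G) (lie m' G') f.
Proof.
move=> gG gG' [g [[gin ginj gsur] glin gbr]].
have /choice[h hP] : forall u, exists w, lie m G u ->
    lie m' G' w /\ lp G' (to_amb w) = g (lp G (to_amb u)).
  move=> u; have [lu|nl] := pselect (lie m G u); last by exists 0.
  have /gin/(xu_rep gG')[w lw ew] : xu_algebra m (lp G (to_amb u)).
    by apply/xu_lie => //; apply: lie_inA lu.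
  by exists w.
pose f u := nrm (h u).
have xlu u : lie m G u -> xu_algebra m (lp G (to_amb u)).
  by move=> lu; apply/xu_lie => //; apply: lie_inA lu.
have fin u : lie m G u -> lie m' G' (f u) by move=> /hP[lw _]; apply: lie_nrm.
have feq u w : lie m G u -> inA m' G' w -> lp G' (to_amb w) = g (lp G (to_amb u)) ->
    f u = nrm w.
  move=> /hP[lu' e] Aw; rewrite -e => e'.
  by apply/(lpi_nrm (lie_inA lu') Aw); rewrite e'.
exists f; split=> //.
- move=> a u v lu lv; rewrite /f -linearP; apply: feq; first exact: lieP.
    by apply: inAP; apply: lie_inA; [have [] := hP _ lu|have [] := hP _ lv].
  rewrite !to_ambD !to_ambZ !lpiD !lpiZ' glin; try exact: xlu.
  by rewrite (hP _ lu).2 (hP _ lv).2.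
- move=> u v lu lv; rewrite /f br_nrml br_nrmr; apply: feq.
  + by apply: lie_br => //; apply: lie_inA; eassumption.
  + by apply: inA_br => //; apply: lie_inA; [have [] := hP _ lu|have [] := hP _ lv].
  + rewrite !to_amb_br -!qbracket_lpi gbr; try exact: xlu.
    by rewrite (hP _ lu).2 (hP _ lv).2.
- by move=> u lu; rewrite nrmK.
- move=> u lu fu0; rewrite -(linear0 (@nrm F)); apply/lpi_nrm.
  + exact: lie_inA lu.
  + exact: inA0.
  apply: ginj; rewrite ?inE; [exact: xlu|by rewrite to_amb0 lpi0; apply: xu_algebra0|].
  have g0 : g 0 = 0.
    by apply: (linear_on0 glin); apply: xu_algebra0.
  rewrite to_amb0 lpi0 g0 -(hP _ lu).2 -(lpi0 (central_elt G')) -to_amb0.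
  apply/(lpi_nrm (m := m')); [|exact: inA0|by rewrite linear0].
  by apply: lie_inA; have [] := hP _ lu.
- move=> lZ; rewrite -(linear0 (@nrm F)); apply: feq => //; first exact: inA0.
  have g0 : g 0 = 0.
    by apply: (linear_on0 glin); apply: xu_algebra0.
  rewrite to_amb0 lpi0 -g0; congr g; rewrite -(lpi0 (central_elt G)) -to_amb0.
  apply/(lpi_nrm (m := m)); [exact: inA0|exact: lie_inA lZ|by rewrite linear0 nrmX1].
- move=> v lv; have : xu_algebra m' (lp G' (to_amb v)).
    by apply/xu_lie => //; apply: lie_inA lv.
  move/gsur => [x lx ex]; have [u lu eu] := xu_rep gG lx; exists u => //.
  by apply: feq => //; [apply: lie_inA lv|rewrite eu].
Qed.

Lemma iso_of_niso m G m' G' f : subgrp G -> subgrp G' ->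
  niso (lie m G) (lie m' G') f -> xu_isomorphic m G m' G'.
Proof.
move=> gG gG' nf; have cL := lie_closed m gG; have cL' := lie_closed m' gG'.
have /choice[h hP] : forall x : Quo G, exists u, xu_algebra m x ->
    lie m G u /\ lp G (to_amb u) = x.
  move=> x; have [lx|nl] := pselect (xu_algebra m x); last by exists 0.
  by have [u lu eu] := xu_rep gG lx; exists u.
have fin u : lie m G u -> inA m' G' (f u) by move=> /(niso_in nf)/lie_inA.
have hA x : xu_algebra m x -> inA m G (h x) by move=> /hP[/lie_inA].
have gE u : lie m G u -> lp G' (to_amb (f (h (lp G (to_amb u))))) = lp G' (to_amb (f u)).
  move=> lu; have lx : xu_algebra m (lp G (to_amb u)).
    by apply/xu_lie => //; apply: lie_inA lu.
  have [lw /(lpi_nrm (hA _ lx) (lie_inA lu)) e] := hP _ lx.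
  by apply/(lpi_nrm (m := m')); [exact: fin|exact: fin|]; rewrite -(niso_nrmr cL nf lw) e (niso_nrmr cL nf lu).
exists (fun x => lp G' (to_amb (f (h x)))); split.
- split.
  + move=> x lx; apply/(xu_lie (m := m')) => //; first by apply: fin; have [] := hP _ lx.
    by apply: (niso_in nf); have [] := hP _ lx.
  + move=> x y; rewrite !inE => lx ly e.
    have [lu eu] := hP _ lx; have [lv ev] := hP _ ly; rewrite -eu -ev.
    apply/lpi_nrm; [exact: hA|exact: hA|]; apply: (niso_eq cL nf) => //.
    by rewrite -(niso_nrm nf) // -[RHS](niso_nrm nf) //; apply/(lpi_nrm (fin _ lu) (fin _ lv)).
  + move=> y ly; have [v lv <-] := xu_rep gG' ly.
    have [u lu eu] := niso_sur nf lv; exists (lp G (to_amb u)).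
      by apply/xu_lie => //; apply: lie_inA lu.
    rewrite gE //; apply/(lpi_nrm (m := m')); [exact: fin|exact: lie_inA lv|].
    by rewrite eu nrmK.
- move=> a x y lx ly; have [lu eu] := hP _ lx; have [lv ev] := hP _ ly.
  have e : a *: x + y = lp G (to_amb (a *: h x + h y)).
    by rewrite to_ambD to_ambZ lpiD lpiZ' eu ev.
  rewrite [in LHS]e gE; last exact: lieP.
  by rewrite (niso_lin nf a lu lv) to_ambD to_ambZ lpiD lpiZ'.
- move=> x y lx ly; have [lu eu] := hP _ lx; have [lv ev] := hP _ ly.
  have e : qbracket x y = lp G (to_amb (br (h x) (h y))).
    by rewrite to_amb_br -qbracket_lpi eu ev.
  rewrite [in LHS]e gE; last by apply: lie_br => //; apply: lie_inA; eassumption.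
  rewrite (niso_br nf lu lv) qbracket_lpi -to_amb_br.
  apply/(lpi_nrm (m := m')); last by rewrite nrmK.
  + by apply: inA_nrm; apply: inA_br => //; apply: fin.
  + by apply: inA_br => //; apply: fin.
Qed.

(** An automorphism of the ambient algebra preserving the bracket and matching
    the two monomial algebras induces an isomorphism. *)
Section Transport.
Variables (m m' : Mvec) (G G' : set 'rV[F]_4) (f g : {linear A -> A}) (c : F).
Hypotheses (fK : cancel f g) (gK : cancel g f).
Hypotheses (fbr : forall u v, f (br u v) = br (f u) (f v)).
Hypotheses (fin : forall u, inA m G u -> inA m' G' (f u)).
Hypotheses (gin : forall u, inA m' G' u -> inA m G (g u)).
Hypotheses (c0 : c != 0) (fZ : f (X s1) = c *: X s1).

Lemma transport_br u v : g (br u v) = br (g u) (g v).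
Proof. by rewrite -[u in LHS]gK -[v in LHS]gK -fbr fK. Qed.

Lemma transport_nrm u : nrm (f (nrm u)) = nrm (f u).
Proof. by rewrite {2}/nrm linearB linearZ /= fZ scalerA linearB linearZ /= nrmX1 scaler0 subr0. Qed.

Lemma transport_nrmV u : nrm (g (nrm u)) = nrm (g u).
Proof.
have gZ : g (X s1) = c^-1 *: X s1.
  by rewrite -[X s1 in RHS]fK fZ linearZ /= scalerA mulVf // scale1r.
by rewrite {2}/nrm linearB linearZ /= gZ scalerA linearB linearZ /= nrmX1 scaler0 subr0.
Qed.

Lemma transport_lie u : lie m G u -> lie m' G' (f u).
Proof.
case=> Au [w dw e]; split; first exact: fin.
exists (f w); last by rewrite -transport_nrm e transport_nrm.
elim: dw {e} => [|a v v' {}w Av Av' _ IH]; first by rewrite linear0; apply: der0.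
by rewrite linearP /= fbr; apply: derP => //; apply: fin.
Qed.

Lemma transport_lieV u : lie m' G' u -> lie m G (g u).
Proof.
case=> Au [w dw e]; split; first exact: gin.
exists (g w); last by rewrite -transport_nrmV e transport_nrmV.
elim: dw {e} => [|a v v' {}w Av Av' _ IH]; first by rewrite linear0; apply: der0.
by rewrite linearP /= transport_br; apply: derP => //; apply: gin.
Qed.

Lemma transport_niso : niso (lie m G) (lie m' G') (fun u => nrm (f u)).
Proof.
split.
- by move=> u /transport_lie; apply: lie_nrm.
- by move=> a u v _ _; rewrite !linearP.
- by move=> u v _ _; rewrite fbr br_nrml br_nrmr.
- by move=> u _; rewrite nrmK.
- by move=> u _ e; rewrite -[u]fK -transport_nrmV e !linear0.
- by rewrite fZ linearZ /= nrmX1 scaler0.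
- by move=> v lv; exists (g v); [apply: transport_lieV|rewrite gK].
Qed.

End Transport.
End Niso.

(** * The block swap *)

Section Multiplicative.
Variable F : fieldType.
Local Notation A := (salg F).
Local Notation index := (index F).

Lemma lext_mul (h : index -> A) :
  (forall k l, h (index_add k l) = h k * h l) ->
  forall u v, lext h (u * v) = lext h u * lext h v.
Proof.
move=> hM u v; elim/linear_ind: u => [k||a u u' IH IH']; last first.
- by rewrite mulrDl -scalerAl !linearP /= IH IH' mulrDl scalerAl.
- by rewrite mul0r linear0 mul0r.
elim/linear_ind: v => [l||a v v' IH IH']; last first.
- by rewrite mulrDr -scalerAr !linearP /= IH IH' mulrDr scalerAr.
- by rewrite mulr0 linear0 mulr0.
by rewrite mulxx !lextx hM.
Qed.
End Multiplicative.

Definition swp (p : 'I_4) : 'I_4 :=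
  if p == p1 then p3 else if p == p2 then p4 else if p == p3 then p1 else p2.

Lemma swpK : involutive swp.
Proof. by apply: ord4P. Qed.

Definition swv (F : fieldType) (a : 'rV[F]_4) : 'rV[F]_4 := \row_p a 0 (swp p).
Definition swe (T : Type) (i : {ffun 'I_4 -> T}) : {ffun 'I_4 -> T} :=
  [ffun p => i (swp p)].

Section Swap.
Variable F : fieldType.
Local Notation A := (salg F).
Local Notation index := (index F).
Implicit Types (u v w : A) (k l : index) (m : Mvec) (G : set 'rV[F]_4)
  (a b : 'rV[F]_4).
Local Notation s := (sigma F).
Local Notation s1 := (sigma1 F).

Lemma swvE a p : swv a 0 p = a 0 (swp p). Proof. by rewrite mxE. Qed.
Lemma swvD a b : swv (a + b) = swv a + swv b.
Proof. by apply/rowP => p; rewrite !mxE. Qed.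
Lemma swvN a : swv (- a) = - swv a.
Proof. by apply/rowP => p; rewrite !mxE. Qed.
Lemma swv0 : swv (0 : 'rV[F]_4) = 0.
Proof. by apply/rowP => p; rewrite !mxE. Qed.
Lemma swvK : involutive (@swv F).
Proof. by move=> a; apply/rowP => p; rewrite !mxE swpK. Qed.
Lemma swv_s : swv s = s.
Proof. by apply: rV4P; rewrite swvE !rvE. Qed.
Lemma sweK (T : Type) : involutive (@swe T).
Proof. by move=> i; apply/ffunP => p; rewrite !ffunE swpK. Qed.

Definition deg4 (i : {ffun 'I_4 -> nat}) : nat := (i p1 + i p2 + i p3 + i p4)%N.

Definition swR := lext (fun k : index =>
  (-1) ^+ deg4 k.2 *: x (- swv k.1, swe k.2) : A).
HB.instance Definition _ := GRing.isLinear.Build F A A _ swR (lext_is_linear _).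

Lemma swRx k : swR (x k) = (-1) ^+ deg4 k.2 *: x (- swv k.1, swe k.2).
Proof. exact: lextx. Qed.

Lemma swRM u v : swR (u * v) = swR u * swR v.
Proof.
apply: lext_mul => k l; rewrite -scalerAl -scalerAr scalerA -exprD mulxx.
congr (_ ^+ _ *: x _); last first.
  rewrite /index_add /= swvD opprD; congr pair.
  by apply/ffunP => p; rewrite !ffunE.
by rewrite /deg4 /= !ffunE; lia.
Qed.

Lemma swRD u v : swR (u + v) = swR u + swR v. Proof. exact: linearD. Qed.
Lemma swRB u v : swR (u - v) = swR u - swR v. Proof. exact: linearB. Qed.

Lemma swRX a : swR (X a) = X (- swv a).
Proof.
rewrite swRx /= /deg4 !ffunE scale1r /X; congr (x (_, _)).
by apply/ffunP => p; rewrite !ffunE.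
Qed.

Lemma swRK : involutive swR.
Proof.
apply: (linear_eq (f := swR \o swR) (g := idfun)) => k /=.
rewrite swRx linearZ /= swRx /= scalerA -exprD swvN opprK swvK sweK -surjective_pairing.
by rewrite /deg4 /= !ffunE /swp /= -signr_odd [odd _](_ : _ = false) ?scale1r //; lia.
Qed.

Lemma D_swR p u : D p (swR u) = - swR (D (swp p) u).
Proof.
apply: (linear_eq (f := D p \o swR) (g := -%R \o (swR \o D (swp p)))) => k /=.
rewrite swRx linearZ /= !Dx /= [swR (_ + _)]linearP /= [swR (_ *: x _)]linearZ /= !swRx /= rvN swvE !ffunE.
case: (posnP (k.2 (swp p))) => [->|kp].
  by rewrite !scale0r !addr0 !scaE; ring.
have -> : swe (exp_dec (swp p) k.2) = exp_dec p (swe k.2).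
  by apply/ffunP => q; rewrite !ffunE (can_eq swpK).
have -> : deg4 k.2 = (deg4 (exp_dec (swp p) k.2)).+1.
  move: kp; rewrite /deg4 !ffunE; by elim/ord4P: p => /=; rewrite /swp /=; lia.
by rewrite exprS !scaE; ring.
Qed.

(** Inverting monomials exchanges the two blocks of coordinates up to signs,
    and the factor X (- s) moves the coefficient X s of the bracket from one
    block to the other. *)
Definition sw u : A := X (- s) * swR u.
Fact sw_is_linear : linear sw.
Proof. by move=> a u v; rewrite /sw [swR (_ + _)]linearP /= mulrDr scalerAr. Qed.
HB.instance Definition _ := GRing.isLinear.Build F A A _ sw sw_is_linear.

Lemma XsN : X s * X (- s) = 1 :> A. Proof. exact: mulXN. Qed.

Lemma swK : involutive sw.
Proof.
by move=> u; rewrite /sw swRM swRX swRK swvN swv_s opprK mulrA [X _ * X s]mulrC XsN mul1r.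
Qed.

Lemma swX a : sw (X a) = X (- swv a - s).
Proof. by rewrite /sw swRX mulXX addrC. Qed.

Lemma swx k : sw (x k) = (-1) ^+ deg4 k.2 *: x (- swv k.1 - s, swe k.2).
Proof.
rewrite /sw swRx -scalerAr mulxx /index_add /=; congr (_ *: x (_, _)).
  by rewrite addrC.
by apply/ffunP => p; rewrite !ffunE.
Qed.

Lemma D_sw p u : D p (sw u) = - (s 0 p *: sw u) - sw (D (swp p) u).
Proof.
by rewrite /sw DM DX D_swR rvN -scalerAl scaleNr mulrN.
Qed.

Lemma sw_br u v : sw (br u v) = br (sw u) (sw v).
Proof.
rewrite {2}/br !D_sw !rvE /= !scale1r !scale0r /swp /=.
rewrite /sw /br !(swRB, swRD, swRM) swRX swv_s.
set u1 := swR u; set v1 := swR v.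
set a1 := swR (D p1 u); set a2 := swR (D p2 u); set a3 := swR (D p3 u); set a4 := swR (D p4 u).
set b1 := swR (D p1 v); set b2 := swR (D p2 v); set b3 := swR (D p3 v); set b4 := swR (D p4 v).
transitivity (X s * X (- s) * (X (- s) * ((u1 + a3) * b4 - (v1 + b3) * a4))
  + X (- s) * X (- s) * (a1 * b2 - b1 * a2)); last by ring.
by rewrite XsN mul1r; ring.
Qed.

Lemma swv_s1 : - swv s1 - s = s1.
Proof. by apply: rV4P; rewrite !rvE swvE !rvE /=; ring. Qed.

Lemma swX1 : sw (X s1) = X s1.
Proof. by rewrite swX swv_s1. Qed.

Definition swG G : set 'rV[F]_4 := fun a => G (swv a).

Lemma swGK G : swG (swG G) = G.
Proof. by apply/funext => a; rewrite /swG swvK. Qed.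

Lemma swG_subgrp G : subgrp G -> subgrp (swG G).
Proof.
move=> gG; rewrite /swG; split; last by rewrite swv_s; apply: subgrp_s.
split; first by rewrite swv0; apply: subgrp0 gG.
by move=> a b Ga Gb; rewrite swvD swvN; apply: subgrpB.
Qed.


Lemma swv_at (c : F) p : swv (at_pos c p) = at_pos c (swp p).
Proof.
by apply/rowP => q; rewrite swvE !at_posE -{1}[p]swpK (can_eq swpK).
Qed.

Lemma swG_axis G : (forall p, exists2 a : F, a != 0 & G (at_pos a p)) ->
  forall p, exists2 a : F, a != 0 & swG G (at_pos a p).
Proof.
by move=> h p; have [a a0 Ga] := h (swp p); exists a; rewrite /swG ?swv_at.
Qed.

Lemma inA_sw m G u : subgrp G -> inA m G u -> inA (swe m) (swG G) (sw u).
Proof.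
move=> gG; elim/supp_ind => [|a k {}u [Gk Jk] IH]; first by rewrite linear0; apply: inA0.
rewrite linearP; apply: inAP => //; rewrite /= swx; apply: inAZ; apply: supp_inx; split.
  rewrite /swG /= swvD !swvN swvK swv_s; apply: subgrpB => //; last exact: subgrp_s.
  exact: subgrpN.
by move=> p; have := Jk (swp p); rewrite /= !ffunE.
Qed.

Lemma sw_niso m G : subgrp G ->
  niso (lie m G) (lie (swe m) (swG G)) (fun u => nrm (sw u)).
Proof.
move=> gG; have gG' := swG_subgrp gG.
apply: (@transport_niso F m (swe m) G (swG G) sw sw 1 swK swK sw_br).
- by move=> u; apply: inA_sw.
- by move=> u /(inA_sw gG'); rewrite sweK swGK.
- exact: oner_neq0.
- by rewrite scale1r; apply: swX1.
Qed.

End Swap.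

(** * Isomorphisms preserve the torus *)

Section Torus.
Variable F : fieldType.
Hypothesis char0 : [pchar F] =i pred0.
Local Notation A := (salg F).
Implicit Types (u v w g : A).
Local Notation s := (sigma F).
Local Notation s1 := (sigma1 F).

Definition shifts (E : A -> A) (cs : seq F) v := foldr (fun c w => E w - c *: w) v cs.

Lemma shifts_lin (E : {linear A -> A}) cs a u v :
  shifts E cs (a *: u + v) = a *: shifts E cs u + shifts E cs v.
Proof.
elim: cs => //= c cs ->; rewrite linearP /= !scaE; ring.
Qed.

Lemma shifts_comm (E : {linear A -> A}) cs cs' v :
  shifts E cs (shifts E cs' v) = shifts E cs' (shifts E cs v).
Proof.
have h c cs1 w : shifts E cs1 (E w - c *: w) = E (shifts E cs1 w) - c *: shifts E cs1 w.
  elim: cs1 => //= c' cs1 ->; rewrite !linearB !linearZ /= !scaE; ring.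
elim: cs' => [//|c cs' IH] /=; by rewrite h IH.
Qed.

Lemma locfin_lin (E : {linear A -> A}) a u v : locfin E u -> locfin E v ->
  locfin E (a *: u + v).
Proof.
move=> [cs e] [cs' e']; exists (cs ++ cs'); rewrite foldr_cat -!/(shifts _ _ _).
rewrite shifts_lin [shifts E cs' v]e' addr0 -[_ *: _]addr0.
have s0 cs1 : shifts E cs1 0 = 0 by elim: cs1 => //= c cs1 ->; rewrite linear0 scaler0 subr0.
by rewrite shifts_lin shifts_comm [shifts E cs u]e !s0 scaler0 addr0.
Qed.

Definition scaleD (e : F) p : A -> A := fun v => e *: D p v.
Fact scaleD_linear e p : linear (scaleD e p).
Proof. by move=> a u v; rewrite /scaleD linearP scalerDr !scalerA mulrC. Qed.
HB.instance Definition _ e p := GRing.isLinear.Build F A A _ (scaleD e p) (scaleD_linear e p).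

(** On a monomial a derivation acts by a scalar up to terms of lower degree. *)
Lemma locfin_D e p v : locfin (scaleD e p) v.
Proof.
elim/monom_ind: v => [|a k u IH]; first by exists [::].
apply: (locfin_lin (E := scaleD e p)) => // {IH u a}.
have [n] := ubnP (k.2 p); elim: n k => // n IH k kn.
have xk : scaleD e p (x k) - (e * k.1 0 p) *: x k = (e * (k.2 p)%:R) *: x (k.1, exp_dec p k.2).
  by rewrite /scaleD Dx !scaE; ring.
case: (posnP (k.2 p)) => [k0|kp].
  by exists [:: e * k.1 0 p]; rewrite /= xk k0 mulr0 scale0r.
have [|cs h] := IH (k.1, exp_dec p k.2).
  by rewrite /= ffunE eqxx; lia.
exists (rcons cs (e * k.1 0 p)); rewrite foldr_rcons xk -/(shifts _ _ _).
have h0 : locfin (scaleD e p) 0 by exists [::].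
have -> : shifts (scaleD e p) cs ((e * (k.2 p)%:R) *: x (k.1, exp_dec p k.2))
  = (e * (k.2 p)%:R) *: shifts (scaleD e p) cs (x (k.1, exp_dec p k.2)).
  have s0 : shifts (scaleD e p) cs 0 = 0.
    by elim: (cs) => //= c cs1 ->; rewrite linear0 scaler0 subr0.
  by rewrite -[X in shifts _ _ X]addr0 shifts_lin s0 addr0.
by rewrite [shifts _ _ _]h scaler0.
Qed.

Lemma nrmX a : a <> s1 -> nrm (X a) = X a.
Proof.
move=> na; rewrite /nrm cox; case: eqP => [[]//|_]; by rewrite scale0r subr0.
Qed.

Lemma zero_neq_s1 : (0 : 'rV[F]_4) <> s1.
Proof.
by move/rowP/(_ p3)/eqP; rewrite !rvE eq_sym oppr_eq0 oner_eq0.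
Qed.

Lemma oppS_neq_s1 : - s <> s1.
Proof.
by move/rowP/(_ p1)/eqP; rewrite !rvE oppr_eq0 oner_eq0.
Qed.

Lemma nrm1 : nrm (1 : A) = 1. Proof. by rewrite -X0 nrmX //; exact: zero_neq_s1. Qed.
Lemma nrmXs : nrm (X (- s)) = X (- s) :> A. Proof. by rewrite nrmX //; exact: oppS_neq_s1. Qed.

Lemma co_nrm u : nrm u = u -> co (s1, exp0) u = 0.
Proof.
by move=> <-; rewrite /nrm coB coZ cox eqxx mulr1 subrr.
Qed.

Lemma X_inj (a b : 'rV[F]_4) c d : c *: X a = d *: X b -> c != 0 -> a = b /\ c = d.
Proof.
move=> e c0; have := congr1 (co (a, exp0)) e; rewrite !coZ !cox eqxx mulr1.
case: eqP => [[->]|_]; first by rewrite mulr1.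
by rewrite mulr0 => h; rewrite h eqxx in c0.
Qed.

Lemma X_neq0 (a : 'rV[F]_4) : X a <> 0 :> A.
Proof.
by move/(congr1 (co (a, exp0))); rewrite cox eqxx co0 => /eqP; rewrite oner_eq0.
Qed.

(** The central exponent has weight zero. *)
Lemma nrm_weight p b w : p = p2 \/ p = p4 -> b != 0 -> D p w = b *: w -> nrm w = w.
Proof.
move=> hp b0 /(D_eigen char0) h; rewrite /nrm.
have [->|n0] := eqVneq (co (s1, exp0) w) 0; first by rewrite scale0r subr0.
have [/= e _] := h _ n0; case/negP: b0; rewrite -e.
by case: hp => ->; rewrite sigma1E.
Qed.

Definition weight (b d : F) g := D p2 g = b *: g /\ D p4 g = d *: g.

(** Central components are excluded: one in D p g could be absorbed into g,
    where normalization forbids it, and one in D q g would contradict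
    commutation of the two derivations. *)
Lemma weightP b d g : (b != 0) || (d != 0) -> nrm g = g ->
  nrm (D p2 g) = b *: g -> nrm (D p4 g) = d *: g -> weight b d g.
Proof.
move=> bd ng.
have half p q c e : p = p2 \/ p = p4 -> q = p2 \/ q = p4 -> c != 0 ->
    nrm (D p g) = c *: g -> nrm (D q g) = e *: g -> D p g = c *: g /\ D q g = e *: g.
  move=> hp hq c0 h1 h2.
  have /nrm_eq[a ea] : nrm (c *: g) = nrm (D p g) by rewrite linearZ /= ng.
  have /nrm_eq[a' ea'] : nrm (e *: g) = nrm (D q g) by rewrite linearZ /= ng.
  have DZ r : r = p2 \/ r = p4 -> D r (X s1) = 0.
    by case=> ->; rewrite DX sigma1E scale0r.
  have Dg : D p g = c *: g - a *: X s1 by rewrite -ea opprB addrC subrK.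
  have Dg' : D q g = e *: g - a' *: X s1 by rewrite -ea' opprB addrC subrK.
  have e0 : D p (g - (c^-1 * a) *: X s1) = c *: (g - (c^-1 * a) *: X s1).
    by rewrite linearB linearZ /= DZ // scaler0 subr0 Dg scalerBr scalerA mulVKf.
  have a0 : a = 0.
    have := co_nrm (nrm_weight hp c0 e0); rewrite coB coZ cox eqxx mulr1 (co_nrm ng).
    by rewrite sub0r => /eqP; rewrite oppr_eq0 mulf_eq0 invr_eq0 (negPf c0) => /eqP.
  have {}Dg : D p g = c *: g by rewrite Dg a0 scale0r subr0.
  split=> //.
  suff a'0 : a' = 0 by rewrite Dg' a'0 scale0r subr0.
  have := congr1 (co (s1, exp0)) (Dcomm p q g).
  rewrite Dg Dg' linearB /= [D p (e *: g)]linearZ [D p (a' *: _)]linearZ [D q _]linearZ /=.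
  rewrite DZ // scaler0 subr0 Dg Dg' !(coB, coZ) cox eqxx (co_nrm ng) !mulr0 mulr1 sub0r.
  by move/eqP; rewrite eq_sym mulf_eq0 (negPf c0) oppr_eq0 => /eqP.
case/orP: bd => h e2 e4.
  by have [] := half p2 p4 _ _ (or_introl erefl) (or_intror erefl) h e2 e4.
by have [] := half p4 p2 _ _ (or_intror erefl) (or_introl erefl) h e4 e2; split.
Qed.

Section Iso.
Variables (m m' : Mvec) (G G' : set 'rV[F]_4) (f : A -> A).
Hypotheses (gG : subgrp G) (gG' : subgrp G').
Hypothesis axG : forall p, exists2 a : F, a != 0 & G (at_pos a p).
Hypothesis axG' : forall p, exists2 a : F, a != 0 & G' (at_pos a p).
Hypothesis nf : niso (lie m G) (lie m' G') f.
Let cL := lie_closed m gG.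
Let cL' := lie_closed m' gG'.

(** The image satisfies the same equation up to a central term, which one more
    bracket annihilates. *)
Lemma locfin_image u v : lie m G u -> lie m' G' v ->
  (forall w, locfin (br u) w) -> locfin (br (f u)) v.
Proof.
move=> lu lv lf; have [w lw ew] := niso_sur nf lv.
have [cs hcs] := lf w.
have key cs1 : lie m G (shifts (br u) cs1 w) /\
    nrm (shifts (br (f u)) cs1 v) = f (shifts (br u) cs1 w).
  elim: cs1 => [//|c cs1 [IH1 IH2]] /=.
  have lb : lie m G (br u (shifts (br u) cs1 w)) by apply: (lieclosed_br cL).
  have lc : lie m G (c *: shifts (br u) cs1 w) by apply: lieZ.
  split; first exact: lieB.
  rewrite linearB linearZ /= -br_nrmr IH2 (nisoB nf lb lc) (nisoZ cL nf) //.
  by rewrite (niso_br nf).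
exists (0 :: cs); rewrite /= scale0r subr0.
have := (key cs).2; rewrite [shifts (br u) cs w]hcs (niso0 cL nf) => h.
by rewrite -br_nrmr [nrm _]h br0r.
Qed.

Lemma lie1 : lie m G 1.
Proof.
rewrite -X0; apply: lieX0 => //; rewrite ?rvE //; first exact: subgrp0.
by rewrite eq_sym oner_eq0.
Qed.

Lemma lieXs : lie m G (X (- s)).
Proof.
apply: lieX0; rewrite ?rvE ?oppr0 //; first by apply: subgrpN => //; apply: subgrp_s.
by rewrite -[-1 == 1]subr_eq0 -opprD oppr_eq0 -mulr2n natrF_eq0.
Qed.

Lemma br1_locfin w : locfin (br 1) w.
Proof.
have -> : br (1 : A) = scaleD 1 p4 by apply: funext => v; rewrite br1 /scaleD scale1r.
exact: locfin_D.
Qed.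

Lemma brXs_locfin w : locfin (br (X (- s))) w.
Proof.
have -> : br (X (- s) : A) = scaleD (-1) p2.
  by apply: funext => v; rewrite brXs /scaleD scaleN1r.
exact: locfin_D.
Qed.

Lemma torus_image u : lie m G u -> (forall w, locfin (br u) w) ->
  exists a b, f u = a *: 1 + b *: X (- s).
Proof.
move=> lu lf; have [|a [b [c e]]] := @locfin_torus F char0 (f u).
  move=> p; have [a a0 Ga] := axG' p; exists a => // z.
  by apply: locfin_image => //; apply: lie_axis.
have nZ : nrm (c *: X s1) = 0 by rewrite linearZ /= nrmX1 scaler0.
by exists a, b; rewrite -(niso_nrm nf lu) e -addrA !nrmP nrm1 nrmXs nZ addr0.
Qed.

End Iso.
End Torus.

(** * The two distinguished lines of the torus *)

Section Axes.
Variable F : fieldType.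
Hypothesis char0 : [pchar F] =i pred0.
Local Notation A := (salg F).
Implicit Types (u v w g : A).
Local Notation s := (sigma F).
Local Notation s1 := (sigma1 F).

Lemma multiple_notin (a : F) (bad : seq F) : a != 0 -> exists n : nat, n%:R * a \notin bad.
Proof.
move=> a0; apply: contrapT => nex.
have sub : {subset [seq n%:R * a | n <- iota 0 (size bad).+1] <= bad}.
  move=> _ /mapP[n _ ->]; apply: contraT => h; case: nex; by exists n.
have := uniq_leq_size _ sub; rewrite size_map size_iota ltnn map_inj_in_uniq.
  by rewrite iota_uniq => /(_ isT).
have le_inj n k : (n <= k)%N -> n%:R * a = k%:R * a -> n = k.
  move=> nk /(mulIf a0)/eqP; rewrite eq_sym -subr_eq0 -natrB // natrF_eq0 //.
  by move=> h; apply/eqP; rewrite eqn_leq nk.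
move=> n k _ _ e; case/orP: (leq_total n k) => nk; first exact: le_inj.
by apply/esym/le_inj.
Qed.

Lemma brXX34 a b : form12 a b = 0 -> br (X a) (X b) = form34 a b *: X (a + b) :> A.
Proof. by move=> e; rewrite brXX e scale0r add0r. Qed.

Lemma brXX12 a b : form34 a b = 0 -> br (X a) (X b) = form12 a b *: X (a + b + s) :> A.
Proof. by move=> e; rewrite brXX e scale0r addr0. Qed.

Lemma mulI_scal (u g : A) c : g <> 0 -> u * g = c *: g -> u = scal c.
Proof.
by move=> g0; rewrite scaE ![_ * g]mulrC => /(salg_mulI char0 g0).
Qed.

Lemma D24_br p u v : p = p2 \/ p = p4 -> D p (br u v) = br (D p u) v + br u (D p v).
Proof.
move=> hp.
have DD a b : D p (a + b) = D p a + D p b :> A by exact: linearD.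
have DN a : D p (- a) = - D p a :> A by exact: linearN.
rewrite /br !(DD, DN, DM) DX.
have -> : s 0 p = 0 by case: hp => ->; rewrite sigmaE.
by rewrite scale0r !(Dcomm p); ring.
Qed.

(** An element commuting with the torus acts on a weight space by a
    multiplication. *)
Lemma br_weight u b d g : D p2 u = 0 -> D p4 u = 0 -> weight b d g ->
  br u g = (b *: (X s * D p1 u) + d *: (u + D p3 u)) * g.
Proof.
by move=> e2 e4 [h2 h4]; rewrite /br e2 e4 h2 h4 !scaE; ring.
Qed.

Section Iso.
Variables (m m' : Mvec) (G G' : set 'rV[F]_4) (f : A -> A).
Hypotheses (gG : subgrp G) (gG' : subgrp G').
Hypothesis axG : forall p, exists2 a : F, a != 0 & G (at_pos a p).
Hypothesis axG' : forall p, exists2 a : F, a != 0 & G' (at_pos a p).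
Hypothesis nf : niso (lie m G) (lie m' G') f.
Let cL := lie_closed m gG.
Let cL' := lie_closed m' gG'.
Variables t r q p : F.
Hypothesis f1 : f 1 = t *: 1 + r *: X (- s).
Hypothesis fXs : f (X (- s)) = q *: 1 + p *: X (- s).

Lemma f_torus0 a b : f (a *: 1 + b *: X (- s)) = 0 -> a = 0 /\ b = 0.
Proof.
have l1 := lie1 m gG axG; have ls := lieXs char0 m gG axG.
move/(niso_ker nf (lieP a l1 (lieZ b ls))).
rewrite nrmP nrm1 linearZ /= nrmXs => h; split.
  have := congr1 (co (0, exp0)) h; rewrite coD !coZ co0 -X0 !cox eqxx.
  case: eqP => [[/eqP]|_]; last by rewrite mulr1 mulr0 addr0.
  by rewrite oppr_eq0 => /eqP/rowP/(_ p1)/eqP; rewrite !rvE oner_eq0.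
have := congr1 (co (- s, exp0)) h; rewrite coD !coZ co0 -X0 !cox eqxx.
case: eqP => [[/esym/eqP]|_]; last by rewrite mulr1 mulr0 add0r.
by rewrite oppr_eq0 => /eqP/rowP/(_ p1)/eqP; rewrite !rvE oner_eq0.
Qed.

Lemma f_torus_lin a b : f (a *: 1 + b *: X (- s)) =
  (a * t + b * q) *: 1 + (a * r + b * p) *: X (- s).
Proof.
have l1 := lie1 m gG axG; have ls := lieXs char0 m gG axG.
rewrite (niso_lin nf) ?(nisoZ cL nf) //; last exact: lieZ.
by rewrite f1 fXs !scaE; ring.
Qed.

Lemma torus_det : t * p - r * q != 0.
Proof.
apply/eqP => det0.
have key a b : a * t + b * q = 0 -> a * r + b * p = 0 -> a = 0 /\ b = 0.
  by move=> e1 e2; apply: f_torus0; rewrite f_torus_lin e1 e2 !scale0r addr0.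
have [p0 /eqP] : p = 0 /\ - r = 0 by apply: key; [rewrite -[RHS]det0|]; ring.
rewrite oppr_eq0 => /eqP r0.
have [q0 /eqP] : q = 0 /\ - t = 0 by apply: key; rewrite ?p0 ?r0; ring.
rewrite oppr_eq0 => /eqP t0.
have [/eqP] : 1 = 0 :> F /\ 0 = 0 :> F by apply: key; rewrite ?t0 ?r0 ?q0 ?p0; ring.
by rewrite oner_eq0.
Qed.

(** As br 1 = D p4 and br (X (- s)) = - D p2, applying f to the two brackets
    gives a linear system for the derivatives of f v, whose matrix is that of f
    on the torus. *)
Lemma weight_image v b d : lie m G v -> weight b d v -> (b != 0) || (d != 0) ->
  weight ((q * d + t * b) / (t * p - r * q)) ((p * d + r * b) / (t * p - r * q)) (f v).
Proof.
move=> lv [v2 v4] bd.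
have l1 := lie1 m gG axG; have ls := lieXs char0 m gG axG.
have D0 := torus_det; set Dt := t * p - r * q in D0 *.
have e4 : d *: f v = t *: nrm (D p4 (f v)) - r *: nrm (D p2 (f v)).
  rewrite -(nisoZ cL nf) // -v4 -br1 (niso_br nf) // f1 brDl brZl br1 brXs nrmP linearZ /=.
  by rewrite linearN /= scalerN.
have e2 : - b *: f v = q *: nrm (D p4 (f v)) - p *: nrm (D p2 (f v)).
  rewrite -(nisoZ cL nf) // scaleNr -v2 -brXs (niso_br nf) // fXs brDl brZl br1 brXs nrmP linearZ /=.
  by rewrite linearN /= scalerN.
apply: weightP; rewrite ?(niso_nrm nf) //.
- apply: contraTT bd; rewrite !negb_or !negbK !mulf_eq0 !invr_eq0 (negPf D0) !orbF.
  move=> /andP[/eqP h1 /eqP h2]; apply/andP; split; rewrite -(mulrI_eq0 _ (mulfI D0)) /Dt.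
    rewrite (_ : _ * b = p * (q * d + t * b) - q * (p * d + r * b)); last by ring.
    by rewrite h1 h2 !mulr0 subrr.
  rewrite (_ : _ * d = t * (p * d + r * b) - r * (q * d + t * b)); last by ring.
  by rewrite h1 h2 !mulr0 subrr.
- apply: (scalerI D0); rewrite scalerA mulrCA mulfV // mulr1.
  rewrite (_ : (q * d + t * b) *: f v = q *: (d *: f v) - t *: (- b *: f v)).
    by rewrite e4 e2 /Dt !scaE; ring.
  by rewrite {e2 e4} !scaE; ring.
- apply: (scalerI D0); rewrite scalerA mulrCA mulfV // mulr1.
  rewrite (_ : (p * d + r * b) *: f v = p *: (d *: f v) - r *: (- b *: f v)).
    by rewrite e4 e2 /Dt !scaE; ring.
  by rewrite {e2 e4} !scaE; ring.
Qed.

Lemma fX_neq0 a : lie m G (X a) -> a <> s1 -> f (X a) <> 0.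
Proof.
by move=> la na e; have := niso_ker nf la e; rewrite nrmX // => /X_neq0.
Qed.

Lemma at_neq_s1 (a : F) i : i <> p3 -> at_pos a i <> s1.
Proof.
move=> ni /rowP/(_ p3)/eqP; rewrite !rvE (introF eqP ni) mulr0.
by rewrite eq_sym oppr_eq0 oner_eq0.
Qed.

(** Suppose that f 1 has both components.  Let xi be a generic exponent on the
    third axis, and let u represent f (X xi).  It has weight zero and thus acts
    on weight spaces by multiplications.  It kills the image of X be, as X xi
    does X be, and it acts invertibly on the image of X de, where be and de lie
    on the second and fourth axes.  The two conditions determine the
    multiplications; they turn out to be scalars, while X xi does not act on
    X de by a scalar. *)
Lemma torus_axis : t = 0 \/ r = 0.
Proof.
have D0 := torus_det.
have [b b0 Gb] := axG p2; have [d d0 Gd] := axG p4; have [c' c'0 Gc'] := axG p3.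
have [n] := multiple_notin [:: 0; 1; -1; 2; -2] c'0; set c := n%:R * c' => cbad.
have Gc : G (at_pos c p3).
  by rewrite /c /at_pos -scalerA scaler_nat; apply: (subgrpMn gG).
move: cbad; rewrite !inE !negb_or => /and5P[c0 c1 cN1 c2 cN2].
set be := at_pos b p2; set de := at_pos d p4; set xi := at_pos c p3.
have lbe : lie m G (X be) by apply: (lieX2 m gG); rewrite // /be !rvE mulr1.
have lde : lie m G (X de) by apply: (lieX4 m gG); rewrite // /de !rvE mulr1.
have Gxi : G xi by []. have GNxi : G (- xi) by apply: (subgrpN gG).
have lx y : y = xi \/ y = - xi -> lie m G (X y).
  move=> hy; have Gy : G y by case: hy => ->.
  by apply: (lieX0 m gG axG) => //; case: hy => ->; rewrite /xi !rvE /= ?simp01 // eq_sym oner_eq0.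
have lde' y : y = xi \/ y = - xi -> lie m G (X (y - de)).
  move=> hy; apply: (lieX4 m gG); first by apply: (subgrpB gG) => //; case: hy => ->.
  by case: hy => ->; rewrite /xi /de !rvE /= !simp01 oppr_eq0.
have lde2 y : y = xi \/ y = - xi -> lie m G (X (y + de)).
  move=> hy; apply: (lieX4 m gG); first by apply: (subgrpD gG) => //; case: hy => ->.
  by case: hy => ->; rewrite /xi /de !rvE /= !simp01.
have wbe : weight b 0 (X be) by split; rewrite DX /be !rvE /= !simp01.
have wde : weight 0 d (X de) by split; rewrite DX /de !rvE /= !simp01.
have := weight_image lbe wbe; rewrite b0 !mulr0 !add0r => /(_ isT).
set Dt := t * p - r * q in D0 *.
set g2 := f (X be); set b1 := t * b / Dt; set d1 := r * b / Dt => wg2.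
have := weight_image lde wde; rewrite d0 orbT !mulr0 !addr0 -/Dt => /(_ isT).
set g4 := f (X de); set b2 := q * d / Dt; set d2 := p * d / Dt => wg4.
have bd1 : (b1 != 0) || (d1 != 0).
  rewrite !mulf_eq0 !invr_eq0 (negPf D0) (negPf b0) !orbF -negb_and.
  by apply: contra D0 => /andP[/eqP h1 /eqP h2]; rewrite /Dt h1 h2 !mul0r subrr.
have bd2 : (b2 != 0) || (d2 != 0).
  rewrite !mulf_eq0 !invr_eq0 (negPf D0) (negPf d0) !orbF -negb_and.
  by apply: contra D0 => /andP[/eqP h1 /eqP h2]; rewrite /Dt h1 h2 !mulr0 subrr.
have g20 : g2 <> 0 by apply: fX_neq0 => //; apply: at_neq_s1.
have g40 : g4 <> 0 by apply: fX_neq0 => //; apply: at_neq_s1.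
have nrmw b' d' w : (b' != 0) || (d' != 0) -> weight b' d' w -> nrm w = w.
  by case/orP=> h [w2 w4]; [apply: nrm_weight h w2|apply: nrm_weight h w4]; auto.
(* X y is a bracket of monomials of opposite weights, and the same bracket of
   their images has weight zero exactly, not only modulo the centre. *)
have rep y : y = xi \/ y = - xi -> exists u, [/\ D p2 u = 0, D p4 u = 0 & nrm u = f (X y)].
  move=> hy; have y3 : y 0 p3 + 2 != 0.
    case: hy => ->; rewrite /xi !rvE /= mulr1; first by rewrite addr_eq0.
    by rewrite addrC subr_eq0 eq_sym.
  have [y1 [y2 y4]] : y 0 p1 = 0 /\ y 0 p2 = 0 /\ y 0 p4 = 0.
    by case: hy => ->; rewrite /xi !rvE /= !simp01.
  have ebr : br (X de) (X (y - de)) = - (d * (y 0 p3 + 2)) *: X y.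
    rewrite brXX34; last by rewrite /form12 /de !rvE y1 y2 /=; ring.
    by rewrite [de + _]addrC subrK; congr (_ *: _); rewrite /form34 /de !rvE y4 /=; ring.
  have k0 : - (d * (y 0 p3 + 2)) != 0 by rewrite oppr_eq0 mulf_neq0.
  have wy : weight 0 (- d) (X (y - de)).
    by split; rewrite DX /de !rvE ?y2 ?y4 /= !simp01.
  have := weight_image (lde' _ hy) wy; rewrite oppr_eq0 d0 orbT !mulr0 !addr0 -/Dt => /(_ isT).
  rewrite !mulrN !mulNr -/b2 -/d2; set h := f _ => -[h2 h4].
  have [g42 g44] := wg4.
  exists ((- (d * (y 0 p3 + 2)))^-1 *: br g4 h); split.
  - rewrite linearZ /= D24_br; last by left.
    by rewrite g42 h2 brZl brZr scaleNr addrN scaler0.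
  - rewrite linearZ /= D24_br; last by right.
    by rewrite g44 h4 brZl brZr scaleNr addrN scaler0.
  rewrite linearZ /= -(niso_br nf) // ?ebr; last exact: lde'.
  by rewrite (nisoZ cL nf) ?scalerA ?mulVf ?scale1r //; apply: lx.
have [u [u2 u4 nu]] := rep xi (or_introl erefl).
have [u' [u'2 u'4 nu']] := rep (- xi) (or_intror erefl).
have := br_weight u2 u4 wg2; have := br_weight u2 u4 wg4; have := br_weight u'2 u'4 wg4.
set t1 := X s * D p1 u; set t3 := u + D p3 u; set t1' := X s * D p1 u'; set t3' := u' + D p3 u'.
move=> br' br4 br2.
have brw w b' d' : D p2 w = 0 -> D p4 w = 0 -> forall g, weight b' d' g -> weight b' d' (br w g).
  move=> w2 w4 g [h2 h4]; split; rewrite D24_br; auto.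
    by rewrite w2 h2 br0l add0r brZr.
  by rewrite w4 h4 br0l add0r brZr.
(* [X xi, X be] = 0, so u kills g2. *)
have k2 : b1 *: t1 + d1 *: t3 = 0.
  apply: contrapT => k2; apply: (salg_mul_neq0 char0 k2 g20); rewrite -br2.
  rewrite -(nrmw _ _ _ bd1 (brw _ _ _ u2 u4 _ wg2)) -br_nrml nu -(niso_br nf) //; last by apply: lx; left.
  rewrite brXX34; last by rewrite /form12 /xi /be !rvE /=; ring.
  rewrite (_ : form34 xi be = 0) ?scale0r ?(niso0 cL nf) //.
  by rewrite /form34 /xi /be !rvE /=; ring.
(* [X xi, [X (- xi), X de]] is a nonzero multiple of X de, so the multiplication
   by which u acts on g4 is a unit, hence a monomial. *)
pose K := (1 - c) * (1 + c) * d * d.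
have K0 : K != 0.
  rewrite /K !mulf_neq0 //; first by rewrite subr_eq0 eq_sym.
  by rewrite addrC addr_eq0.
have k4 : (b2 *: t1 + d2 *: t3) * (b2 *: t1' + d2 *: t3') = scal K.
  apply: (mulI_scal g40); rewrite -mulrA -br' -[g4]/(f (X de)).
  have wb' := brw _ _ _ u'2 u'4 _ wg4.
  rewrite -(br_weight u2 u4 wb') -(nrmw _ _ _ bd2 (brw _ _ _ u2 u4 _ wb')).
  rewrite -br_nrml nu -br_nrmr -[X in nrm (br _ (nrm X))]br_nrml nu' -(niso_br nf) //; last by apply: lx; right.
  have lb : lie m G (br (X (- xi)) (X de)) by apply: (lieclosed_br cL) => //; apply: lx; right.
  rewrite -(niso_br nf) //; last by apply: lx; left.
  rewrite -(nisoZ cL nf) //; congr f.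
  rewrite brXX34; last by rewrite /form12 /xi /de !rvE /=; ring.
  rewrite brZr brXX34; last by rewrite /form12 /xi /de !rvE /=; ring.
  rewrite scalerA addNKr; congr (_ *: _).
  by rewrite /K /form34 /xi /de !rvE /=; ring.
have [|k [et [k0 ek]]] := @unit_monomial F char0 (b2 *: t1 + d2 *: t3) (K^-1 *: (b2 *: t1' + d2 *: t3')).
  by rewrite -scalerAr k4 /scal scalerA mulVf // scale1r.
have E0 : b1 * d2 - d1 * b2 != 0.
  rewrite (_ : _ - _ = b * d / Dt); first by rewrite !mulf_neq0 ?invr_eq0.
  by move: (D0); rewrite /b1 /b2 /d1 /d2 /Dt => D0'; field.
have [b10|b10] := eqVneq b1 0.
  by left; move/eqP: b10; rewrite !mulf_eq0 invr_eq0 (negPf D0) (negPf b0) !orbF => /eqP.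
have [d10|d10] := eqVneq d1 0.
  by right; move/eqP: d10; rewrite !mulf_eq0 invr_eq0 (negPf D0) (negPf b0) !orbF => /eqP.
exfalso.
pose k3 := b1 * k / (b1 * d2 - d1 * b2); pose k1 := - (d1 / b1 * k3).
have k30 : k3 != 0 by apply: mulf_neq0 (mulf_neq0 b10 k0) (invr_neq0 E0).
have k10 : k1 != 0.
  by rewrite oppr_eq0; apply: mulf_neq0 (mulf_neq0 d10 (invr_neq0 b10)) k30.
have et3 : t3 = k3 *: X et.
  apply: (scalerI E0); rewrite scalerA [_ * k3]mulrC /k3 divfK // -scalerA -ek.
  rewrite -[RHS]subr0 -(scaler0 _ b2) -k2 !scaE; ring.
have et1 : t1 = k1 *: X et.
  apply: (scalerI b10); rewrite scalerA /k1 mulrN mulrA [b1 * _]mulrCA mulfV // mulr1.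
  by rewrite scaleNr -scalerA -et3 -[LHS](addrK (d1 *: t3)) k2 sub0r.
have D1u : D p1 u = k1 *: X (et - s).
  by rewrite -[LHS]mul1r -(XsN F) mulrAC -/t1 et1 -scalerAl mulXX.
have Dt3 i : D i u = 0 -> et 0 i = 0.
  move=> Diu; have : D i t3 = 0 by rewrite /t3 linearD /= Dcomm Diu linear0 addr0.
  rewrite et3 linearZ /= DX scalerA => /(congr1 (co (et, exp0))).
  by rewrite coZ cox eqxx mulr1 co0 => /eqP; rewrite mulf_eq0 (negPf k30) => /eqP.
(* Both t1 and t3 derive from u; D p1 commutes with 1 + D p3. *)
have cross : (k1 * et 0 p3) *: X (et - s) = (k3 * et 0 p1) *: X et.
  have : D p1 t3 = D p1 u + D p3 (D p1 u) by rewrite /t3 linearD /= Dcomm.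
  rewrite et3 D1u !linearZ /= !DX !rvE !scalerA => ->.
  by rewrite -scalerDl; congr (_ *: _); ring.
have et30 : et 0 p3 = 0.
  apply/eqP/negPn/negP => e3; have := X_inj cross; rewrite mulf_neq0 // => /(_ isT)[].
  by move/rowP/(_ p1)/eqP; rewrite !rvE -subr_eq0 addrAC subrr sub0r oppr_eq0 oner_eq0.
have et10 : et 0 p1 = 0.
  move: cross; rewrite et30 mulr0 scale0r => /(congr1 (co (et, exp0))).
  by rewrite co0 coZ cox eqxx mulr1 => /eqP; rewrite eq_sym mulf_eq0 (negPf k30) => /eqP.
have et0 : et = 0 by apply: rV4P; rewrite ?et10 ?et30 ?Dt3 // !rvE.
have bru : br u g4 = (k3 * d2 + k1 * b2) *: g4.
  by rewrite br4 et1 et3 et0 X0 !scaE; ring.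
(* Now u acts on g4 by a scalar. *)
have : f (form34 xi de *: X (xi + de)) = (k3 * d2 + k1 * b2) *: g4.
  rewrite -brXX34; last by rewrite /form12 /xi /de !rvE /=; ring.
  rewrite (niso_br nf) //; last by apply: lx; left.
  rewrite -nu br_nrml bru linearZ /= [nrm g4](nrmw _ _ _ bd2 wg4) //.
have lxd : lie m G (X (xi + de)) by apply: lde2; left.
rewrite -(nisoZ cL nf) // => /(niso_eq cL nf).
move=> /(_ (lieZ _ lxd) (lieZ _ lde)); rewrite !linearZ /= !nrmX; last first.
- by move/rowP/(_ p4)/eqP; rewrite /xi /de !rvE /= !simp01 (negPf d0).
- by apply: at_neq_s1.
move/X_inj => []; last first.
  by move/rowP/(_ p3)/eqP; rewrite /xi /de !rvE /= !simp01 (negPf c0).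
by rewrite /form34 /xi /de !rvE /= !simp01 mulf_neq0 // addr_eq0.
Qed.

End Iso.
End Axes.

(** * Isomorphisms fixing the lines of the torus *)

Section Diagonal.
Variable F : fieldType.
Hypothesis char0 : [pchar F] =i pred0.
Local Notation A := (salg F).
Implicit Types (u v w : A) (a b : 'rV[F]_4).
Local Notation s := (sigma F).
Local Notation s1 := (sigma1 F).
Variables (m m' : Mvec) (G G' : set 'rV[F]_4) (f : A -> A).
Hypotheses (gG : subgrp G) (gG' : subgrp G').
Hypothesis axG : forall p, exists2 a : F, a != 0 & G (at_pos a p).
Hypothesis axG' : forall p, exists2 a : F, a != 0 & G' (at_pos a p).
Hypothesis nf : niso (lie m G) (lie m' G') f.
Variables lam mu : F.
Hypothesis f1 : f 1 = lam *: 1.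
Hypothesis fXs : f (X (- s)) = mu *: X (- s).
Let cL := lie_closed m gG.
Let cL' := lie_closed m' gG'.
Local Notation kap := (mu^-1).
Local Notation kap' := (lam^-1).

Lemma lam_mu_neq0 : lam != 0 /\ mu != 0.
Proof.
have := @torus_det F char0 m m' G G' f gG axG nf lam 0 0 mu.
rewrite !scale0r addr0 add0r => /(_ f1 fXs).
by rewrite mul0r subr0 mulf_eq0 negb_or => /andP.
Qed.
Let lam0 : lam != 0. Proof. by case: lam_mu_neq0. Qed.
Let mu0 : mu != 0. Proof. by case: lam_mu_neq0. Qed.

Lemma diag_weight v (b d : F) : lie m G v -> weight b d v -> (b != 0) || (d != 0) ->
  weight (kap * b) (kap' * d) (f v).
Proof.
move=> lv wv bd.
have := @weight_image F char0 m m' G G' f gG axG nf lam 0 0 mu.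
rewrite !scale0r addr0 add0r => /(_ f1 fXs _ _ _ lv wv bd).
rewrite !mul0r subr0 add0r addr0.
have -> : lam * b / (lam * mu) = kap * b by field; rewrite lam0 mu0.
by have -> : mu * d / (lam * mu) = kap' * d by field; rewrite lam0 mu0.
Qed.

(** Exponents whose weight lies on the first axis of weights, and exponents of
    weight zero. *)
Definition G2 a := [/\ G a, a 0 p2 != 0 & a 0 p4 = 0].
Definition G0 a := [/\ G a, a 0 p2 = 0 & a 0 p4 = 0].

Lemma G2D0 a b : G2 a -> G0 b -> G2 (a + b).
Proof.
by move=> [Ga a2 a4] [Gb b2 b4]; split; rewrite ?rvE ?b2 ?a4 ?b4 ?addr0 //; apply: subgrpD.
Qed.
Lemma G0D a b : G0 a -> G0 b -> G0 (a + b).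
Proof.
by move=> [Ga a2 a4] [Gb b2 b4]; split; rewrite ?rvE ?a2 ?b2 ?a4 ?b4 ?addr0 //; apply: subgrpD.
Qed.
Lemma G0N a : G0 a -> G0 (- a).
Proof. by move=> [Ga a2 a4]; split; rewrite ?rvE ?a2 ?a4 ?oppr0 //; apply: subgrpN. Qed.
Lemma G0s : G0 s.
Proof. by split; rewrite ?rvE //; apply: subgrp_s. Qed.
Lemma G2D a b : G2 a -> G2 b -> a 0 p2 + b 0 p2 != 0 -> G2 (a + b).
Proof.
by move=> [Ga a2 a4] [Gb b2 b4] ab; split; rewrite ?rvE ?a4 ?b4 ?addr0 //; apply: subgrpD.
Qed.
Lemma G2N a : G2 a -> G2 (- a).
Proof.
by move=> [Ga a2 a4]; split; rewrite ?rvE ?a4 ?oppr0 ?oppr_eq0 //; apply: subgrpN.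
Qed.

Lemma G2NN a : G2 a -> G2 (- a - s - s).
Proof.
by move=> /G2N ha; apply: G2D0 (G0N G0s); apply: G2D0 (G0N G0s).
Qed.

Lemma G2lie a : G2 a -> lie m G (X a).
Proof. by case=> Ga a2 _; apply: lieX2. Qed.
Lemma G2s1 a : G2 a -> a <> s1.
Proof. by case=> _ a2 _ e; move: a2; rewrite e rvE eqxx. Qed.

Local Notation g a := (f (X a)).

Lemma g_weight a : G2 a -> D p2 (g a) = (kap * a 0 p2) *: g a /\ D p4 (g a) = 0.
Proof.
move=> ha; have [Ga a2 a4] := ha.
have wa : weight (a 0 p2) 0 (X a) by split; rewrite DX ?a4.
have [|-> ->] := diag_weight (G2lie ha) wa; first by rewrite a2.
by rewrite mulr0 scale0r.
Qed.

Lemma g_neq0 a : G2 a -> g a <> 0.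
Proof. by move=> ha; apply: (fX_neq0 nf); [apply: G2lie|apply: G2s1]. Qed.

Lemma kap2 a : G2 a -> kap * a 0 p2 != 0.
Proof. by case=> _ a2 _; rewrite mulf_neq0 ?invr_eq0. Qed.

Lemma br_g a b : G2 a -> G2 b -> br (g a) (g b) =
  X s * ((kap * b 0 p2) *: (D p1 (g a) * g b) - (kap * a 0 p2) *: (g a * D p1 (g b))).
Proof.
move=> /g_weight[a2 a4] /g_weight[b2 b4]; rewrite /br a2 a4 b2 b4 !scaE; ring.
Qed.

Lemma form34_G2 a b : G2 a -> G2 b -> form34 a b = 0.
Proof. by case=> _ _ a4 [_ _ b4]; rewrite /form34 a4 b4 !mulr0 subr0. Qed.

Lemma form12_g a b : G2 a -> G2 b -> a 0 p2 + b 0 p2 != 0 ->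
  form12 a b *: g (a + b + s) = br (g a) (g b).
Proof.
move=> ha hb ab.
have la := G2lie ha; have lb := G2lie hb.
have lab := G2lie (G2D0 (G2D ha hb ab) G0s).
rewrite -(nisoZ cL nf) // -brXX12 ?form34_G2 // (niso_br nf) //.
have [a2 a4] := g_weight ha; have [b2 b4] := g_weight hb.
apply: (@nrm_weight F char0 p2 (kap * (a 0 p2 + b 0 p2))); first by left.
  by rewrite mulf_neq0 ?invr_eq0.
by rewrite D24_br; [rewrite a2 b2 brZl brZr !scaE; ring|left].
Qed.

(** For a and a' of opposite weights, [[X a, X a'], X c] is a multiple of
    X (c + e), where e depends on a + a' only.  On the side of the images, the
    inner bracket has weight zero, so that it acts on the image of X c by a
    multiplication independent of c. *)
Lemma shift_mult e : G0 e -> e 0 p1 != 1 -> e 0 p1 != 2 ->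
  exists M, forall c, G2 c -> g (c + e) = M * g c.
Proof.
move=> he e1 e2; have [b b0 Gb] := axG p2.
pose a := at_pos b p2; pose a' := e - s - s - a.
have ha : G2 a by split=> //; rewrite /a !rvE /= ?mulr1 ?mulr0.
have ha' : G2 a'.
  have [Ge _ _] := G0D (G0D he (G0N G0s)) (G0N G0s).
  split; first by apply: (subgrpB gG).
    by rewrite /a' /a !rvE /=; case: he => _ -> _; rewrite !simp01 oppr_eq0.
  by rewrite /a' /a !rvE /=; case: he => _ _ ->; rewrite !simp01.
pose w := br (g a) (g a').
have [a2 a4] := g_weight ha; have [a'2 a'4] := g_weight ha'.
have aa' : kap * a' 0 p2 = - (kap * a 0 p2).
  by rewrite /a' /a !rvE /=; case: he => _ -> _; ring.
have w2 : D p2 w = 0.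
  by rewrite D24_br; [rewrite a2 a'2 aa' brZl brZr scaleNr addrN|left].
have w4 : D p4 w = 0 by rewrite D24_br; [rewrite a4 a'4 br0l br0r addr0|right].
exists ((kap / (- (e 0 p1 - 2) * b * (e 0 p1 - 1))) *: (X s * D p1 w)) => c hc.
have [_ c20 c4] := hc.
pose K := - (e 0 p1 - 2) * b * (e 0 p1 - 1).
have K0 : K != 0 by rewrite /K !mulf_neq0 // ?oppr_eq0 subr_eq0.
have E : br (br (X a) (X a')) (X c) = (K * c 0 p2) *: X (c + e).
  rewrite brXX12 ?form34_G2 // brZl (_ : a + a' + s = e - s); last first.
    by rewrite /a' [a + _]addrC subrK subrK.
  rewrite brXX12; last by rewrite /form34 !rvE c4; case: he => _ _ ->; ring.
  rewrite scalerA (_ : e - s + c + s = c + e); last by rewrite addrAC subrK addrC.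
  congr (_ *: _); rewrite /form12 /K /a' /a !rvE /=.
  by case: he => _ -> _; ring.
have lc := G2lie hc; have la := G2lie ha; have la' := G2lie ha'.
have lce := G2lie (G2D0 hc he).
have wc : br w (g c) = (kap * c 0 p2) *: (X s * D p1 w) * g c.
  rewrite (br_weight (b := kap * c 0 p2) (d := 0) w2 w4); first by rewrite scale0r addr0.
  by have [h2 h4] := g_weight hc; split; rewrite // scale0r.
have : (K * c 0 p2) *: g (c + e) = br w (g c).
  rewrite -(nisoZ cL nf) // -E (niso_br nf) //; last exact: (lieclosed_br cL).
  rewrite (niso_br nf) // br_nrml -/w.
  apply: (@nrm_weight F char0 p2 (kap * c 0 p2)); [by left|exact: kap2|].
  rewrite D24_br; last by left.
  by have [-> _] := g_weight hc; rewrite w2 br0l add0r brZr.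
rewrite wc => h.
apply: (scalerI (a := K * c 0 p2)); first by rewrite mulf_neq0.
rewrite h -/K -!scalerAl scalerA; congr (_ *: _).
by rewrite [RHS]mulrAC [K * _]mulrCA mulfV // mulr1.
Qed.

(** The exponent th and the scalar ch are the image of e as seen from its
    action on weight spaces; a direct definition by f (X e) would leave
    exceptions. *)
Definition shift (e : 'rV[F]_4) (ch : F) (th : 'rV[F]_4) := [/\ ch != 0, th 0 p2 = 0, th 0 p4 = 0
  & forall c, G2 c -> g (c + e) = ch *: (X th * g c)].

Lemma some_G2 : exists a, G2 a.
Proof.
have [b b0 Gb] := axG p2; exists (at_pos b p2).
by split=> //; rewrite !rvE /= ?mulr1 ?mulr0.
Qed.

Lemma eigen_mulX p c t u (e : F) : D p u = e *: u ->
  D p (c *: (X t * u)) = (t 0 p + e) *: (c *: (X t * u)).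
Proof. by move=> h; rewrite DZ DM DX h !scaE; ring. Qed.

Lemma eigen_uniq u (e e' : F) : u <> 0 -> e *: u = e' *: u -> e = e'.
Proof.
move=> u0 /eqP; rewrite -subr_eq0 -scalerBl scaler_eq0 => /orP[|/eqP//].
by rewrite subr_eq0 => /eqP.
Qed.

(** The multipliers of e and -e are inverse to each other, hence monomials.
    The excluded values of the first coordinate are reached by splitting off a
    multiple of a point of the first axis. *)
Lemma shiftP e : G0 e -> exists ch th, shift e ch th.
Proof.
have [a ha] := some_G2.
have unit e1 : G0 e1 -> e1 0 p1 \notin [:: 1; 2; -1; -2] -> exists ch th, shift e1 ch th.
  move=> he; rewrite !inE !negb_or => /and4P[n1 n2 n1' n2'].
  have [M hM] := shift_mult he n1 n2.
  have [||M' hM'] := shift_mult (G0N he); rewrite ?rvE ?eqr_oppLR //.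
  have MM : M * M' = 1.
    apply: (salg_mulI char0 (g_neq0 ha)); rewrite mulr1 mulrC -mulrA -hM' // -hM.
      by rewrite subrK.
    exact/G2D0/G0N.
  have [ch [th [ch0 eM]]] := unit_monomial char0 MM.
  have E c : G2 c -> g (c + e1) = ch *: (X th * g c) by move=> hc; rewrite hM // eM scalerAl.
  have gX c t : c != 0 -> c *: (X t * g a) <> 0.
    move=> c0 /eqP; rewrite scaler_eq0 (negPf c0) => /eqP.
    exact: (salg_mul_neq0 char0 (@X_neq0 F t) (g_neq0 ha)).
  exists ch, th; split=> //.
  - have [h1 _] := g_weight (G2D0 ha he); have [h2 _] := g_weight ha.
    rewrite E // (eigen_mulX ch th h2) in h1; move/(eigen_uniq (gX ch th ch0)): h1.
    by rewrite rvE; case: (he) => _ -> _; rewrite addr0 => /(canRL (addrK _)); rewrite subrr.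
  - have [_ h1] := g_weight (G2D0 ha he); have [_ h2] := g_weight ha.
    have {}h2 : D p4 (g a) = 0 *: g a by rewrite scale0r.
    rewrite E // (eigen_mulX ch th h2) -[RHS](scale0r (ch *: (X th * g a))) in h1.
    by move/(eigen_uniq (gX ch th ch0)): h1; rewrite addr0.
move=> he; have [b b0 Gb] := axG p1.
have [n] := multiple_notin char0 ([:: 1; 2; -1; -2] ++
  [:: e 0 p1 - 1; e 0 p1 - 2; e 0 p1 + 1; e 0 p1 + 2]) b0.
rewrite mem_cat negb_or => /andP[h1 h2]; set z := n%:R * b in h1 h2.
have hz : G0 (at_pos z p1).
  split; rewrite ?rvE /= ?mulr0 //.
  by rewrite /z /at_pos -scalerA scaler_nat; apply: (subgrpMn gG).
have [|ch [th [ch0 t2 t4 E]]] := unit _ hz; first by rewrite !rvE /= mulr1.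
have [|ch' [th' [ch'0 t'2 t'4 E']]] := unit _ (G0D he (G0N hz)).
  move: h2; rewrite !rvE /= mulr1 !inE !negb_or => /and4P[k1 k2 k3 k4].
  apply/and4P; split; rewrite subr_eq addrC -subr_eq ?opprK eq_sym //.
exists (ch * ch'), (th + th'); split; rewrite ?mulf_neq0 // ?rvE ?t2 ?t4 ?t'2 ?t'4 ?addr0 //.
move=> c hc; have -> : c + e = c + at_pos z p1 + (e - at_pos z p1).
  by rewrite -[RHS]addrA [at_pos z p1 + _]addrC subrK.
rewrite E' ?E //; last exact: G2D0.
by rewrite -mulXX !scaE; ring.
Qed.

(** Replacing a by a + e changes the bracket formula form12_g by the same
    factors throughout, except for the structure constants; the difference of
    the two instances retains only the product of g a and g b. *)
Lemma shift_mul e ch th a b : G0 e -> shift e ch th -> G2 a -> G2 b ->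
  a 0 p2 + b 0 p2 != 0 ->
  e 0 p1 *: g (a + b + s) = (kap * th 0 p1) *: (X s * g a * g b).
Proof.
move=> he [ch0 t2 t4 E] ha hb ab.
have hab := G2D0 (G2D ha hb ab) G0s.
have hae := G2D0 ha he.
have [_ b20 _] := hb.
have ae2 : (a + e) 0 p2 = a 0 p2 by rewrite rvE; case: he => _ -> _; rewrite addr0.
have := form12_g hae hb; rewrite ae2 => /(_ ab); rewrite (br_g hae hb) ae2.
have -> : a + e + b + s = a + b + s + e by rewrite -!addrA; congr (_ + _); rewrite addrC -!addrA.
rewrite !E // DZ DM DX.
have ppe : form12 (a + e) b = form12 a b + e 0 p1 * b 0 p2.
  by rewrite /form12 !rvE; case: he => _ -> _; ring.
rewrite ppe => h; have := form12_g ha hb ab; rewrite (br_g ha hb) => h'.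
apply: (scalerI b20); apply: (scalerI ch0); apply: (salg_mulI char0 (@X_neq0 F th)).
transitivity ((form12 a b + e 0 p1 * b 0 p2) *: (ch *: (X th * g (a + b + s)))
   - ch *: (X th * (form12 a b *: g (a + b + s)))); first by rewrite !scaE; ring.
by rewrite h h' !scaE; ring.
Qed.

Lemma g_mul : exists2 k, k != 0 & forall a b, G2 a -> G2 b ->
  a 0 p2 + b 0 p2 != 0 -> g (a + b + s) = k *: (X s * g a * g b).
Proof.
have [b b0 Gb] := axG p1.
have hb : G0 (at_pos b p1) by split; rewrite ?rvE /= ?mulr0.
have [ch [th st]] := shiftP hb.
have E a a' : G2 a -> G2 a' -> a 0 p2 + a' 0 p2 != 0 ->
    g (a + a' + s) = (b^-1 * (kap * th 0 p1)) *: (X s * g a * g a').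
  move=> ha ha' aa'; have := shift_mul hb st ha ha' aa'.
  rewrite !rvE /= mulr1 => h; apply: (scalerI b0); rewrite h scalerA.
  by rewrite mulVKf.
exists (b^-1 * (kap * th 0 p1)) => //.
have [a ha] := some_G2; have [_ a2 _] := ha.
have aa : a 0 p2 + a 0 p2 != 0 by rewrite -mulr2n -mulr_natr mulf_neq0 // natrF_eq0.
apply/eqP => k0; apply: (g_neq0 (G2D0 (G2D ha ha aa) G0s)).
by rewrite E // k0 scale0r.
Qed.

(** Expanding g a as the image of (2a + s) + (-a - 2s) + s, and then g (2a + s)
    as that of a + a + s, and cancelling g a leaves 1 as a multiple of g a: so g a
    is a unit, hence a monomial. *)
Lemma g_monomial : exists2 k, k != 0 &
  (forall e ch th, G0 e -> shift e ch th -> kap * th 0 p1 = k * e 0 p1) /\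
  (forall a, G2 a -> exists c c' a', [/\ c != 0, g a = c *: X a',
    g (- a - s - s) = c' *: X (- a' - s - s) & c * c' * (k * k) = 1]) /\
  (forall a b, G2 a -> G2 b -> a 0 p2 + b 0 p2 != 0 ->
    g (a + b + s) = k *: (X s * g a * g b)).
Proof.
have [k k0 E] := g_mul; exists k => //.
have dbl a : G2 a -> a 0 p2 + a 0 p2 != 0.
  by move=> [_ a2 _]; rewrite -mulr2n -mulr_natr mulf_neq0 // natrF_eq0.
split; [|split=> //].
  move=> e ch th he st; have [a ha] := some_G2.
  have := shift_mul he st ha ha (dbl _ ha); rewrite E ?dbl // scalerA => h.
  symmetry; rewrite mulrC; apply: (@eigen_uniq (X s * g a * g a)) => //.
  apply: (salg_mul_neq0 char0); last exact: g_neq0.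
  by apply: (salg_mul_neq0 char0); [apply: X_neq0|apply: g_neq0].
move=> a ha; have [_ a20 _] := ha.
have haa := G2D0 (G2D ha ha (dbl _ ha)) G0s.
have hN := G2NN ha.
have e1 : g (a + a + s + (- a - s - s) + s) = g a.
  by congr (f (X _)); apply/rowP => i; rewrite !rvE; ring.
have := E _ _ haa hN; rewrite e1 => h0.
have {h0}h : g a = k *: (X s * g (a + a + s) * g (- a - s - s)).
  by apply: h0; rewrite !rvE !(subr0, addr0) addrK.
rewrite E ?dbl // in h.
have U : g a * ((k * k) *: (X s * X s * g (- a - s - s))) = 1.
  apply: (salg_mulI char0 (g_neq0 ha)); rewrite mulr1 [RHS]h !scaE; ring.
have [c [a' [c0 ea]]] := unit_monomial char0 U.
have V : g (- a - s - s) = ((c * (k * k))^-1) *: X (- a' - s - s).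
  have ck0 : c * (k * k) != 0 by rewrite !mulf_neq0.
  apply: (scalerI ck0); rewrite scalerA mulfV // scale1r.
  have XX : X s * X s * X a' * X (- a' - s - s) = 1 :> A.
    by rewrite !mulXX -X0; congr X; apply/rowP => i; rewrite !rvE; ring.
  have X0' : X s * X s * X a' <> 0 :> A by move=> h0; move/eqP: XX; rewrite h0 mul0r eq_sym oner_eq0.
  apply: (salg_mulI char0 X0'); rewrite XX -U ea !scaE; ring.
exists c, (c * (k * k))^-1, a'; split=> //.
by rewrite mulrAC mulfV // !mulf_neq0.
Qed.

Lemma g_exponent a c a' : G2 a -> c != 0 -> g a = c *: X a' ->
  [/\ G' a', a' 0 p2 = kap * a 0 p2 & a' 0 p4 = 0].
Proof.
move=> ha c0 e; have [h2 h4] := g_weight ha.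
have cX0 : c *: X a' <> 0 by rewrite -e; apply: g_neq0.
split.
- have := lie_inA (niso_in nf (G2lie ha)); rewrite e => /(_ (a', exp0)).
  by rewrite coZ cox eqxx mulr1 => /(_ c0)[].
- by apply: (eigen_uniq cX0); rewrite -e -h2 e DZ DX !scalerA mulrC.
- by apply: (eigen_uniq cX0); rewrite scale0r -h4 e DZ DX !scalerA mulrC.
Qed.

(** Brackets of opposite weights have weight zero.  Where the source vanishes
    they constrain the exponents; elsewhere they compute images of torus
    monomials. *)
Lemma g_opposite a b a' b' c c' : G2 a -> G2 b -> a 0 p2 + b 0 p2 = 0 ->
  g a = c *: X a' -> g b = c' *: X b' ->
  br (g a) (g b) = (- kap * a 0 p2 * c * c' * (a' 0 p1 + b' 0 p1)) *: X (a' + b' + s).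
Proof.
move=> ha hb ab ea eb; rewrite br_g //.
have -> : b 0 p2 = - a 0 p2 by apply/eqP; rewrite -addr_eq0 addrC ab.
by rewrite ea eb !DZ !DX -!mulXX !scaE; ring.
Qed.

Lemma shiftD e e' ch ch' th th' : G0 e -> G0 e' -> shift e ch th -> shift e' ch' th' ->
  shift (e + e') (ch * ch') (th + th').
Proof.
move=> he he' [ch0 t2 t4 E] [ch'0 t'2 t'4 E'].
split; rewrite ?mulf_neq0 // ?rvE ?t2 ?t4 ?t'2 ?t'4 ?addr0 // => c hc.
by rewrite addrA E' ?E //; [rewrite -mulXX !scaE; ring|apply: G2D0].
Qed.

(** The constant k of g_monomial equals kap.  Indeed [X a, X b] = 0 for
    b = - a - 2s + e with e1 = 2, which forces th1 = 2 or th = s + s1.  For e = 2s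
    the first alternative gives k = kap, and so it does for e = 2s + z, z a point
    of the third axis.  If the second alternative held both times, z would shift
    all exponents of G2 by 0, against injectivity. *)
Lemma shift_normal e ch th : G0 e -> shift e ch th -> th 0 p1 = e 0 p1.
Proof.
have [k k0 [kE [mono _]]] := g_monomial.
suff kk : k = kap.
  move=> he st; have := kE _ _ _ he st; rewrite kk => /mulfI; apply.
  by rewrite invr_eq0.
have [chs [ths ss]] := shiftP G0s.
have [b b0 Gb] := axG p3.
have hz : G0 (at_pos b p3) by split; rewrite ?rvE /= ?mulr0.
have [chz [thz sz]] := shiftP hz.
have ss2 := shiftD G0s G0s ss ss.
have ssz := shiftD (G0D G0s G0s) hz ss2 sz.
have [a ha] := some_G2.
have [c [c' [a' [c0 ea eN cc]]]] := mono a ha.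
have hN := G2NN ha.
have c'0 : c' != 0.
  by apply/eqP => z; move/eqP: cc; rewrite z mulr0 mul0r eq_sym oner_eq0.
have key e1 ch1 th1 : G0 e1 -> e1 0 p1 = 2 -> shift e1 ch1 th1 ->
    th1 0 p1 = 2 \/ th1 = s + s1.
  move=> he e12 [ch10 _ _ E].
  have hb := G2D0 hN he.
  have ab2 : a 0 p2 + (- a - s - s + e1) 0 p2 = 0.
    by rewrite !rvE; case: he => _ -> _; ring.
  have eb : g (- a - s - s + e1) = (ch1 * c') *: X (- a' - s - s + th1).
    by rewrite E // eN -!mulXX !scaE; ring.
  have := g_opposite ha hb ab2 ea eb.
  have br0 : br (X a) (X (- a - s - s + e1)) = 0.
    rewrite brXX12 ?form34_G2 // (_ : form12 _ _ = 0) ?scale0r //.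
    by rewrite /form12 !rvE e12; case: he => _ -> _; ring.
  have -> : a' + (- a' - s - s + th1) + s = th1 - s.
    by apply/rowP => i; rewrite !rvE; ring.
  have -> : a' 0 p1 + (- a' - s - s + th1) 0 p1 = th1 0 p1 - 2 by rewrite !rvE; ring.
  move/(congr1 (@nrm F)); rewrite -(niso_br nf) ?br0 ?(niso0 cL nf); [|exact: G2lie|exact: G2lie].
  have [-> _|n12] := eqVneq (th1 0 p1) 2; first by left.
  have [-> _|ns1] := eqVneq th1 (s + s1); first by right.
  rewrite linearZ /= nrmX; last by move=> h; move/eqP: ns1; case; rewrite -h addrC subrK.
  move/esym/eqP; rewrite scaler_eq0 => /orP[|/eqP/X_neq0//].
  rewrite !mulf_eq0 oppr_eq0 invr_eq0 (negPf mu0) (negPf c0) (negPf ch10) (negPf c'0) subr_eq0 (negPf n12).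
  by have [_ a20 _] := ha; rewrite (negPf a20).
have kz : thz 0 p1 = 0.
  have := kE _ _ _ hz sz; rewrite !rvE /= !mulr0 => /eqP.
  by rewrite mulf_eq0 invr_eq0 (negPf mu0) => /eqP.
have ks : kap * ths 0 p1 = k by have := kE _ _ _ G0s ss; rewrite rvE mulr1.
have fin : ths 0 p1 + ths 0 p1 = 2 -> k = kap.
  rewrite -mulr2n => h; rewrite -ks.
  have -> : ths 0 p1 = 1; last by rewrite mulr1.
  by apply: (@mulIf F 2); [rewrite natrF_eq0|rewrite mulr_natr h mul1r].
have [|h1|h1] := key _ _ _ (G0D G0s G0s) _ ss2; first by rewrite !rvE.
  by apply: fin; move: h1; rewrite rvE.
have [|h2|h2] := key _ _ _ (G0D (G0D G0s G0s) hz) _ ssz.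
- by rewrite !rvE /= mulr0 addr0.
- by apply: fin; move: h2; rewrite !rvE kz addr0.
exfalso; have thz0 : thz = 0 by apply: (addrI (ths + ths)); rewrite h2 h1 addr0.
have [_ _ _ /(_ a ha)] := sz; rewrite thz0 X0 mul1r -(nisoZ cL nf); last exact: G2lie.
move/(niso_eq cL nf); move=> /(_ (G2lie (G2D0 ha hz)) (lieZ _ (G2lie ha))).
rewrite linearZ /= !nrmX; try exact: G2s1; last exact: (G2s1 (G2D0 ha hz)).
rewrite -[LHS]scale1r => /X_inj; rewrite oner_neq0 => /(_ isT)[h _].
have := congr1 (fun v : 'rV[F]_4 => v 0 p3) h; rewrite /= !rvE /= mulr1 => /eqP.
by rewrite -subr_eq0 addrAC subrr add0r (negPf b0).
Qed.

(** The product formula and the bracket formula for g (a + b + s) together show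
    that the determinants a1 b2 - b1 a2 and a'1 b2 - b'1 a2 agree: the map
    a -> a1 - a'1 is proportional to a2.  If the weights of a and b are
    opposite, one passes through 2a. *)
Lemma g_exponent1 : exists c0, forall a c a', G2 a -> c != 0 -> g a = c *: X a' ->
  a' 0 p1 = a 0 p1 - c0 * a 0 p2.
Proof.
have [k k0 [kE [_ E]]] := g_monomial.
have kk : k = kap.
  have [chs [ths ss]] := shiftP G0s.
  by have := kE _ _ _ G0s ss; rewrite (shift_normal G0s ss) rvE !mulr1.
rewrite {}kk {k0 kE} in E.
have key a b a' b' c c' : G2 a -> G2 b -> a 0 p2 + b 0 p2 != 0 ->
    c != 0 -> c' != 0 -> g a = c *: X a' -> g b = c' *: X b' ->
    a 0 p1 * b 0 p2 - b 0 p1 * a 0 p2 = a' 0 p1 * b 0 p2 - b' 0 p1 * a 0 p2.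
  move=> ha hb ab c0 c'0 ea eb; have := form12_g ha hb ab; rewrite E // br_g // ea eb.
  rewrite !DZ !DX => h.
  have h' : (kap * c * c' * form12 a b) *: X (s + a' + b')
     = (kap * c * c' * (a' 0 p1 * b 0 p2 - b' 0 p1 * a 0 p2)) *: X (s + a' + b').
    transitivity (form12 a b *: (kap *: (X s * (c *: X a') * (c' *: X b')))).
      by rewrite -!mulXX !scaE; ring.
    by rewrite h -!mulXX !scaE; ring.
  have := eigen_uniq (@X_neq0 F _) h'; apply: mulfI.
  by rewrite !mulf_neq0 // invr_eq0.
have [kx _ [_ [mono _]]] := g_monomial.
have [a ha] := some_G2; have [_ a2 _] := ha.
have [c [_ [a' [cn0 ea _ _]]]] := mono a ha.
pose c0 := (a 0 p1 - a' 0 p1) / a 0 p2; exists c0.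
have via b b' d b'' b3 d3 : G2 b'' -> d3 != 0 -> g b'' = d3 *: X b3 ->
    b3 0 p1 = b'' 0 p1 - c0 * b'' 0 p2 -> G2 b -> d != 0 -> g b = d *: X b' ->
    b'' 0 p2 + b 0 p2 != 0 -> b' 0 p1 = b 0 p1 - c0 * b 0 p2.
  move=> hb'' d30 eb'' e3 hb d0 eb bb; have := key _ _ _ _ _ _ hb'' hb bb d30 d0 eb'' eb.
  have [_ b2 _] := hb''; rewrite e3 => h; apply: (mulIf b2).
  apply/eqP; rewrite -subr_eq0; apply/eqP.
  transitivity ((b'' 0 p1 * b 0 p2 - b 0 p1 * b'' 0 p2)
    - ((b'' 0 p1 - c0 * b'' 0 p2) * b 0 p2 - b' 0 p1 * b'' 0 p2)); first by ring.
  by rewrite h subrr.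
have ea1 : a' 0 p1 = a 0 p1 - c0 * a 0 p2 by rewrite /c0 divfK // subKr.
move=> b d b' hb d0 eb.
have [ab|ab] := eqVneq (a 0 p2 + b 0 p2) 0; last exact: via ha cn0 ea ea1 hb d0 eb ab.
have aa : a 0 p2 + a 0 p2 != 0 by rewrite -mulr2n -mulr_natr mulf_neq0 // natrF_eq0.
have haa := G2D ha ha aa.
have [c3 [_ [a3 [c30 ea3 _ _]]]] := mono _ haa.
have e3 : a3 0 p1 = (a + a) 0 p1 - c0 * (a + a) 0 p2.
  apply: via ha cn0 ea ea1 haa c30 ea3 _; rewrite !rvE -!mulr2n -mulrS -mulr_natr.
  by rewrite mulf_neq0 // natrF_eq0.
apply: via haa c30 ea3 e3 hb d0 eb _.
by rewrite rvE -addrA ab addr0.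
Qed.

(** X xi is a multiple of the bracket of X a with an exponent of opposite
    weight, whose image is known through the shift by xi + s. *)
Lemma g_torus e ch th xi : G0 e -> shift e ch th -> e = xi + s -> xi 0 p1 != 1 ->
  xi <> s1 -> f (X xi) = (mu * ch) *: X (th - s).
Proof.
move=> he st exi xi1 xis1.
have hxi : G0 xi by have := G0D he (G0N G0s); rewrite exi addrK.
have lxi : lie m G (X xi).
  by case: hxi => Gxi x2 x4; apply: (lieX0 m gG axG) => //; rewrite xi1.
have th1 := shift_normal he st; have [ch0 _ _ E] := st.
have [k k0 [kE [mono _]]] := g_monomial.
have kk : k = kap.
  have [chs [ths ss]] := shiftP G0s.
  by have := kE _ _ _ G0s ss; rewrite (shift_normal G0s ss) rvE !mulr1.
have [a ha] := some_G2; have [_ a2 _] := ha.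
have [c [c' [a' [c0 ea eN cc]]]] := mono a ha.
have hN := G2NN ha.
have hb := G2D0 hN he.
have ab2 : a 0 p2 + (- a - s - s + e) 0 p2 = 0.
  by rewrite !rvE; case: he => _ -> _; ring.
have eb : g (- a - s - s + e) = (ch * c') *: X (- a' - s - s + th).
  by rewrite E // eN -!mulXX !scaE; ring.
have := g_opposite ha hb ab2 ea eb.
have -> : a' + (- a' - s - s + th) + s = th - s.
  by apply/rowP => i; rewrite !rvE; ring.
have -> : a' 0 p1 + (- a' - s - s + th) 0 p1 = xi 0 p1 - 1.
  by rewrite !rvE th1 exi !rvE; ring.
have brE : br (X a) (X (- a - s - s + e)) = ((1 - xi 0 p1) * a 0 p2) *: X xi.
  rewrite brXX12 ?form34_G2 // (_ : a + _ + s = xi); last first.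
    by rewrite exi; apply/rowP => i; rewrite !rvE; ring.
  by congr (_ *: _); rewrite /form12 exi !rvE; case: hxi => _ -> _; ring.
move/(congr1 (@nrm F)); rewrite -(niso_br nf) ?brE; [|exact: G2lie|exact: G2lie].
rewrite (nisoZ cL nf) // linearZ /= => h.
have K0 : (1 - xi 0 p1) * a 0 p2 != 0 by rewrite mulf_neq0 // subr_eq0 eq_sym.
have {}h : f (X xi) = (mu * ch) *: nrm (X (th - s)).
  apply: (scalerI K0); rewrite h !scalerA; congr (_ *: _).
  have ccm : c * c' * kap = mu.
    rewrite kk in cc; apply: (mulIf (x := kap)); first by rewrite invr_eq0.
    by rewrite /= -[LHS]mulrA cc mulfV.
  transitivity ((1 - xi 0 p1) * a 0 p2 * (c * c' * kap * ch)); first by ring.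
  by rewrite ccm.
rewrite h nrmX // => z; apply: (fX_neq0 nf lxi xis1).
by rewrite h z nrmX1 scaler0.
Qed.

End Diagonal.

(** * Jordan blocks of the derivations *)

Section PolyVariables.
Variable F : fieldType.
Hypothesis char0 : [pchar F] =i pred0.
Local Notation A := (salg F).
Implicit Types (u v w : A) (a b : 'rV[F]_4).
Local Notation s := (sigma F).
Local Notation s1 := (sigma1 F).

Lemma Jset_inc (m : Mvec) p : m p -> Jset m (exp_inc p exp0).
Proof.
move=> mp q; rewrite !ffunE add0n; case: eqP => [->|_]; first by rewrite mp.
by case: (m q).
Qed.

Lemma D_tvar p q a : D q (x (a, exp_inc p exp0) : A)
  = a 0 q *: x (a, exp_inc p exp0) + ((q == p)%:R : F) *: X a.
Proof.
rewrite Dx /= !ffunE add0n eq_sym; congr (_ + _).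
case: (eqVneq p q) => [->|_]; last by rewrite !scale0r.
congr (_ *: x (_, _)); apply/ffunP => r; rewrite !ffunE add0n subnn //.
Qed.

(** Without the polynomial variable p, the derivation p is diagonalizable. *)
Lemma no_jordan m (G : set 'rV[F]_4) p h a (r c : F) : inA m G h -> m p = false ->
  c != 0 -> D p h = a 0 p *: h + r *: (c *: X a) -> r = 0.
Proof.
move=> Ah mp c0 /(congr1 (co (a, exp0))); rewrite co_D coD !coZ cox eqxx /= !ffunE mulr1.
have -> : co (a, exp_inc p exp0) h = 0.
  apply/eqP/negPn/negP => /Ah[_ /(_ p)]; rewrite /= mp !ffunE eqxx; by [].
rewrite mulr0 => /addrI/esym/eqP; by rewrite mulf_eq0 (negPf c0) orbF => /eqP.
Qed.

Lemma nrmB u v : nrm (u - v) = nrm u - nrm v.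
Proof. exact: linearB. Qed.

Lemma nrmZ (c : F) u : nrm (c *: u) = c *: nrm u.
Proof. exact: linearZ. Qed.

End PolyVariables.

(** * Comparison of the two blocks *)

(** Conjugation by the block swap: statements about the second half of f are
    statements about the first half of swf f. *)
Definition swf (F : fieldType) (f : salg F -> salg F) : salg F -> salg F :=
  fun u => nrm (sw (f (nrm (sw u)))).

Definition G4 (F : fieldType) (G : set 'rV[F]_4) (a : 'rV[F]_4) :=
  [/\ G a, a 0 p4 != 0 & a 0 p2 = 0].

Section SwapConjugate.
Variable F : fieldType.
Local Notation A := (salg F).
Implicit Types (u v w : A) (a b : 'rV[F]_4).
Local Notation s := (sigma F).
Local Notation s1 := (sigma1 F).

Lemma nrm_sw u : nrm (sw (nrm u)) = nrm (sw u).
Proof.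
by rewrite {2}/nrm [sw _]linearB linearZ /= swX1 linearB linearZ /= nrmX1 scaler0 subr0.
Qed.

Lemma sw1 : sw (1 : A) = X (- s).
Proof. by rewrite -X0 swX swv0 oppr0 add0r. Qed.

Lemma swXs : sw (X (- s)) = 1 :> A.
Proof. by rewrite -sw1 swK. Qed.

Definition swdual a := - swv a - s.

Lemma swdualK : involutive swdual.
Proof.
by move=> a; rewrite /swdual swvD !swvN swvK swv_s opprD !opprK addrK.
Qed.

Lemma swdual_s1 : swdual s1 = s1. Proof. exact: swv_s1. Qed.

Lemma swdual_neq a : a <> s1 -> swdual a <> s1.
Proof. by move=> na e; apply: na; rewrite -[a]swdualK e swdual_s1. Qed.

Lemma swX' a : sw (X a) = X (swdual a). Proof. exact: swX. Qed.

Lemma G4swdual (G : set 'rV[F]_4) b : subgrp G -> G4 G b -> G2 (swG G) (swdual b).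
Proof.
move=> gG [Gb b4 b2]; split; rewrite /swdual ?rvE ?swvE /=.
- rewrite /swG swvD !swvN swvK swv_s; apply: (subgrpB gG) => //; last exact: subgrp_s.
  exact: (subgrpN gG).
- by rewrite subr0 oppr_eq0.
- by rewrite b2 oppr0 addr0.
Qed.

Lemma G0swv (G : set 'rV[F]_4) e : subgrp G -> G0 G e -> G0 (swG G) (- swv e).
Proof.
move=> gG [Ge e2 e4]; split; rewrite ?rvE ?swvE /= ?e2 ?e4 ?oppr0 //.
by rewrite /swG swvN swvK; apply: (subgrpN gG).
Qed.

Section Iso.
Variables (m m' : Mvec) (G G' : set 'rV[F]_4) (f : A -> A).
Hypotheses (gG : subgrp G) (gG' : subgrp G').
Hypothesis nf : niso (lie m G) (lie m' G') f.

Lemma swf_niso : niso (lie (swe m) (swG G)) (lie (swe m') (swG G')) (swf f).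
Proof.
have gS := swG_subgrp gG; have gS' := swG_subgrp gG'.
have h1 := sw_niso (swe m) gS; rewrite sweK swGK in h1.
have h2 := niso_comp (lie_closed m gG) (lie_closed m' gG') h1 nf.
exact: (niso_comp (lie_closed m' gG') (lie_closed (swe m') gS') h2 (sw_niso m' gG')).
Qed.

Lemma swfE u : lie m G u -> f u = nrm (sw (swf f (sw u))).
Proof.
move=> lu; rewrite /swf swK nrm_sw swK (niso_nrmr (lie_closed m gG) nf) //.
by rewrite (niso_nrm nf).
Qed.

End Iso.

Lemma swf1 f mu : f (X (- s)) = mu *: X (- s) :> A -> swf f 1 = mu *: 1.
Proof. by move=> h; rewrite /swf sw1 nrmXs h linearZ /= swXs linearZ /= nrm1. Qed.

Lemma swfs f lam : f 1 = lam *: 1 :> A -> swf f (X (- s)) = lam *: X (- s).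
Proof. by move=> h; rewrite /swf swXs nrm1 h linearZ /= sw1 linearZ /= nrmXs. Qed.

End SwapConjugate.

Section Comparison.
Variable F : fieldType.
Hypothesis char0 : [pchar F] =i pred0.
Local Notation A := (salg F).
Implicit Types (u v w : A) (a b : 'rV[F]_4).
Local Notation s := (sigma F).
Local Notation s1 := (sigma1 F).
Variables (m m' : Mvec) (G G' : set 'rV[F]_4) (f : A -> A).
Hypotheses (gG : subgrp G) (gG' : subgrp G').
Hypothesis axG : forall p, exists2 a : F, a != 0 & G (at_pos a p).
Hypothesis nf : niso (lie m G) (lie m' G') f.
Variables lam mu : F.
Hypothesis f1 : f 1 = lam *: 1.
Hypothesis fXs : f (X (- s)) = mu *: X (- s).
Let cL := lie_closed m gG.
Local Notation kap := (mu^-1).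
Local Notation kap' := (lam^-1).
Local Notation G0 := (G0 G).
Local Notation G2 := (G2 G).
Local Notation G4 := (G4 G).
Local Notation g a := (f (X a)).
Let gS := swG_subgrp gG.
Let axS := swG_axis axG.
Let nS := swf_niso gG gG' nf.
Let fS1 := swf1 fXs.
Let fSs := swfs f1.

Lemma G4lie b : G4 b -> lie m G (X b).
Proof. by case=> Gb b4 _; apply: (lieX4 m gG). Qed.
Lemma G4s1 b : G4 b -> b <> s1.
Proof. by case=> _ b4 _ e; move: b4; rewrite e rvE eqxx. Qed.

Lemma g_swdual b c a' : G4 b -> c != 0 -> swf f (X (swdual b)) = c *: X a' ->
  [/\ a' 0 p4 = 0, a' 0 p2 = - (kap' * b 0 p4) & g b = c *: X (swdual a')].
Proof.
move=> hb c0 e; have hd := G4swdual gG hb.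
have [_ a2 a4] := g_exponent char0 gS axS nS fS1 fSs hd c0 e.
have {}a2 : a' 0 p2 = - (kap' * b 0 p4).
  by rewrite a2 /swdual !rvE swvE /= subr0 mulrN.
split=> //.
rewrite (swfE gG nf (G4lie hb)) swX' e linearZ /= swX' linearZ /= nrmX //.
apply: swdual_neq => h; move: a2; rewrite h !rvE => /eqP; rewrite eq_sym oppr_eq0.
have [lam0 _] := lam_mu_neq0 char0 gG axG nf f1 fXs.
by case: hb => _ b4 _; rewrite mulf_eq0 invr_eq0 (negPf lam0) (negPf b4).
Qed.

Lemma g_monomial4 b : G4 b -> exists c a', [/\ c != 0, g b = c *: X a' & a' 0 p4 = kap' * b 0 p4].
Proof.
move=> hb; have [k _ [_ [mono _]]] := g_monomial char0 gS axS nS fS1 fSs.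
have [c [_ [a' [c0 e _ _]]]] := mono _ (G4swdual gG hb).
have [a4 a2 eb] := g_swdual hb c0 e.
exists c, (swdual a'); split=> //.
by rewrite /swdual !rvE swvE /= a2 opprK subr0.
Qed.

(** This is shiftP, shift_normal and g_torus for swf f; shift12 states the same
    for f. *)
Lemma shift34 e : G0 e -> exists (ch : F) (th : 'rV[F]_4),
  [/\ ch != 0, th 0 p3 = e 0 p3, th 0 p2 = 0 & th 0 p4 = 0] /\
  (forall b, G4 b -> g (b + e) = ch *: (X th * g b)) /\
  (e 0 p3 != -2 -> e <> s1 -> g e = (lam * ch) *: X th).
Proof.
move=> he; have heS := G0swv gG he.
have [ch [th st]] := shiftP char0 gS axS nS fS1 fSs heS.
have t1 := shift_normal char0 gS axS nS fS1 fSs heS st.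
have [ch0 t2 t4 E] := st.
exists ch, (- swv th); split; [|split].
- by split; rewrite ?rvE ?swvE //= ?t2 ?t4 ?oppr0 // t1 rvE swvE /= opprK.
- move=> b hb; have hd := G4swdual gG hb.
  have [k _ [_ [mono _]]] := g_monomial char0 gS axS nS fS1 fSs.
  have [c [_ [a' [c0 eb _ _]]]] := mono _ hd.
  have [_ _ ->] := g_swdual hb c0 eb.
  have hbe : G4 (b + e).
    case: hb he => Gb b4 b2 [Ge e2 e4]; split; rewrite ?rvE ?e4 ?b2 ?e2 ?addr0 //.
    exact: (subgrpD gG).
  have de : swdual (b + e) = swdual b - swv e by rewrite /swdual swvD opprD addrAC.
  have ebe : swf f (X (swdual (b + e))) = (ch * c) *: X (a' + th).
    by rewrite de E // eb -mulXX !scaE; ring.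
  have [|_ _ ->] := g_swdual hbe _ ebe; first by rewrite mulf_neq0.
  by rewrite -scalerAr mulXX scalerA /swdual swvD; congr (_ *: X _);
    apply/rowP => i; rewrite !rvE; ring.
- move=> e3 es1; have es : - swv e = swdual e + s by rewrite /swdual subrK.
  have := g_torus char0 gS axS nS fS1 fSs heS st es.
  move=> /(_ _ (swdual_neq es1)) h.
  have le : lie m G (X e).
    by case: he => Ge e2 e4; apply: (lieX0 m gG axG) => //; rewrite e3 orbT.
  have {}h : swf f (X (swdual e)) = (lam * ch) *: X (th - s).
    apply: h; rewrite /swdual !rvE swvE /=; apply: contra e3 => /eqP h'.
    by apply/eqP; rewrite -[LHS]opprK -[- e 0 p3](subrK 1) h' -natr1 mulr1n.
  have e0 := fX_neq0 nf le es1.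
  move: e0; rewrite (swfE gG nf le) swX' h linearZ /= swX' linearZ /=.
  have -> : swdual (th - s) = - swv th.
    by rewrite /swdual swvD swvN swv_s opprB addrAC subrr sub0r.
  have [->|ns _] := pselect (- swv th = s1); first by rewrite nrmX1 scaler0.
  by rewrite nrmX.
Qed.

Lemma shift12 e : G0 e -> exists (ch : F) (th : 'rV[F]_4),
  [/\ ch != 0, th 0 p1 = e 0 p1, th 0 p2 = 0 & th 0 p4 = 0] /\
  (forall a, G2 a -> g (a + e) = ch *: (X th * g a)) /\
  (e 0 p1 != 2 -> e <> s + s1 -> g (e - s) = (mu * ch) *: X (th - s)).
Proof.
move=> he; have [ch [th st]] := shiftP char0 gG axG nf f1 fXs he.
have t1 := shift_normal char0 gG axG nf f1 fXs he st.
have [ch0 t2 t4 E] := st.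
exists ch, th; split; [by []|split=> // e2 es].
apply: (g_torus char0 gG axG nf f1 fXs he st); first by rewrite subrK.
  by rewrite !rvE subr_eq; apply: contra e2 => /eqP ->.
by move=> h; apply: es; rewrite -h addrC subrK.
Qed.

Definition generic (e : 'rV[F]_4) := [/\ e 0 p1 != 1, e 0 p3 != -2 & e <> s1].

Lemma shift12_uniq a (ch ch' : F) (th th' : 'rV[F]_4) : G2 a -> ch != 0 ->
  ch *: (X th * g a) = ch' *: (X th' * g a) -> th = th' /\ ch = ch'.
Proof.
move=> ha ch0; rewrite !scalerAl => h; apply: X_inj ch0.
apply: (salg_mulI char0 (g_neq0 gG nf ha)); by rewrite ![g a * _]mulrC.
Qed.

(** Both halves attach an exponent to e, normalized on the first coordinate by
    one half and on the third by the other.  They agree, because both compute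
    f (X e) and f 1. *)
Lemma shift_generic e : G0 e -> generic e -> exists2 ch, ch != 0 &
  [/\ forall a, G2 a -> g (a + e) = ch *: (X e * g a),
      forall b, G4 b -> g (b + e) = ch *: (X e * g b)
    & g e = (lam * ch) *: X e].
Proof.
move=> he [e1 e3 es1].
have [lam0 mu0] := lam_mu_neq0 char0 gG axG nf f1 fXs.
have h0 : G0 0 by split; rewrite ?rvE //; apply: subgrp0.
have [a ha] := some_G2 axG.
have hs := G0s gG.
have [chs [ths [[chs0 ts1 ts2 ts4] [Es Ts]]]] := shift12 hs.
have [ch0 [th0 [[ch00 t03 t02 t04] [E0 T0]]]] := shift34 h0.
have [ch1 [th1 [[ch10 t11 t12 t14] [E1 T1]]]] := shift12 he.
have [che [the [[che0 te1 te2 te4] [Ee Te]]]] := shift12 (G0D gG he hs).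
have [ch3 [th3 [[ch30 t33 t32 t34] [E3 T3]]]] := shift34 he.
have [ths_s chs_e] : ths = s /\ chs = lam / mu.
  have g0 : g 0 = lam *: X 0 by rewrite X0 f1.
  have : (mu * chs) *: X (ths - s) = lam *: X 0.
    rewrite -g0 -Ts ?subrr //; first by rewrite rvE -subr_eq0 opprD addrA subrr sub0r oppr_eq0 oner_eq0.
    by rewrite -[X in X <> _]addr0 => /addrI /zero_neq_s1.
  move/X_inj; rewrite mulf_neq0 // => /(_ isT)[/eqP h1 h2]; split.
    by move: h1; rewrite subr_eq0 => /eqP.
  by rewrite -h2 mulrC mulKf.
have [the_e che_e] : the = th1 + s /\ che = ch1 * chs.
  apply: (shift12_uniq ha che0); rewrite -Ee // addrA Es ?E1 ?ths_s //.
    by rewrite -mulXX !scaE; ring.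
  exact: (G2D0 gG).
have h1 : (e + s) 0 p1 != 2.
  by rewrite !rvE -subr_eq0 opprD addrACA subrr addr0 subr_eq0.
have h2 : e + s <> s + s1 by rewrite [e + s]addrC => /addrI.
have h3 := Te h1 h2; rewrite addrK in h3.
have [] := X_inj (etrans (esym h3) (T3 e3 es1)); first by rewrite mulf_neq0.
rewrite the_e addrK => th13 ech.
have ch13 : ch1 = ch3.
  by apply: (mulfI lam0); rewrite -ech che_e chs_e mulrCA [mu * _]mulrC divfK // mulrC.
have e_th : th1 = e.
  apply: rV4P; rewrite ?t11 ?t12 ?t14 //; try by case: he.
  by rewrite th13 t33.
exists ch1 => //; split.
- by move=> a' ha'; rewrite E1 // e_th.
- by move=> b hb; rewrite E3 // -th13 e_th ch13.
- by rewrite T3 // -th13 e_th ch13.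
Qed.

Lemma shift_axis1 z ch : G0 (at_pos z p1) -> z != 1 -> z != 2 -> ch != 0 ->
  (forall a, G2 a -> g (a + at_pos z p1) = ch *: (X (at_pos z p1) * g a)) ->
  g (at_pos z p1 - s) = (mu * ch) *: X (at_pos z p1 - s).
Proof.
move=> hz z1 z2 ch0 E.
have [ch' [th' [_ [E' T']]]] := shift12 hz.
have [a ha] := some_G2 axG.
have h : ch *: (X (at_pos z p1) * g a) = ch' *: (X th' * g a) by rewrite -E // -E'.
have [e1 e2] := shift12_uniq ha ch0 h; rewrite -e1 -e2 in T'.
apply: T'; first by rewrite rvE /= mulr1.
move/rowP/(_ p1)/eqP; by rewrite !rvE /= mulr1 addr0 (negPf z1).
Qed.

(** * Mixed weights *)

Let lam0 : lam != 0. Proof. by case: (lam_mu_neq0 char0 gG axG nf f1 fXs). Qed.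
Let mu0 : mu != 0. Proof. by case: (lam_mu_neq0 char0 gG axG nf f1 fXs). Qed.

Definition off24 a := G a /\ (a 0 p2 != 0) || (a 0 p4 != 0).

Lemma off_lie a : off24 a -> lie m G (X a).
Proof. by case=> Ga /orP[h|h]; [apply: (lieX2 m gG)|apply: (lieX4 m gG)]. Qed.

Lemma off_weight a : off24 a -> weight (kap * a 0 p2) (kap' * a 0 p4) (g a).
Proof.
move=> ha; have [_ h] := ha; apply: (diag_weight char0 gG axG nf f1 fXs (off_lie ha)) h.
by split; rewrite DX.
Qed.

Lemma off_neq0 a : off24 a -> g a <> 0.
Proof.
move=> ha; apply: (fX_neq0 nf (off_lie ha)) => e; case: ha => _.
by rewrite e !rvE eqxx.
Qed.

Lemma off_nrm a w : off24 a -> weight (kap * a 0 p2) (kap' * a 0 p4) w -> nrm w = w.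
Proof.
move=> [_ /orP[h|h]] [w2 w4].
  by apply: (nrm_weight char0 _ _ w2); [left|rewrite mulf_neq0 ?invr_eq0].
by apply: (nrm_weight char0 _ _ w4); [right|rewrite mulf_neq0 ?invr_eq0].
Qed.

Lemma offD0 a e : off24 a -> G0 e -> off24 (a + e).
Proof.
move=> [Ga h] [Ge e2 e4]; split; first exact: (subgrpD gG).
by rewrite !rvE e2 e4 !addr0.
Qed.

Lemma weight_mulX (th : 'rV[F]_4) u (b d : F) : th 0 p2 = 0 -> th 0 p4 = 0 -> weight b d u ->
  weight b d (X th * u).
Proof.
by move=> t2 t4 [u2 u4]; split; rewrite DM DX ?t2 ?t4 ?u2 ?u4 !scaE; ring.
Qed.


Definition nice p (z : F) := [/\ p = p1 \/ p = p3, z \notin [:: 0; 1; 2; -1; -2] & G (at_pos z p)].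

Lemma nice_exists p : p = p1 \/ p = p3 -> exists z, nice p z.
Proof.
move=> hp; have [a a0 Ga] := axG p; have [n hn] := multiple_notin char0 [:: 0; 1; 2; -1; -2] a0.
exists (n%:R * a); split=> //.
by rewrite /at_pos -scalerA scaler_nat; apply: (subgrpMn gG).
Qed.

Lemma nice_G0 p z : nice p z -> G0 (at_pos z p).
Proof. by case=> hp _ Gz; split=> //; case: hp => ->; rewrite rvE mulr0. Qed.

Lemma at_posN (z : F) p : at_pos (- z) p = - at_pos z p.
Proof. by rewrite /at_pos scaleNr. Qed.

Lemma niceN p z : nice p z -> nice p (- z).
Proof.
case=> hp; rewrite !inE !negb_or => /and5P[z0 z1 z2 z3 z4] Gz; split=> //.
  by rewrite !inE !negb_or oppr_eq0 !eqr_oppLR !opprK z0 z1 z2 z3 z4.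
by rewrite at_posN; apply: (subgrpN gG).
Qed.

Lemma nice_generic p z : nice p z -> generic (at_pos z p).
Proof.
case=> hp; rewrite !inE !negb_or => /and5P[z0 z1 z2 z3 z4] Gz.
have n2 : (0 : F) != -2 by rewrite eq_sym oppr_eq0 natrF_eq0.
case: hp => ->; split; rewrite ?rvE /= ?mulr1 ?mulr0 //.
- exact: at_neq_s1.
- by rewrite eq_sym oner_eq0.
- move/rowP/(_ p3)/eqP; by rewrite !rvE /= mulr1 (negPf z3).
Qed.

(** For mixed weights, the shift by z on an axis is obtained from the bracket
    with a torus monomial, X (z - s) or X z, whose image is known. *)
Lemma shift_nice p z : nice p z -> exists2 ch, ch != 0 &
  forall a, off24 a -> g (a + at_pos z p) = ch *: (X (at_pos z p) * g a).
Proof.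
move=> hz; have h0 := nice_G0 hz.
have [ch ch0 [E2 E4 Ee]] := shift_generic h0 (nice_generic hz).
exists ch => // a ha; have [Ga a24] := ha.
have [a2|a2] := eqVneq (a 0 p2) 0; first by apply: E4; split; rewrite // a2 eqxx in a24.
have [a4|a4] := eqVneq (a 0 p4) 0; first exact: E2.
have hae := offD0 ha h0; have [h2 h4] := off_weight ha.
have nz : nrm (X (at_pos z p) * g a) = X (at_pos z p) * g a.
  apply: (off_nrm ha); apply: weight_mulX; rewrite ?(off_weight ha) //; by case: h0.
case: hz => hp; rewrite !inE !negb_or => /and5P[z0 z1 z2 z3 z4] Gz.
case: hp => ep; rewrite {p}ep in h0 Ee hae nz E2 E4 Gz *.
- have Es := shift_axis1 h0 z1 z2 ch0 E2.
  have le : lie m G (X (at_pos z p1 - s)).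
    apply: (lieX0 m gG axG); rewrite ?rvE /= ?mulr0 ?mulr1 ?subr0 ?oppr0 ?addr0 //.
      by apply: (subgrpB gG) => //; apply: subgrp_s.
    by rewrite subr_eq -mulr2n z2.
  have := niso_br nf le (off_lie ha); rewrite Es brZl.
  have -> : br (X (at_pos z p1 - s)) (X a) = ((z - 1) * a 0 p2) *: X (a + at_pos z p1).
    rewrite brXX12; last by rewrite /form34 !rvE /=; ring.
    rewrite (_ : at_pos z p1 - s + a + s = a + at_pos z p1); last first.
      by apply/rowP => i; rewrite !rvE; ring.
    by congr (_ *: _); rewrite /form12 !rvE /=; ring.
  have -> : br (X (at_pos z p1 - s)) (g a)
      = ((z - 1) * (kap * a 0 p2)) *: (X (at_pos z p1) * g a).
    rewrite /br !DX !rvE /= h2 -[X (at_pos z p1) in RHS]/(X (at_pos z p1)).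
    have -> : X (at_pos z p1) = X s * X (at_pos z p1 - s) :> A by rewrite mulXX addrC subrK.
    by rewrite !scaE; ring.
  rewrite (nisoZ cL nf _ (off_lie hae)) scalerA => h.
  apply: (scalerI (a := (z - 1) * a 0 p2)); first by rewrite mulf_neq0 // subr_eq0.
  rewrite h (_ : mu * ch * _ = (z - 1) * a 0 p2 * ch); last by field.
  by rewrite nrmZ nz scalerA.
have le : lie m G (X (at_pos z p3)).
  by apply: (lieX0 m gG axG); rewrite ?rvE /= ?mulr0 ?mulr1 // eq_sym oner_eq0.
have := niso_br nf le (off_lie ha); rewrite Ee brZl.
have -> : br (X (at_pos z p3)) (X a) = ((z + 1) * a 0 p4) *: X (a + at_pos z p3).
  rewrite brXX34; last by rewrite /form12 !rvE /=; ring.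
  by rewrite [at_pos z p3 + a]addrC; congr (_ *: _); rewrite /form34 !rvE /=; ring.
have -> : br (X (at_pos z p3)) (g a)
    = ((z + 1) * (kap' * a 0 p4)) *: (X (at_pos z p3) * g a).
  by rewrite /br !DX !rvE /= h4 !scaE; ring.
rewrite (nisoZ cL nf _ (off_lie hae)) scalerA => h.
apply: (scalerI (a := (z + 1) * a 0 p4)); first by rewrite mulf_neq0 // addr_eq0.
rewrite h (_ : lam * ch * _ = (z + 1) * a 0 p4 * ch); last by field.
by rewrite nrmZ nz scalerA.
Qed.

(** The exponents in the bracket of X (b + e) and X (c - e) do not depend on e,
    only its coefficients do. *)
Lemma mixing_eq b c e ch ch' cb b' : G2 b -> off24 c -> off24 (b + c) -> G0 e ->
  c 0 p4 != 0 ->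
  g (b + e) = ch *: (X e * g b) -> g (c - e) = ch' *: (X (- e) * g c) -> ch * ch' = 1 ->
  g b = cb *: X b' -> cb != 0 ->
  ((b 0 p1 + e 0 p1) * c 0 p2 - (c 0 p1 - e 0 p1) * b 0 p2) *: g (b + c + s)
    + ((b 0 p3 + e 0 p3 + 1) * c 0 p4) *: g (b + c) =
  cb *: (X b' * (X s * (((b' 0 p1 + e 0 p1) * (kap * c 0 p2)) *: g c
     - (kap * b 0 p2) *: (D p1 (g c) - e 0 p1 *: g c))
     + ((b' 0 p3 + e 0 p3 + 1) * (kap' * c 0 p4)) *: g c)).
Proof.
move=> hb hc hbc he c4 Eb Ec chch eb cb0; have [_ e2 e4] := he; have [Gb b2 b4] := hb.
have [Gb' b'2 b'4] := g_exponent char0 gG axG nf f1 fXs hb cb0 eb.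
have hbe : off24 (b + e) by apply: offD0 he; split=> //; rewrite b2.
have hce : off24 (c - e) by apply: offD0 hc (G0N gG he).
have hbcs := offD0 hbc (G0s gG).
have [h2 h4] := off_weight hc.
have := niso_br nf (off_lie hbe) (off_lie hce).
rewrite brXX (_ : b + e + (c - e) = b + c); last by apply/rowP => i; rewrite !rvE; ring.
rewrite (niso_lin nf) ?(nisoZ cL nf) //; try exact: off_lie; last by apply: lieZ; apply: off_lie.
have -> : form12 (b + e) (c - e)
    = (b 0 p1 + e 0 p1) * c 0 p2 - (c 0 p1 - e 0 p1) * b 0 p2.
  by rewrite /form12 !rvE e2; ring.
have -> : form34 (b + e) (c - e) = (b 0 p3 + e 0 p3 + 1) * c 0 p4.
  by rewrite /form34 !rvE e4 b4; ring.
move=> ->; rewrite Eb Ec eb -scalerAr brZl brZl brZr !scalerA.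
have -> : ch * cb * ch' = cb by rewrite mulrAC chch mul1r.
rewrite linearZ /=; congr (_ *: _).
have -> : br (X e * X b') (X (- e) * g c) = X b' * (X s *
    (((b' 0 p1 + e 0 p1) * (kap * c 0 p2)) *: g c - (kap * b 0 p2) *: (D p1 (g c) - e 0 p1 *: g c))
     + ((b' 0 p3 + e 0 p3 + 1) * (kap' * c 0 p4)) *: g c).
  rewrite mulXX /br !DM !DX !rvE h2 h4 e2 e4 b'2 b'4.
  have -> : X (e + b') = X e * X b' :> A by rewrite mulXX.
  transitivity (X e * X (- e) * (X b' * (X s *
    (((b' 0 p1 + e 0 p1) * (kap * c 0 p2)) *: g c - (kap * b 0 p2) *: (D p1 (g c) - e 0 p1 *: g c))
     + ((b' 0 p3 + e 0 p3 + 1) * (kap' * c 0 p4)) *: g c))); last by rewrite mulXN mul1r.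
  by rewrite !scaE; ring.
set w := X s * _ + _.
have w4 : D p4 w = (kap' * c 0 p4) *: w.
  rewrite /w DD DM DX rvE DZ DB !DZ DB DZ [D p4 (D p1 _)]Dcomm h4 !DZ !scaE; ring.
apply: (nrm_weight char0 (p := p4) (b := kap' * c 0 p4)); first by right.
  by rewrite mulf_neq0 ?invr_eq0.
by rewrite DM DX b'4 w4 !scaE; ring.
Qed.

(** Comparing the instances of mixing_eq at 0 and at a point of the first axis,
    resp. of the third, gives g (b + c + s) and g (b + c) as products; the
    instance at 0 then becomes an equation for g c alone. *)
Lemma mixing b c cb b' c0 : G2 b -> off24 c -> c 0 p4 != 0 -> b 0 p2 + c 0 p2 != 0 ->
  g b = cb *: X b' -> cb != 0 -> b' 0 p1 = b 0 p1 - c0 * b 0 p2 ->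
  X s * ((kap * b 0 p2) *: (D p1 (g c) - (c 0 p1 - c0 * c 0 p2) *: g c))
    = ((b' 0 p3 - b 0 p3) * (kap' * c 0 p4)) *: g c.
Proof.
move=> hb hc c4 bc2 eb cb0 b'1; have [Gb b2 b4] := hb; have [Gc _] := hc.
have hbc : off24 (b + c) by split; [apply: (subgrpD gG)|rewrite !rvE bc2].
have hbo : off24 b by split=> //; rewrite b2.
have h0 : G0 0 by split; rewrite ?rvE //; apply: (subgrp0 gG).
have q1 : g (b + 0) = 1 *: (X 0 * g b) by rewrite addr0 X0 mul1r scale1r.
have q2 : g (c - 0) = 1 *: (X (- 0) * g c) by rewrite subr0 oppr0 X0 mul1r scale1r.
have T0 := mixing_eq hb hc hbc h0 c4 q1 q2 (mulr1 1) eb cb0.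
rewrite !rvE !addr0 !subr0 scale0r subr0 in T0.
have Tn p z : nice p z -> exists ch ch', [/\ g (b + at_pos z p) = ch *: (X (at_pos z p) * g b),
    g (c - at_pos z p) = ch' *: (X (- at_pos z p) * g c) & ch * ch' = 1].
  move=> hz; have [ch ch0 E] := shift_nice hz; have [ch' ch'0 E'] := shift_nice (niceN hz).
  rewrite at_posN in E'; exists ch, ch'; split; [exact: E|exact: E'|].
  have := E' _ (offD0 hbo (nice_G0 hz)); rewrite E // addrK => h.
  apply: (@eigen_uniq F (g b)); first exact: off_neq0.
  rewrite scale1r [RHS]h -[LHS]mul1r -(mulXN (at_pos z p)) !scaE rmorphM /=; ring.
have [z1 hz1] := nice_exists (or_introl (erefl p1)).
have [ch1 [ch1' [E1 E1' e1]]] := Tn _ _ hz1.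
have T1 := mixing_eq hb hc hbc (nice_G0 hz1) c4 E1 E1' e1 eb cb0.
have [z3 hz3] := nice_exists (or_intror (erefl p3)).
have [ch3 [ch3' [E3 E3' e3]]] := Tn _ _ hz3.
have T3 := mixing_eq hb hc hbc (nice_G0 hz3) c4 E3 E3' e3 eb cb0.
have z10 : z1 != 0 by case: hz1 => _; rewrite !inE !negb_or => /and5P[].
have z30 : z3 != 0 by case: hz3 => _; rewrite !inE !negb_or => /and5P[].
rewrite !rvE /= !mulr0 !mulr1 !addr0 in T1; rewrite !rvE /= !mulr0 !mulr1 !addr0 !subr0 scale0r subr0 in T3.
set B := g (b + c + s) in T0 T1 T3; set C := g (b + c) in T0 T1 T3.
set h := g c in T0 T1 T3 *; set Y := cb *: X b'.
have Y0 : Y <> 0 by rewrite /Y -eb; apply: off_neq0.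
have EB : B = kap *: (Y * X s * h).
  have k0 : z1 * (b 0 p2 + c 0 p2) != 0 by rewrite mulf_neq0.
  apply: (scalerI k0).
  transitivity ((((b 0 p1 + z1) * c 0 p2 - (c 0 p1 - z1) * b 0 p2) *: B + ((b 0 p3 + 1) * c 0 p4) *: C)
    - ((b 0 p1 * c 0 p2 - c 0 p1 * b 0 p2) *: B + ((b 0 p3 + 1) * c 0 p4) *: C)).
    by rewrite !scaE; ring.
  by rewrite T1 T0 /Y !scaE; ring.
have EC : C = kap' *: (Y * h).
  have k0 : z3 * c 0 p4 != 0 by rewrite mulf_neq0.
  apply: (scalerI k0).
  transitivity (((b 0 p1 * c 0 p2 - c 0 p1 * b 0 p2) *: B + ((b 0 p3 + z3 + 1) * c 0 p4) *: C)
    - ((b 0 p1 * c 0 p2 - c 0 p1 * b 0 p2) *: B + ((b 0 p3 + 1) * c 0 p4) *: C)).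
    by rewrite !scaE; ring.
  by rewrite T3 T0 /Y !scaE; ring.
apply: (salg_mulI char0 Y0).
rewrite EB EC b'1 in T0.
apply/eqP; rewrite -subr_eq0; apply/eqP; move/eqP: T0; rewrite -subr_eq0 => /eqP <-.
by rewrite /Y !scaE; ring.
Qed.

(** For c on the fourth axis, g c is a monomial and the two sides of mixing are
    monomials with distinct exponents; so both vanish. *)
Lemma g_exponent3 c0 b cb b' : (forall a c a', G2 a -> c != 0 -> g a = c *: X a' ->
  a' 0 p1 = a 0 p1 - c0 * a 0 p2) -> G2 b -> cb != 0 -> g b = cb *: X b' ->
  b' 0 p3 = b 0 p3.
Proof.
move=> c0E hb cb0 eb; have [d d0 Gd] := axG p4.
have hd : G4 (at_pos d p4) by split; rewrite ?rvE /= ?mulr0 ?mulr1.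
have [c [d' [cn0 ed d'4]]] := g_monomial4 hd.
have [_ d4 d2] := hd; have [_ b2 _] := hb.
have off : off24 (at_pos d p4) by split=> //; rewrite d4 orbT.
have := mixing hb off d4 _ eb cb0 (c0E _ _ _ hb cb0 eb); rewrite d2 addr0 => /(_ b2).
rewrite ed DZ DX => h.
pose k := (kap * b 0 p2) * c * (d' 0 p1 - (at_pos d p4 0 p1 - c0 * 0)).
have h' : k *: X (s + d') = ((b' 0 p3 - b 0 p3) * (kap' * at_pos d p4 0 p4) * c) *: X d'.
  by rewrite -scalerA -h -mulXX /k !scaE; ring.
have [k0|k0] := eqVneq k 0.
  move: h'; rewrite k0 scale0r => /esym/eqP; rewrite scaler_eq0 => /orP[|/eqP/X_neq0//].
  rewrite !mulf_eq0 invr_eq0 (negPf lam0) (negPf d4) (negPf cn0) !orbF subr_eq0.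
  by move/eqP.
have [e _] := X_inj h' k0; exfalso.
have /rowP/(_ p1)/eqP : s = 0 by apply: (addIr d'); rewrite e add0r.
by rewrite !rvE oner_eq0.
Qed.

(** With g_exponent3 the right-hand side of mixing vanishes. *)
Lemma D1_off c0 c : (forall a c a', G2 a -> c != 0 -> g a = c *: X a' ->
  a' 0 p1 = a 0 p1 - c0 * a 0 p2) -> off24 c -> c 0 p4 != 0 ->
  D p1 (g c) = (c 0 p1 - c0 * c 0 p2) *: g c.
Proof.
move=> c0E hc c4.
have [a ha ac] : exists2 a, G2 a & a 0 p2 + c 0 p2 != 0.
  have [a ha] := some_G2 axG; have [ac|ac] := eqVneq (a 0 p2 + c 0 p2) 0; last by exists a.
  have [_ a2 _] := ha.
  exists (a + a); last by rewrite rvE -addrA ac addr0.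
  by apply: (G2D gG); rewrite // -mulr2n -mulr_natr mulf_neq0 // natrF_eq0.
have [k _ [_ [mono _]]] := g_monomial char0 gG axG nf f1 fXs.
have [ca [_ [a' [ca0 ea _ _]]]] := mono _ ha.
have := mixing ha hc c4 ac ea ca0 (c0E _ _ _ ha ca0 ea).
rewrite (g_exponent3 c0E ha ca0 ea) subrr mul0r scale0r => h.
have k0 : kap * a 0 p2 != 0 by case: ha => _ a2 _; rewrite mulf_neq0 ?invr_eq0.
apply/eqP; rewrite -subr_eq0; apply/eqP; apply: (scalerI k0); rewrite scaler0.
by apply: (salg_mulI char0 (@X_neq0 F s)); rewrite h mulr0.
Qed.

(** * Polynomial variables *)

Lemma g_mul_kap a b : G2 a -> G2 b -> a 0 p2 + b 0 p2 != 0 ->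
  g (a + b + s) = kap *: (X s * g a * g b).
Proof.
have [k k0 [kE [_ E]]] := g_monomial char0 gG axG nf f1 fXs.
have gs := G0s gG.
have [chs [ths ss]] := shiftP char0 gG axG nf f1 fXs gs.
have := kE _ _ _ gs ss; rewrite (shift_normal char0 gG axG nf f1 fXs gs ss) rvE !mulr1 => ->.
exact: E.
Qed.

(** A Jordan block of v over X a is transported: the one of D p2 because D p2 is
    the bracket with an element of the torus, and the one of D p1 through the
    bracket with X a.  The central ambiguity in f v is removed by adding z. *)
Lemma poly_image v a a' c0 e e' c : lie m G v -> D p4 v = 0 -> G2 a ->
  D p2 v = a 0 p2 *: v + e *: X a -> D p1 v = a 0 p1 *: v + e' *: X a ->
  g a = c *: X a' -> a' 0 p1 = a 0 p1 - c0 * a 0 p2 ->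
  exists h, [/\ inA m' G' h, D p2 h = kap *: (a 0 p2 *: h + e *: g a)
    & D p1 h = a' 0 p1 *: h + (e' - c0 * e) *: g a].
Proof.
move=> lv v4 ha v2 v1 ea a'1; have [Ga a2 a4] := ha.
have la := G2lie m gG ha.
have [ga2 ga4] := g_weight char0 gG axG nf f1 fXs ha.
have k0 : kap * a 0 p2 != 0 by rewrite mulf_neq0 ?invr_eq0.
have l1 := lie1 m gG axG; have ls := lieXs char0 m gG axG.
have DZ1 p : p = p2 \/ p = p4 -> D p (X s1) = 0 by case=> ->; rewrite DX sigma1E scale0r.
set h0 := f v.
have nh0 : nrm h0 = h0 by apply: (niso_nrm nf).
have Ah0 : inA m' G' h0 by apply: lie_inA; apply: (niso_in nf).
have Aga : inA m' G' (g a) by apply: lie_inA; apply: (niso_in nf).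
have lD2 : lie m G (a 0 p2 *: v + e *: X a) by apply: lieP => //; apply: lieZ.
have /nrm_eq[e0 ee0] : nrm (D p2 h0) = nrm (kap *: (a 0 p2 *: h0 + e *: g a)).
  have := niso_br nf ls lv; rewrite brXs v2 fXs brZl brXs -scaleN1r (nisoZ cL nf) //.
  rewrite (niso_lin nf) ?(nisoZ cL nf) //; last exact: lieZ.
  rewrite -/h0 !nrmZ !nrmP !nrmZ nh0 (niso_nrm nf) // linearN /= => h.
  by rewrite -[LHS](scalerK mu0) -[mu *: _]opprK -scalerN -h scaleN1r opprK.
pose z := (kap * a 0 p2)^-1 *: (e0 *: X s1).
have [h hE] : exists h, h = h0 + z by exists (h0 + z).
have Az : inA m' G' z.
  apply: inAZ; rewrite -ee0; apply: supp_inB; first exact: inA_D.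
  by apply: inAZ; apply: inAP => //; apply: inAZ.
have Dz p : p = p2 \/ p = p4 -> D p z = 0 by move=> hp; rewrite !DZ DZ1 // !scaler0.
have h2 : D p2 h = kap *: (a 0 p2 *: h + e *: g a).
  rewrite hE DD Dz ?addr0; last by left.
  rewrite -[LHS](subrK (kap *: (a 0 p2 *: h0 + e *: g a))) ee0.
  have <- : (kap * a 0 p2) *: z = e0 *: X s1 by rewrite /z scalerA mulfV // scale1r.
  by rewrite !scaE; ring.
have h4 : D p4 h = 0.
  have /nrm_eq[e4 ee4] : nrm (D p4 h0) = nrm 0.
    have := niso_br nf l1 lv; rewrite br1 v4 (niso0 cL nf) f1 brZl br1 nrmZ linear0.
    by move/esym/eqP; rewrite scaler_eq0 (negPf lam0) => /eqP.
  have {}h4 : D p4 h = e4 *: X s1 by rewrite hE DD Dz ?addr0 -?ee4 ?subr0 //; right.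
  have := Dcomm p2 p4 h; rewrite h2 h4 !(DZ, DD) h4 ga4 scaler0 addr0.
  rewrite DZ1; last by left.
  rewrite scaler0 !scalerA => /esym/eqP.
  rewrite scaler_eq0 => /orP[|/eqP/X_neq0//].
  by rewrite mulf_eq0 (negPf k0) => /eqP ->; rewrite scale0r.
exists h; split=> //; first by rewrite hE; apply: supp_inD.
have aa : a 0 p2 + a 0 p2 != 0 by rewrite -mulr2n -mulr_natr mulf_neq0 // natrF_eq0.
have ha2 := G2D0 gG (G2D gG ha ha aa) (G0s gG).
have D1g : D p1 (g a) = a' 0 p1 *: g a by rewrite ea DZ DX !scalerA mulrC.
pose Y := D p1 h - a' 0 p1 *: h - (e' - c0 * e) *: g a.
have brv : br (X a) v = (a 0 p1 * e - a 0 p2 * e') *: X (a + a + s).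
  rewrite /br v1 v2 v4 !DX a4 -!mulXX !scaE rmorph0; ring.
have := niso_br nf la lv; rewrite brv (nisoZ cL nf); last exact: G2lie.
rewrite g_mul_kap // -/h0.
have -> : br (g a) h0 = br (g a) h.
  have nz : nrm z = 0 by rewrite !nrmZ nrmX1 !scaler0.
  by rewrite hE brAr -[br (g a) z]br_nrmr nz br0r addr0.
have -> : br (g a) h = (a 0 p1 * e - a 0 p2 * e') *: (kap *: (X s * g a * g a))
    - (kap * a 0 p2) *: (X s * g a * Y).
  rewrite /Y /br h2 h4 ga4 ga2 D1g a'1 !scaE !(rmorphB, rmorphM) /=; ring.
rewrite nrmB !nrmZ.
have -> : nrm (X s * g a * g a) = X s * g a * g a.
  have k1 : kap^-1 *: (kap *: (X s * g a * g a)) = X s * g a * g a.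
    by rewrite scalerA mulVf ?scale1r // invr_eq0.
  by rewrite -[LHS]/(nrm _) -{1}k1 -g_mul_kap // nrmZ (niso_nrm nf) ?g_mul_kap ?k1 //; apply: G2lie.
have DY : D p2 Y = (kap * a 0 p2) *: Y.
  rewrite /Y !DB !DZ Dcomm h2 !(DZ, DD) D1g ga2 !scaE; ring.
have -> : nrm (X s * g a * Y) = X s * g a * Y.
  apply: (nrm_weight char0 (p := p2) (b := kap * (a 0 p2 + a 0 p2))); first by left.
    by rewrite mulf_neq0 ?invr_eq0.
  by rewrite !DM DX DY ga2 rvE !scaE; ring.
move/eqP; rewrite -subr_eq0 opprB addrC subrK => /eqP hY.
have : Y = 0.
  apply: (salg_mulI char0 (u := X s * g a)).
    by apply: (salg_mul_neq0 char0); [apply: X_neq0|apply: (g_neq0 gG nf ha)].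
  by apply: (scalerI k0); rewrite hY mulr0 scaler0.
rewrite /Y => /eqP; rewrite subr_eq0 => /eqP {1}<-; by rewrite addrC subrK.
Qed.

(** The first half of f.  Polynomial variables of the source produce Jordan
    blocks in the target: t1 one of D p1, t2 one of D p2, and the latter is also
    one of D p1, with off-diagonal entry - c0. *)
Lemma half_linear : exists c0,
  [/\ forall a, G2 a -> exists c a', [/\ c != 0, g a = c *: X a',
        a' 0 p1 = a 0 p1 - c0 * a 0 p2 & a' 0 p3 = a 0 p3],
      forall c, off24 c -> c 0 p4 != 0 ->
        D p1 (g c) = (c 0 p1 - c0 * c 0 p2) *: g c,
      m p1 -> m' p1, m p2 -> m' p2 & m' p1 = false -> m p2 -> c0 = 0].
Proof.
have [c0 c0E] := g_exponent1 char0 gG axG nf f1 fXs; exists c0.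
have [k _ [_ [mono _]]] := g_monomial char0 gG axG nf f1 fXs.
have [a ha] := some_G2 axG; have [Ga a2 a4] := ha.
have [c [_ [a' [cn0 ea _ _]]]] := mono _ ha.
have a'1 := c0E _ _ _ ha cn0 ea.
have [_ a'2 a'4] := g_exponent char0 gG axG nf f1 fXs ha cn0 ea.
have tvar p : m p -> lie m G (x (a, exp_inc p exp0)).
  move=> mp; apply: (lie_D2 gG _ a2).
    by apply: supp_inx; split=> //; apply: Jset_inc.
  rewrite D_tvar addrC addKr; apply: lieZ; exact: G2lie.
have tD p q : D q (x (a, exp_inc p exp0) : A) = a 0 q *: x (a, exp_inc p exp0)
    + ((q == p)%:R : F) *: X a by apply: D_tvar.
have t1 : m p1 -> exists h, [/\ inA m' G' h & D p1 h = a' 0 p1 *: h + 1 *: g a].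
  move=> mp; have t4 : D p4 (x (a, exp_inc p1 exp0) : A) = 0.
    by rewrite tD a4 !scale0r addr0.
  have [h [Ah _ h1]] := poly_image (tvar _ mp) t4 ha (tD p1 p2) (tD p1 p1) ea a'1.
  by exists h; split=> //; rewrite h1 mulr0 subr0.
have t2 : m p2 -> exists h, [/\ inA m' G' h, D p2 h = kap *: (a 0 p2 *: h + 1 *: g a)
    & D p1 h = a' 0 p1 *: h + (0 - c0 * 1) *: g a].
  move=> mp; have t4 : D p4 (x (a, exp_inc p2 exp0) : A) = 0.
    by rewrite tD a4 !scale0r addr0.
  exact: poly_image (tvar _ mp) t4 ha (tD p2 p2) (tD p2 p1) ea a'1.
split.
- move=> b hb; have [cb [_ [b' [cb0 eb _ _]]]] := mono _ hb.
  exists cb, b'; split=> //; first exact: c0E hb cb0 eb.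
  exact: (g_exponent3 c0E hb cb0 eb).
- by move=> d hd d4; apply: (D1_off c0E hd d4).
- move=> /t1[h [Ah h1]]; apply: contraT => /negbTE mp'.
  have /eqP := no_jordan (r := 1) Ah mp' cn0 (etrans h1 (congr1 (fun w => _ + 1 *: w) ea)).
  by rewrite oner_eq0.
- move=> /t2[h [Ah h2 _]]; apply: contraT => /negbTE mp'.
  have h2' : D p2 h = a' 0 p2 *: h + kap *: (c *: X a').
    by rewrite h2 ea a'2 scale1r scalerDr scalerA.
  by have /eqP := no_jordan Ah mp' cn0 h2'; rewrite invr_eq0 (negPf mu0).
- move=> mp' /t2[h [Ah _ h1]].
  have h1' : D p1 h = a' 0 p1 *: h + (- c0) *: (c *: X a') by rewrite h1 ea sub0r mulr1.
  by have /eqP := no_jordan Ah mp' cn0 h1'; rewrite oppr_eq0 => /eqP.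
Qed.

End Comparison.

(** * From isomorphisms to linear equivalence of the parameters *)

(** The action of a block diagonal matrix, see mul_diag22. *)
Definition dlin (F : fieldType) (c0 k2 c4 k4 : F) (a : 'rV[F]_4) : 'rV[F]_4 :=
  \row_p (if p == p1 then a 0 p1 - c0 * a 0 p2 else if p == p2 then k2 * a 0 p2
          else if p == p3 then a 0 p3 - c4 * a 0 p4 else k4 * a 0 p4).

Section Linear.
Variables (F : fieldType) (c0 k2 c4 k4 : F).
Lemma dlinE a : (dlin c0 k2 c4 k4 a 0 p1 = a 0 p1 - c0 * a 0 p2)
  * (dlin c0 k2 c4 k4 a 0 p2 = k2 * a 0 p2)
  * (dlin c0 k2 c4 k4 a 0 p3 = a 0 p3 - c4 * a 0 p4)
  * (dlin c0 k2 c4 k4 a 0 p4 = k4 * a 0 p4).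
Proof. by rewrite !mxE. Qed.
End Linear.

Lemma dlinK (F : fieldType) (c0 k2 c4 k4 : F) : k2 != 0 -> k4 != 0 ->
  cancel (dlin c0 k2 c4 k4) (dlin (- c0 / k2) k2^-1 (- c4 / k4) k4^-1).
Proof.
by move=> h2 h4 a; apply: rV4P; rewrite !dlinE; field.
Qed.

Section DiagonalLinear.
Variable F : fieldType.
Hypothesis char0 : [pchar F] =i pred0.
Local Notation A := (salg F).
Implicit Types (u v w : A) (a b : 'rV[F]_4).
Local Notation s := (sigma F).
Local Notation s1 := (sigma1 F).

Section Iso.
Variables (m m' : Mvec) (G G' : set 'rV[F]_4) (f : A -> A).
Hypotheses (gG : subgrp G) (gG' : subgrp G').
Hypothesis axG : forall p, exists2 a : F, a != 0 & G (at_pos a p).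
Hypothesis nf : niso (lie m G) (lie m' G') f.
Variables lam mu : F.
Hypothesis f1 : f 1 = lam *: 1.
Hypothesis fXs : f (X (- s)) = mu *: X (- s).
Local Notation kap := (mu^-1).
Local Notation kap' := (lam^-1).
Local Notation G0 := (G0 G).
Local Notation G2 := (G2 G).
Local Notation G4 := (G4 G).
Local Notation g a := (f (X a)).
Let lam0 : lam != 0. Proof. by case: (lam_mu_neq0 char0 gG axG nf f1 fXs). Qed.
Let mu0 : mu != 0. Proof. by case: (lam_mu_neq0 char0 gG axG nf f1 fXs). Qed.
Let gS := swG_subgrp gG.
Let gS' := swG_subgrp gG'.
Let axS := swG_axis axG.
Let nS := swf_niso gG gG' nf.
Let fS1 := swf1 fXs.
Let fSs := swfs f1.

Lemma supp_X a (c : F) : c != 0 -> lie m' G' (c *: X a) -> G' a.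
Proof.
move=> c0 /lie_inA /(_ (a, exp0)); rewrite coZ cox eqxx mulr1.
by move=> /(_ c0)[].
Qed.

Lemma swv_p a : (swv a 0 p1 = a 0 p3) * (swv a 0 p2 = a 0 p4)
  * (swv a 0 p3 = a 0 p1) * (swv a 0 p4 = a 0 p2).
Proof. by rewrite !mxE. Qed.

Lemma swdual_p a : (swdual a 0 p1 = - a 0 p3 - 1) * (swdual a 0 p2 = - a 0 p4)
  * (swdual a 0 p3 = - a 0 p1 - 1) * (swdual a 0 p4 = - a 0 p2).
Proof. by rewrite /swdual !rvE !swv_p /= !subr0. Qed.

Lemma G_swdual b : G b -> swG G (swdual b).
Proof.
rewrite /swG /swdual swvD !swvN swvK swv_s => Gb.
by apply: (subgrpB gG); [apply: (subgrpN gG)|apply: subgrp_s gG].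
Qed.

Lemma D3_off c4 c : off24 G c ->
  D p1 (swf f (X (swdual c))) = ((swdual c) 0 p1 - c4 * (swdual c) 0 p2)
    *: swf f (X (swdual c)) ->
  D p3 (g c) = (c 0 p3 - c4 * c 0 p4) *: g c.
Proof.
move=> hc; have [Gc c24] := hc.
have hS : off24 (swG G) (swdual c).
  by split; [apply: G_swdual|rewrite !swdual_p !oppr_eq0 orbC].
rewrite !swdual_p (swfE gG nf (off_lie m gG hc)) swX'.
have [] := off_weight char0 gS axS nS fS1 fSs hS; rewrite !swdual_p.
set h := swf f _ => h2 h4 h1.
have wh : weight (kap * c 0 p2) (kap' * c 0 p4) (sw h).
  split; rewrite D_sw !rvE scale0r oppr0 add0r /swp /=.
    by rewrite h4 [sw (_ *: _)]linearZ /= mulrN scaleNr opprK.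
  by rewrite h2 [sw (_ *: _)]linearZ /= mulrN scaleNr opprK.
rewrite (off_nrm char0 gG axG nf f1 fXs hc wh) D_sw !rvE /swp /= h1 [sw (_ *: _)]linearZ /=.
by rewrite !scaE; ring.
Qed.

(** If the weight of a is not zero, then X a has as image a monomial or at least
    a joint eigenvector, whose exponent thus belongs to G'.  If it is zero, a is a
    sum of two generic exponents, which shift_generic places in G'. *)
Lemma diag_image : exists c0 c4, [/\
  forall a, G a -> G' (dlin c0 kap c4 kap' a),
  forall a, G2 a \/ G4 a -> exists2 c, c != 0 & g a = c *: X (dlin c0 kap c4 kap' a),
  forall p, m p -> m' p, m' p1 = false -> m p2 -> c0 = 0
  & m' p3 = false -> m p4 -> c4 = 0].
Proof.
have [c0 [M2 O2 j1 j2 K2]] := half_linear char0 gG gG' axG nf f1 fXs.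
have [c4 [M4 O4 j3 j4 K4]] := half_linear char0 gS gS' axS nS fS1 fSs.
rewrite !ffunE /swp /= in j3 j4 K4.
have B a : G2 a \/ G4 a -> exists2 c, c != 0 & g a = c *: X (dlin c0 kap c4 kap' a).
  case=> ha.
    have [c [a' [cn0 e a'1 a'3]]] := M2 _ ha; exists c => //.
    have [_ a'2 a'4] := g_exponent char0 gG axG nf f1 fXs ha cn0 e.
    rewrite e; congr (_ *: X _); apply: rV4P; rewrite !dlinE //.
      by rewrite a'3; case: ha => _ _ ->; rewrite mulr0 subr0.
    by rewrite a'4; case: ha => _ _ ->; rewrite mulr0.
  have [c [a' [cn0 e a'1 a'3]]] := M4 _ (G4swdual gG ha); exists c => //.
  have [a'4 a'2 ->] := g_swdual char0 gG gG' axG nf f1 fXs ha cn0 e.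
  congr (_ *: X _); apply: rV4P; rewrite !swdual_p !dlinE ?a'1 ?a'2 ?a'3 ?a'4 ?swdual_p.
  - by case: ha => _ _ ->; ring.
  - by case: ha => _ _ ->; ring.
  - by ring.
  - by ring.
exists c0, c4; split=> //; last first.
  by elim/ord4P.
move=> a Ga.
have in24 b : G2 b \/ G4 b -> G' (dlin c0 kap c4 kap' b).
  move=> hb; have [c cn0 e] := B _ hb; apply: (supp_X cn0); rewrite -e.
  apply: (niso_in nf); case: hb => hb; [exact: (G2lie _ _ hb)|exact: (G4lie _ _ hb)].
have [a2|a2] := eqVneq (a 0 p2) 0; have [a4|a4] := eqVneq (a 0 p4) 0; first last.
- have ha : off24 G a by split=> //; rewrite a2.
  have gn0 := off_neq0 gG nf ha.
  have [|c e] := @joint_eigen F char0 (g a) (dlin c0 kap c4 kap' a).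
    have [w2 w4] := off_weight char0 gG axG nf f1 fXs ha.
    elim/ord4P; rewrite dlinE //; first exact: O2.
    apply: D3_off => //; apply: O4; rewrite ?swdual_p ?oppr_eq0 //.
    by split; [apply: G_swdual|rewrite !swdual_p !oppr_eq0 a2 orbT].
  have cn0 : c != 0 by apply/eqP => c00; apply: gn0; rewrite e c00 scale0r.
  by apply: (supp_X cn0); rewrite -e; apply: (niso_in nf); apply: off_lie.
- by apply: in24; left; split.
- by apply: in24; right; split.
have -> : dlin c0 kap c4 kap' a = a by apply: rV4P; rewrite !dlinE ?a2 ?a4; ring.
have gen e : G0 e -> generic e -> G' e.
  move=> he hgen.
  have [ch ch0 [_ _ e0]] := shift_generic char0 gG gG' axG nf f1 fXs he hgen.
  apply: (@supp_X e (lam * ch)); first by rewrite mulf_neq0.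
  rewrite -e0; apply: (niso_in nf); case: he hgen => Ge e2 e4 [e1 e3 es1].
  by apply: (lieX0 m gG axG) => //; rewrite e3 orbT.
have [z1' z1'0 Gz1] := axG p1; have [z3' z3'0 Gz3] := axG p3.
have [n1] := multiple_notin char0 [:: 0; 1; a 0 p1; a 0 p1 - 1] z1'0.
have [n3] := multiple_notin char0 [:: -2; a 0 p3 + 2] z3'0.
set z3 := _ * z3'; set z1 := _ * z1'; rewrite !inE !negb_or.
move=> /andP[h31 h32] /and4P[h11 h12 h13 h14].
pose e := at_pos z1 p1 + at_pos z3 p3.
have Ge : G0 e.
  split; rewrite /e ?rvE /= ?mulr0 ?addr0 //.
  by apply: (subgrpD gG); rewrite /z1 /z3 /at_pos -scalerA scaler_nat; apply: (subgrpMn gG).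
have e1 : e 0 p1 = z1 by rewrite /e !rvE /= mulr1 mulr0 addr0.
have e3 : e 0 p3 = z3 by rewrite /e !rvE /= mulr1 mulr0 add0r.
rewrite -[a](subrK e); apply: (subgrpD gG').
  apply: gen; first by apply: (G0D gG) (G0N gG Ge).
  split; rewrite ?rvD ?rvN ?e1 ?e3.
  - by apply: contra h14 => /eqP h; rewrite -h subKr.
  - by apply: contra h32 => /eqP h; rewrite -[2]opprK -h subKr.
  - move/rowP/(_ p1)/eqP; rewrite !rvD !rvN e1 !rvE /= subr_eq0 eq_sym; exact/negP.
apply: gen => //; split; rewrite ?e1 ?e3 //.
by move/rowP/(_ p1)/eqP; rewrite e1 !rvE /=; apply/negP.
Qed.

End Iso.

Definition lin_equiv (m : Mvec) (G G' : set 'rV[F]_4) := exists c0 k2 c4 k4,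
  [/\ k2 != 0, k4 != 0, m p1 = false -> m p2 -> c0 = 0, m p3 = false -> m p4 -> c4 = 0
    & G' = [set dlin c0 k2 c4 k4 a | a in G]%classic].

Section Equivalence.
Variables (m m' : Mvec) (G G' : set 'rV[F]_4) (f : A -> A).
Hypotheses (gG : subgrp G) (gG' : subgrp G').
Hypothesis axG : forall p, exists2 a : F, a != 0 & G (at_pos a p).
Hypothesis axG' : forall p, exists2 a : F, a != 0 & G' (at_pos a p).
Hypothesis nf : niso (lie m G) (lie m' G') f.

(** The inverse isomorphism satisfies the hypotheses too.  Composing the two on
    one exponent of each half shows that its linear map is the inverse one. *)
Lemma diag_equiv lam mu : f 1 = lam *: 1 -> f (X (- s)) = mu *: X (- s) ->
  m = m' /\ lin_equiv m G G'.
Proof.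
move=> f1 fXs; have [lam0 mu0] := lam_mu_neq0 char0 gG axG nf f1 fXs.
have [f' [nf' f'f ff']] := niso_inv (lie_closed m gG) (lie_closed m' gG') nf.
have cL' := lie_closed m' gG'.
have l1 := lie1 m gG axG; have ls := lieXs char0 m gG axG.
have l1' := lie1 m' gG' axG'; have ls' := lieXs char0 m' gG' axG'.
have f'1 : f' 1 = lam^-1 *: 1.
  by have := f'f _ l1; rewrite nrm1 f1 (nisoZ cL' nf') // => e; rewrite -[LHS](scalerK lam0) e.
have f'Xs : f' (X (- s)) = mu^-1 *: X (- s).
  by have := f'f _ ls; rewrite nrmXs fXs (nisoZ cL' nf') // => e; rewrite -[LHS](scalerK mu0) e.
have [c0 [c4 [hG hg hm hc0 hc4]]] := diag_image gG gG' axG nf f1 fXs.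
have [c0' [c4' [hG' hg' hm' _ _]]] := diag_image gG' gG axG' nf' f'1 f'Xs.
rewrite !invrK in hG' hg'.
pose d := dlin c0 mu^-1 c4 lam^-1; pose d' := dlin c0' mu c4' lam.
have emm : m = m'.
  by apply/ffunP => p; apply/idP/idP; [apply: hm|apply: hm'].
have dd a : G2 G a \/ G4 G a -> d' (d a) = a.
  move=> ha; have [c cn0 e] := hg _ ha.
  have hda : G2 G' (d a) \/ G4 G' (d a).
    case: ha => -[Ga n z]; [left|right]; (split; first exact: hG).
    - by rewrite /d dlinE mulf_neq0 // invr_eq0.
    - by rewrite /d dlinE z mulr0.
    - by rewrite /d dlinE mulf_neq0 // invr_eq0.
    - by rewrite /d dlinE z mulr0.
  have [c' c'n0 e'] := hg' _ hda.
  have la : lie m G (X a) by case: ha => ha; [exact: (G2lie _ _ ha)|exact: (G4lie _ _ ha)].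
  have na : a <> s1 by case: ha => ha; [exact: G2s1 ha|exact: G4s1 ha].
  have lda : lie m' G' (X (d a)) by case: hda => hda; [exact: (G2lie _ _ hda)|exact: (G4lie _ _ hda)].
  have := f'f _ la; rewrite nrmX // e (nisoZ cL' nf') // e' scalerA -[RHS]scale1r.
  by move/X_inj; rewrite mulf_neq0 // => /(_ isT)[].
have [a ha] := some_G2 axG; have [Ga a2 a4] := ha.
have [b b0 Gb] := axG p4.
have hb : G4 G (at_pos b p4) by split; rewrite ?rvE /= ?mulr0 ?mulr1.
have ec0 : c0' = - c0 / mu^-1.
  have := congr1 (fun a : 'rV[F]_4 => a 0 p1) (dd _ (or_introl ha)).
  rewrite /d' /d !dlinE -[RHS]subr0 -addrA => /addrI; rewrite oppr0 => /eqP.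
  have -> : - (c0 * a 0 p2) - c0' * (mu^-1 * a 0 p2) = (- c0 - c0' / mu) * a 0 p2 by ring.
  rewrite mulf_eq0 (negPf a2) orbF subr_eq0 => /eqP ->; by rewrite mulfK // invr_eq0.
have ec4 : c4' = - c4 / lam^-1.
  have := congr1 (fun a : 'rV[F]_4 => a 0 p3) (dd _ (or_intror hb)).
  rewrite /d' /d !dlinE -[RHS]subr0 -addrA => /addrI; rewrite oppr0 => /eqP.
  set z := at_pos b p4 0 p4.
  have z0 : z != 0 by case: hb.
  have -> : - (c4 * z) - c4' * (lam^-1 * z) = (- c4 - c4' / lam) * z by ring.
  rewrite mulf_eq0 (negPf z0) orbF subr_eq0 => /eqP ->; by rewrite mulfK // invr_eq0.
split=> //; exists c0, mu^-1, c4, lam^-1; split.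
- by rewrite invr_eq0.
- by rewrite invr_eq0.
- by rewrite {1}emm; apply: hc0.
- by rewrite {1}emm; apply: hc4.
apply/seteqP; split=> [b' Gb'|_ [b' Gb' <-]]; last exact: hG.
exists (d' b'); first exact: hG'.
rewrite /d' ec0 ec4; have := @dlinK F (- c0 / mu^-1) mu (- c4 / lam^-1) lam mu0 lam0 b'.
have -> : - (- c0 / mu^-1) / mu = c0 by rewrite invrK mulNr mulfK // opprK.
by have -> : - (- c4 / lam^-1) / lam = c4 by rewrite invrK mulNr mulfK // opprK.
Qed.

End Equivalence.

(** Applied to f and to its composition with the block swap, torus_axis puts a
    zero in each row of the invertible matrix of f on the torus: the matrix is
    diagonal or antidiagonal, and the swap reduces the second case to the
    first. *)
Lemma iso_lin_equiv m m' (G G' : set 'rV[F]_4) f : subgrp G -> subgrp G' ->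
  (forall p, exists2 a : F, a != 0 & G (at_pos a p)) ->
  (forall p, exists2 a : F, a != 0 & G' (at_pos a p)) ->
  niso (lie m G) (lie m' G') f ->
  m = m' /\ lin_equiv m G G' \/ swe m = m' /\ lin_equiv (swe m) (swG G) G'.
Proof.
move=> gG gG' axG axG' nf.
have l1 := lie1 m gG axG; have ls := lieXs char0 m gG axG.
have [t [r f1]] := torus_image char0 gG gG' axG' nf l1 (@br1_locfin F).
have [q [p fs]] := torus_image char0 gG gG' axG' nf ls (@brXs_locfin F).
have gS := swG_subgrp gG; have axS := swG_axis axG.
have nh := sw_niso (swe m) gS; rewrite sweK swGK in nh.
have {nh}nh := niso_comp (lie_closed m gG) (lie_closed m' gG') nh nf.
have h1 : (f \o (fun u => nrm (sw u))) 1 = q *: 1 + p *: X (- s).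
  by rewrite /= sw1 nrmXs.
have hs : (f \o (fun u => nrm (sw u))) (X (- s)) = t *: 1 + r *: X (- s).
  by rewrite /= swXs nrm1.
have det := torus_det char0 gG axG nf f1 fs.
have fc := torus_axis char0 gG axG nf f1 fs.
have hc := torus_axis char0 gS axS nh h1 hs.
case: fc hc det => z; rewrite z ?(mul0r, sub0r, subr0).
  case=> [->|z']; first by rewrite mulr0 oppr0 eqxx.
  move=> _; right; apply: (diag_equiv gS gG' axS axG' nh (lam := q) (mu := r)).
    by rewrite h1 z' scale0r addr0.
  by rewrite hs z scale0r add0r.
case=> [z'|->]; last by rewrite mulr0 eqxx.
move=> _; left; apply: (diag_equiv gG gG' axG axG' nf (lam := t) (mu := p)).
  by rewrite f1 z scale0r addr0.
by rewrite fs z' scale0r add0r.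
Qed.
End DiagonalLinear.

(** * From linear equivalence of the parameters to isomorphisms *)

Section Character.
Variables (F : closedFieldType) (V : zmodType).
Implicit Types (a b v : V) (x y z : F).

Lemma nth_root x n : (0 < n)%N -> exists y, y ^+ n = x.
Proof.
move=> n0; have [y e] := @solve_monicpoly F n (fun i => if i == 0%N then x else 0) n0.
exists y; rewrite e; case: n n0 {e} => // n _.
by rewrite big_ord_recl /= expr0 mulr1 big1 ?addr0 // => i _; rewrite mul0r.
Qed.

(** Graphs of characters of subgroups of V. *)
Definition char_graph (R : set (V * F)) := [/\ forall x, R (0, x) -> x = 1,
  forall a x, R (a, x) -> x != 0
  & forall a b x y, R (a, x) -> R (b, y) -> R (a - b, x / y)].

Section Graph.
Variable R : set (V * F).
Hypothesis gR : char_graph R.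

Lemma graph_fun a x y : R (a, x) -> R (a, y) -> x = y.
Proof.
case: gR => R1 R0 RB hx hy; have := RB _ _ _ _ hx hy; rewrite subrr => /R1 e.
by rewrite -[x](divfK (R0 _ _ hy)) e mul1r.
Qed.

Lemma graph0 a x : R (a, x) -> R (0, 1).
Proof.
by case: gR => R1 R0 RB h; have := RB _ _ _ _ h h; rewrite subrr divff // (R0 _ _ h).
Qed.

Lemma graphN a x : R (a, x) -> R (- a, x^-1).
Proof.
by move=> h; have := graph0 h; case: gR => _ _ RB h1; have := RB _ _ _ _ h1 h; rewrite sub0r div1r.
Qed.

Lemma graphD a b x y : R (a, x) -> R (b, y) -> R (a + b, x * y).
Proof.
by move=> ha /graphN hb; case: gR => _ _ RB; have := RB _ _ _ _ ha hb; rewrite opprK invrK.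
Qed.

Lemma graphM a x (n : int) : R (a, x) -> R (a *~ n, x ^ n).
Proof.
move=> h; have nat k : R (a *+ k, x ^+ k).
  elim: k => [|k IH]; first exact: graph0 h.
  by rewrite mulrS exprS; apply: graphD.
by case: n => n; [exact: nat|exact: (graphN (nat n.+1))].
Qed.

(** A value for the character at v: a root of the value at the least positive
    multiple of v in the domain, when there is one. *)
Lemma graph_value v : (exists r, R r) -> exists2 y, y != 0 &
  forall (n : int) x, R (v *~ n, x) -> x = y ^ n.
Proof.
case=> -[a0 x0'] /graph0 R01; have [R1 R0 RB] := gR.
have [ex|nex] := pselect (exists n, (0 < n)%N && `[< exists x, R (v *+ n, x) >]).
  have [n /andP[n0 /asboolP[x Rx]] nmin] := ex_minnP ex.
  have [y yn] := nth_root x n0; exists y.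
    by apply: contraTneq (R0 _ _ Rx) => y0; rewrite -yn y0 expr0n eqn0Ngt n0 eqxx.
  have y0 : y != 0.
    by apply: contraTneq (R0 _ _ Rx) => y0; rewrite -yn y0 expr0n eqn0Ngt n0 eqxx.
  move=> k w Rw; have := divz_eq k n.
  set q := (k %/ n)%Z; have r0 : (0 <= (k %% n)%Z) by rewrite modz_ge0 // eqz_nat -lt0n.
  have rn : ((k %% n)%Z < n%:Z)%R by rewrite ltz_pmod // ltz_nat.
  case: (k %% n)%Z r0 rn => [r _|//]; rewrite ltz_nat => rn ek.
  have Rr : R (v *+ r, w / x ^ q).
    have := RB _ _ _ _ Rw (graphM q Rx); rewrite ek mulrzDr mulrC mulrzA -!pmulrn.
    by rewrite addrAC subrr add0r.
  have r0 : r = 0%N.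
    apply/eqP; rewrite -leqn0 leqNgt; apply/negP => r0.
    have /nmin : (0 < r)%N && `[< exists x, R (v *+ r, x) >].
      by rewrite r0; apply/asboolP; exists (w / x ^ q).
    by rewrite leqNgt rn.
  move: Rr ek; rewrite r0 mulr0n => /R1 e ->.
  rewrite addr0 mulrC -exprz_exp -exprnP yn -[w](divfK (_ : x ^ q != 0)) ?e ?mul1r //.
  exact: R0 (graphM q Rx).
exists 1; first exact: oner_neq0.
move=> n x Rx; rewrite exp1rz.
have pos k y : (0 < k)%N -> ~ R (v *+ k, y).
  by move=> k0 h; apply: nex; exists k; rewrite k0; apply/asboolP; exists y.
case: n Rx => [[|n]|n].
- by rewrite mulr0z => /R1.
- by rewrite -pmulrn => /pos-/(_ isT).
- by rewrite NegzE mulrNz -pmulrn => /graphN; rewrite opprK => /pos-/(_ isT).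
Qed.
End Graph.

(** A character of a subgroup extends because the multiplicative group of F is
    divisible. *)
Lemma character_exists (a0 : V) (z : F) : z != 0 -> (forall n, a0 *+ n.+1 <> 0) ->
  exists chi : V -> F, [/\ forall a, chi a != 0,
    forall a b, chi (a + b) = chi a * chi b & chi a0 = z].
Proof.
move=> z0 a0n.
pose P (R : set (V * F)) := char_graph R /\ ((exists r, R r) -> R (a0, z)).
have [R [[gR Ra0] Rmax]] : exists R, P R /\ forall B, (R `<` B)%classic -> ~ P B.
  apply: Zorn_bigcup => E EP Etot; split; last first.
    by case=> [r [B EB Br]]; exists B => //; apply: (EP _ EB).2; exists r.
  split.
  - by move=> x [B /EP[[h _ _] _] /h].
  - by move=> a x [B /EP[[_ h _] _] /h].
  - move=> a b x y [B EB Ba] [C EC Cb]; have [BC|CB] := Etot _ _ EB EC.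
      by exists C => //; have [[_ _ h] _] := EP _ EC; apply: h => //; apply: BC.
    by exists B => //; have [[_ _ h] _] := EP _ EB; apply: h => //; apply: CB.
have {}Ra0 : R (a0, z).
  apply: contrapT => nR.
  have Re r : ~ R r by move=> h; apply: nR; apply: Ra0; exists r.
  pose B : set (V * F) := fun r => exists n : int, r = (a0 *~ n, z ^ n).
  apply: (Rmax B).
    split=> [r /Re//|BR]; by apply: (Re (a0, z)); apply: BR; exists 1; rewrite mulr1z expr1z.
  split; last by exists 1; rewrite mulr1z expr1z.
  split.
  - move=> x [n r]; have := congr1 fst r; have /= -> := congr1 snd r.
    case: n {r} => [[|n]|n] //= /esym e; first by case: (a0n n).
    by case: (a0n n); move/eqP: e; rewrite oppr_eq0 => /eqP.
  - by move=> a x [n [_ ->]]; rewrite expfz_neq0.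
  - move=> a b x y [n [-> ->]] [k [-> ->]]; exists (n - k).
    by rewrite mulrzBr expfzDr // invr_expz.
have dom v : exists x, R (v, x).
  apply: contrapT => nv.
  have [|y y0 yR] := graph_value gR v; first by exists (a0, z).
  have R01 := graph0 gR Ra0.
  pose B : set (V * F) := fun r => exists n : int, exists a, exists x,
    R (a, x) /\ r = (a + v *~ n, x * y ^ n).
  have [R1 R0 RB] := gR.
  apply: (Rmax B).
    split=> [[a x] Rr|BR].
      by exists 0, a, x; rewrite mulr0z addr0 expr0z mulr1.
    apply: nv; exists y; apply: BR; exists 1, 0, 1.
    by rewrite mulr1z add0r expr1z mul1r.
  split; last by move=> _; exists 0, a0, z; rewrite mulr0z addr0 expr0z mulr1.
  split.
  - move=> x [n [a [w [Ra [e ->]]]]].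
    have ea : a = v *~ (- n) by apply/eqP; rewrite mulrNz -addr_eq0 e.
    rewrite ea in Ra; rewrite (yR _ _ Ra) -expfzDr // addNr expr0z //.
  - by move=> a x [n [b [w [/R0 w0 [_ ->]]]]]; rewrite mulf_neq0 // expfz_neq0.
  - move=> a b x w [n [a' [x' [Ra [-> ->]]]]] [k [b' [w' [Rb [-> ->]]]]].
    exists (n - k), (a' - b'), (x' / w'); split; first exact: RB.
    by rewrite mulrzBr opprD addrACA expfzDr // invfM invr_expz mulrACA.
have /choice[chi chiP] := dom.
exists chi; split.
- by move=> a; have [_ h _] := gR; apply: h (chiP a).
- by move=> a b; apply: (graph_fun gR (chiP _)); apply: graphD.
- exact: (graph_fun gR (chiP _)).
Qed.
End Character.

Lemma dlinD (F : fieldType) (c0 k2 c4 k4 : F) a b :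
  dlin c0 k2 c4 k4 (a + b) = dlin c0 k2 c4 k4 a + dlin c0 k2 c4 k4 b.
Proof. by apply: rV4P; rewrite [RHS]mxE !dlinE !rvE; ring. Qed.

Lemma dlinN (F : fieldType) (c0 k2 c4 k4 : F) a :
  dlin c0 k2 c4 k4 (- a) = - dlin c0 k2 c4 k4 a.
Proof. by apply: rV4P; rewrite [RHS]mxE !dlinE !rvE; ring. Qed.

Lemma dlin_s (F : fieldType) (c0 k2 c4 k4 : F) : dlin c0 k2 c4 k4 (sigma F) = sigma F.
Proof. by apply: rV4P; rewrite !dlinE !rvE; ring. Qed.

Lemma dlin_s1 (F : fieldType) (c0 k2 c4 k4 : F) : dlin c0 k2 c4 k4 (sigma1 F) = sigma1 F.
Proof. by apply: rV4P; rewrite !dlinE !rvE; ring. Qed.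

Lemma dlin0 (F : fieldType) (c0 k2 c4 k4 : F) : dlin c0 k2 c4 k4 0 = 0.
Proof. by apply: rV4P; rewrite !dlinE !rvE; ring. Qed.

Lemma dlin_subgrp (F : fieldType) (c0 k2 c4 k4 : F) G : subgrp G ->
  subgrp [set dlin c0 k2 c4 k4 a | a in G]%classic.
Proof.
move=> gG; split; last by exists (sigma F); [apply: subgrp_s|apply: dlin_s].
split; first by exists 0; [apply: subgrp0|apply: dlin0].
move=> _ _ [a Ga <-] [b Gb <-]; exists (a - b); first exact: subgrpB.
by rewrite dlinD dlinN.
Qed.

Section Substitution.
Variable F : fieldType.
Local Notation A := (salg F).
Local Notation index := (index F).
Implicit Types (u v w : A) (k l : index) (a b : 'rV[F]_4) (m : Mvec).
Local Notation s := (sigma F).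
Local Notation s1 := (sigma1 F).

Definition tvar p : A := x (0, exp_inc p exp0).

Lemma tvarX p n : tvar p ^+ n = x (0, [ffun q => if q == p then n else 0%N]).
Proof.
elim: n => [|n IH].
  by congr (x (_, _)); apply/ffunP => q; rewrite !ffunE; case: eqP.
rewrite exprS IH mulxx /index_add /= addr0; congr (x (_, _)); apply/ffunP => q.
by rewrite !ffunE; case: eqP.
Qed.

Lemma x_prod k : x k = X k.1 * \prod_(p < 4) tvar p ^+ k.2 p.
Proof.
rewrite !big_ord_recl big_ord0 mulr1 !tvarX !mulxx /index_add /= !addr0.
rewrite [in LHS](surjective_pairing k); congr (x (_, _)).
by apply/ffunP; elim/ord4P; rewrite !ffunE /= ?add0n ?addn0; congr (k.2 _); apply: val_inj.
Qed.

Section Map.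
Variables (chi : 'rV[F]_4 -> F) (c0 k2 c4 k4 : F).
Hypotheses (chi0 : forall a, chi a != 0)
  (chiD : forall a b, chi (a + b) = chi a * chi b).
Local Notation d := (dlin c0 k2 c4 k4).

Definition subst_var (p : 'I_4) : A :=
  if p == p1 then tvar p1 else if p == p2 then k2 *: tvar p2 - c0 *: tvar p1
  else if p == p3 then tvar p3 else k4 *: tvar p4 - c4 *: tvar p3.

(** The substitution of dlin in the exponents, accompanied by a linear
    substitution of the polynomial variables.  By subst_br, the character is what
    allows k2 and k4 to differ: it rescales the coefficient X s of the
    bracket. *)
Definition subst := lext (fun k : index =>
  chi k.1 *: (X (d k.1) * \prod_(p < 4) subst_var p ^+ k.2 p)).
HB.instance Definition _ := GRing.isLinear.Build F A A _ subst (lext_is_linear _).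

Lemma substx k : subst (x k) = chi k.1 *: (X (d k.1) * \prod_(p < 4) subst_var p ^+ k.2 p).
Proof. exact: lextx. Qed.

Lemma substM u v : subst (u * v) = subst u * subst v.
Proof.
apply: lext_mul => k l; rewrite chiD dlinD -mulXX.
rewrite (eq_bigr (fun p => subst_var p ^+ k.2 p * subst_var p ^+ l.2 p)); last first.
  by move=> p _; rewrite ffunE exprD.
by rewrite big_split /= !scaE rmorphM /=; ring.
Qed.

Lemma chi_0 : chi 0 = 1.
Proof. by apply: (mulfI (chi0 0)); rewrite -chiD addr0 mulr1. Qed.

Lemma substX a : subst (X a) = chi a *: X (d a).
Proof. by rewrite substx /= big1 ?mulr1 // => p _; rewrite ffunE expr0. Qed.

Lemma subst1 : subst 1 = 1.
Proof. by rewrite -X0 substX chi_0 scale1r dlin0. Qed.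

Lemma subst_tvar p : subst (tvar p) = subst_var p.
Proof.
rewrite substx /= chi_0 scale1r dlin0 X0 mul1r (bigD1 p) //= big1 ?mulr1.
  by rewrite !ffunE eqxx expr1.
by move=> q qp; rewrite !ffunE (negPf qp) expr0.
Qed.


Lemma D_tvar0 p q : D q (tvar p) = ((q == p)%:R : F) *: 1.
Proof. by rewrite D_tvar mxE scale0r add0r. Qed.

Definition subst_del (p : 'I_4) u : A :=
  if p == p1 then D p1 u - c0 *: D p2 u else if p == p2 then k2 *: D p2 u
  else if p == p3 then D p3 u - c4 *: D p4 u else k4 *: D p4 u.

Lemma subst_delP p (b : F) u v : subst_del p (b *: u + v) = b *: subst_del p u + subst_del p v.
Proof. by rewrite /subst_del !DD !DZ; case: ifP => _; do 2?[case: ifP => _]; rewrite !scaE; ring. Qed.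
HB.instance Definition _ p := GRing.isLinear.Build F A A _ (subst_del p) (subst_delP p).

Lemma subst_delM p u v : subst_del p (u * v) = subst_del p u * v + u * subst_del p v.
Proof. by rewrite /subst_del !DM; case: ifP => _; do 2?[case: ifP => _]; rewrite !scaE; ring. Qed.

Lemma substZ (b : F) u : subst (b *: u) = b *: subst u. Proof. exact: linearZ. Qed.
Lemma substD u v : subst (u + v) = subst u + subst v. Proof. exact: linearD. Qed.
Lemma substB u v : subst (u - v) = subst u - subst v. Proof. exact: linearB. Qed.

(** Both sides are derivations along the substitution, so that it suffices to
    compare them on the generators. *)
Lemma subst_D p u : D p (subst u) = subst (subst_del p u).
Proof.
pose Q u := D p (subst u) = subst (subst_del p u).
have QM v w : Q v -> Q w -> Q (v * w).
  by rewrite /Q => hv hw; rewrite substM DM hv hw subst_delM substD !substM.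
have Q1 : Q 1 by rewrite /Q subst1 D1 /subst_del !D1 !scaler0 subr0 !if_same linear0.
have QX a : Q (X a).
  rewrite /Q /subst_del !DX substX; elim/ord4P: p {QM Q1 Q} => /=.
  - by rewrite substB !substZ substX DZ DX dlinE !scaE; ring.
  - by rewrite !substZ substX DZ DX dlinE !scaE; ring.
  - by rewrite substB !substZ substX DZ DX dlinE !scaE; ring.
  - by rewrite !substZ substX DZ DX dlinE !scaE; ring.
have Qt q : Q (tvar q).
  rewrite /Q /subst_del !D_tvar0 subst_tvar /subst_var; elim/ord4P: p {QM Q1 Q QX} => /=;
  elim/ord4P: q => /=; rewrite ?(substB, substZ, subst1) ?(DB, DZ) ?D_tvar0 /= !scaE;
  rewrite ?rmorph0 ?rmorph1; ring.
apply: (linear_eq (f := D p \o subst) (g := subst \o subst_del p)) => k /=.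
rewrite x_prod; apply: (QM _ _ (QX _)); apply: (big_ind Q) => [//|v w|q _]; first exact: QM.
by elim: (k.2 q) => [|n IH]; rewrite ?expr0 // exprS; apply: QM.
Qed.

Lemma subst_br u v : k2 = chi s * k4 ->
  br (subst u) (subst v) = k4 *: subst (br u v).
Proof.
move=> ek; rewrite /br !(substB, substD, substM) substX dlin_s !subst_D /subst_del /=.
by rewrite !(substB, substZ) ek !scaE rmorphM /=; ring.
Qed.

(** The argument of the second variable involves the first one unless
    [c0 = 0], and similarly for the last two. *)
Lemma inA_subst m (G G' : set 'rV[F]_4) u : subgrp G' -> (forall a, G a -> G' (d a)) ->
  (m p1 = false -> m p2 -> c0 = 0) -> (m p3 = false -> m p4 -> c4 = 0) ->
  inA m G u -> inA m G' (subst u).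
Proof.
move=> gG' dG h0 h4; elim/supp_ind => [|a k {}u [Gk Jk] IH].
  by rewrite linear0; apply: inA0.
rewrite linearP; apply: inAP => //; rewrite /= substx; apply: inAZ.
have A1 : inA m G' 1 by rewrite -X0; apply: inAX; apply: (subgrp0 gG').
have At p : m p -> inA m G' (tvar p).
  by move=> mp; apply: supp_inx; split; [apply: (subgrp0 gG')|apply: Jset_inc].
have AT p : m p -> inA m G' (subst_var p).
  elim/ord4P: p => mp; rewrite /subst_var /=; try exact: At.
    case: (boolP (m p1)) => m1; last by rewrite h0 ?(negPf m1) // scale0r subr0; apply/inAZ/At.
    by apply: supp_inB; apply/inAZ/At.
  case: (boolP (m p3)) => m3; last by rewrite h4 ?(negPf m3) // scale0r subr0; apply/inAZ/At.
  by apply: supp_inB; apply/inAZ/At.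
apply: (inAM gG'); first by apply: inAX; apply: dG.
apply: (big_ind (inA m G')) => // [v w|p _]; first exact: (inAM gG').
case: (boolP (m p)) => mp; last first.
  by have := Jk p; rewrite (negPf mp) /= => ->; rewrite expr0.
by elim: (k.2 p) => [|n IH']; rewrite ?expr0 // exprS; apply: (inAM gG') => //; apply: AT.
Qed.
End Map.

Section Inverse.
Variables (chi chi' : 'rV[F]_4 -> F) (c0 k2 c4 k4 c0' k2' c4' k4' : F).
Hypotheses (chi0 : forall a, chi a != 0)
  (chiD : forall a b, chi (a + b) = chi a * chi b).
Hypotheses (chi'0 : forall a, chi' a != 0)
  (chi'D : forall a b, chi' (a + b) = chi' a * chi' b).
Local Notation d := (dlin c0 k2 c4 k4).
Local Notation d' := (dlin c0' k2' c4' k4').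
Local Notation f := (subst chi c0 k2 c4 k4).
Local Notation f' := (subst chi' c0' k2' c4' k4').

Lemma substK : cancel d d' -> (forall a, chi a * chi' (d a) = 1) ->
  k2 * k2' = 1 -> k4 * k4' = 1 -> k2 * c0' + c0 = 0 -> k4 * c4' + c4 = 0 -> cancel f f'.
Proof.
move=> dK chiK e2 e4 e0 e3; apply: (linear_eq (f := f' \o f) (g := idfun)) => k /=.
have M := substM c0' k2' c4' k4' chi'D; have T := subst_tvar c0' k2' c4' k4' chi'0 chi'D.
have fX n u : f' (u ^+ n) = f' u ^+ n.
  by elim: n => [|n IH]; rewrite ?expr0 ?(subst1 _ _ _ _ chi'0 chi'D) // !exprS M IH.
rewrite substx substZ M substX scalerAl scalerA chiK scale1r dK [RHS]x_prod.
congr (_ * _); rewrite (big_morph f' M (subst1 _ _ _ _ chi'0 chi'D)).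
apply: eq_bigr => p _; rewrite fX; congr (_ ^+ _).
elim/ord4P: p; rewrite /subst_var /= ?substB ?substZ ?T /subst_var //=.
  have -> : c0 = - (k2 * c0') by apply/eqP; rewrite -addr_eq0 addrC e0.
  transitivity ((k2 * k2') *: tvar p2); last by rewrite e2 scale1r.
  by rewrite !scaE !(rmorphN, rmorphM) /=; ring.
have -> : c4 = - (k4 * c4') by apply/eqP; rewrite -addr_eq0 addrC e3.
transitivity ((k4 * k4') *: tvar p4); last by rewrite e4 scale1r.
by rewrite !scaE !(rmorphN, rmorphM) /=; ring.
Qed.
End Inverse.

Section Niso.
Variables (m : Mvec) (G : set 'rV[F]_4) (chi : 'rV[F]_4 -> F) (c0 k2 c4 k4 : F).
Hypotheses (chi0 : forall a, chi a != 0)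
  (chiD : forall a b, chi (a + b) = chi a * chi b).
Hypotheses (k20 : k2 != 0) (k40 : k4 != 0) (chis : k2 = chi s * k4).
Hypotheses (h0 : m p1 = false -> m p2 -> c0 = 0) (h4 : m p3 = false -> m p4 -> c4 = 0).
Hypothesis gG : subgrp G.
Local Notation d := (dlin c0 k2 c4 k4).
Local Notation d' := (dlin (- c0 / k2) k2^-1 (- c4 / k4) k4^-1).
Let chi' a := (chi (d' a))^-1.
Local Notation f := (subst chi c0 k2 c4 k4).
Local Notation f' := (subst chi' (- c0 / k2) k2^-1 (- c4 / k4) k4^-1).

Lemma dlinVK : cancel d' d.
Proof. by move=> a; apply: rV4P; rewrite !dlinE; field. Qed.

Definition scaled_subst u : A := k4^-1 *: f u.
Definition scaled_substV u : A := k4 *: f' u.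
Fact scaled_subst_linear : linear scaled_subst.
Proof. by move=> a u v; rewrite /scaled_subst linearP scalerDr !scalerA mulrC. Qed.
Fact scaled_substV_linear : linear scaled_substV.
Proof. by move=> a u v; rewrite /scaled_substV linearP scalerDr !scalerA mulrC. Qed.
HB.instance Definition _ := GRing.isLinear.Build F A A _ scaled_subst scaled_subst_linear.
HB.instance Definition _ := GRing.isLinear.Build F A A _ scaled_substV scaled_substV_linear.

Lemma dlin_niso : exists g, niso (lie m G) (lie m [set d a | a in G]%classic) g.
Proof.
have chi'0 a : chi' a != 0 by rewrite invr_eq0.
have chi'D a b : chi' (a + b) = chi' a * chi' b by rewrite /chi' dlinD chiD invfM.
have dK := dlinK c0 c4 k20 k40.
have fK : cancel f f'.
  apply: substK => //; rewrite ?mulfV //.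
  - by move=> a; rewrite /chi' dK mulfV.
  - by field.
  - by field.
have fK' : cancel f' f.
  apply: substK => //; rewrite ?mulVf //.
  - exact: dlinVK.
  - by move=> a; rewrite /chi' mulVf.
  - by field.
  - by field.
have gG' := dlin_subgrp c0 k2 c4 k4 gG.
exists (fun u => nrm (scaled_subst u)).
apply: (@transport_niso F m m G _ scaled_subst scaled_substV (k4^-1 * chi s1)).
- by move=> u; rewrite /= /scaled_subst /scaled_substV substZ fK scalerA mulfV // scale1r.
- by move=> u; rewrite /= /scaled_subst /scaled_substV substZ fK' scalerA mulVf // scale1r.
- move=> u v; rewrite /= /scaled_subst brZl brZr (subst_br _ _ chi0 chiD) // !scalerA.
  by rewrite mulrVK // unitfE.
- move=> u Au; rewrite /= /scaled_subst; apply: inAZ; apply: inA_subst Au => //.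
  by move=> a Ga; exists a.
- move=> u Au; rewrite /= /scaled_substV; apply: inAZ; apply: inA_subst Au => //.
  + by move=> _ [a Ga <-]; rewrite dK.
  + by move=> e1 e2; rewrite h0 // oppr0 mul0r.
  + by move=> e1 e2; rewrite h4 // oppr0 mul0r.
- by rewrite mulf_neq0 ?invr_eq0.
- by rewrite /= /scaled_subst substX dlin_s1 scalerA.
Qed.
End Niso.
End Substitution.

Lemma lin_equiv_niso (F : closedFieldType) (char0 : [pchar F] =i pred0) m
    (G G' : set 'rV[F]_4) : subgrp G -> lin_equiv m G G' ->
  subgrp G' /\ exists f, niso (lie m G) (lie m G') f.
Proof.
move=> gG [c0 [k2 [c4 [k4 [k20 k40 h0 h4 ->]]]]].
split; first exact: dlin_subgrp.
have [|n|chi [chi0 chiD chis]] := @character_exists F _ (sigma F) (k2 / k4).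
- by rewrite mulf_neq0 ?invr_eq0.
- move/rowP/(_ p1)/eqP; rewrite -scaler_nat !rvE mulr1.
  by rewrite (natrF_eq0 char0).
- by apply: (dlin_niso chi0 chiD) => //; rewrite chis divfK.
Qed.

(** * The group acting on the parameters *)

Section Matrices.
Variable F : fieldType.
Implicit Types (al : 'rV[F]_(2 + 2)) (g h : 'M[F]_(2 + 2)) (G : set 'rV[F]_4) (m : Mvec).

Definition diag22 (b1 b2 b3 b4 : F) : 'M[F]_(2 + 2) :=
  block_mx (mx22 b1 b2) 0 0 (mx22 b3 b4).
Definition swap_mx : 'M[F]_(2 + 2) := block_mx 0 1%:M 1%:M 0.

Lemma ord4_split : (p1 = lshift 2 (ord0 : 'I_2)) * (p2 = lshift 2 (lift ord0 ord0 : 'I_2))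
  * (p3 = rshift 2 (ord0 : 'I_2)) * (p4 = rshift 2 (lift ord0 ord0 : 'I_2)).
Proof. by do !split; apply: val_inj. Qed.

Lemma mul_block al (A B C D : 'M[F]_2) (j : 'I_2) :
  ((al *m block_mx A B C D) 0 (lshift 2 j) = al 0 p1 * A ord0 j + al 0 p2 * A (lift ord0 ord0) j
    + (al 0 p3 * C ord0 j + al 0 p4 * C (lift ord0 ord0) j)) *
  ((al *m block_mx A B C D) 0 (rshift 2 j) = al 0 p1 * B ord0 j + al 0 p2 * B (lift ord0 ord0) j
    + (al 0 p3 * D ord0 j + al 0 p4 * D (lift ord0 ord0) j)).
Proof.
rewrite !ord4_split; split; rewrite mxE big_split_ord /=.
  by rewrite !big_ord_recl !big_ord0 !addr0 !block_mxEul !block_mxEdl.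
by rewrite !big_ord_recl !big_ord0 !addr0 !block_mxEur !block_mxEdr.
Qed.

Lemma mul_diag22 al b1 b2 b3 b4 : al *m diag22 b1 b2 b3 b4 = dlin (- b1) b2 (- b3) b4 al.
Proof.
apply: (@rV4P F); rewrite dlinE [in LHS]ord4_split !mul_block !mxE /=; ring.
Qed.

Lemma mul_swap_mx al : al *m swap_mx = swv al.
Proof.
apply: (@rV4P F); rewrite swvE [in LHS]ord4_split !mul_block !mxE /=; ring.
Qed.

Lemma mx_eq_rows g h : (forall al, al *m g = al *m h) -> g = h.
Proof. by move=> e; apply/row_matrixP => i; rewrite !rowE e. Qed.

Lemma diag22K b1 b2 b3 b4 : b2 != 0 -> b4 != 0 ->
  diag22 b1 b2 b3 b4 *m diag22 (- b1 / b2) b2^-1 (- b3 / b4) b4^-1 = 1%:M.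
Proof.
move=> h2 h4; apply: mx_eq_rows => al; rewrite mulmxA !mul_diag22 mulmx1.
by apply: (@rV4P F); rewrite !dlinE; field.
Qed.

Lemma swap_mxK : swap_mx *m swap_mx = 1%:M.
Proof. by apply: mx_eq_rows => al; rewrite mulmxA !mul_swap_mx mulmx1 swvK. Qed.

Lemma invmx_uniq g h : g *m h = 1%:M -> invmx g = h.
Proof.
move=> e; have ug := (mulmx1_unit e).1.
by rewrite -[h](mulKmx ug) e mulmx1.
Qed.

Lemma anti_diag22 b1 b2 b3 b4 :
  block_mx 0 (mx22 b1 b2) (mx22 b3 b4) 0 = diag22 b1 b2 b3 b4 *m swap_mx.
Proof. by rewrite mulmx_block !mulmx0 !mul0mx !mulmx1 !addr0 !add0r. Qed.

Lemma invmx_diag22 b1 b2 b3 b4 : b2 != 0 -> b4 != 0 ->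
  invmx (diag22 b1 b2 b3 b4) = diag22 (- b1 / b2) b2^-1 (- b3 / b4) b4^-1.
Proof. by move=> h2 h4; apply/invmx_uniq/diag22K. Qed.

Lemma invmx_anti b1 b2 b3 b4 : b2 != 0 -> b4 != 0 ->
  invmx (diag22 b1 b2 b3 b4 *m swap_mx) = swap_mx *m diag22 (- b1 / b2) b2^-1 (- b3 / b4) b4^-1.
Proof.
move=> h2 h4; apply: invmx_uniq.
by rewrite mulmxA -[_ *m swap_mx *m swap_mx]mulmxA swap_mxK mulmx1 diag22K.
Qed.

Lemma gact_diag22 b1 b2 b3 b4 G : b2 != 0 -> b4 != 0 -> gact (diag22 b1 b2 b3 b4) G =
  [set dlin (b1 / b2) b2^-1 (b3 / b4) b4^-1 a | a in G]%classic.
Proof.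
move=> h2 h4; rewrite /gact invmx_diag22 //; apply: eq_imagel => al _.
by rewrite mul_diag22 !mulNr !opprK.
Qed.

Lemma swG_image G : swG G = [set swv a | a in G]%classic.
Proof.
apply/seteqP; split=> [a Ga|_ [a Ga <-]]; last by rewrite /swG swvK.
by exists (swv a) => //; rewrite swvK.
Qed.

Lemma gact_anti b1 b2 b3 b4 G : b2 != 0 -> b4 != 0 -> gact (diag22 b1 b2 b3 b4 *m swap_mx) G =
  [set dlin (b1 / b2) b2^-1 (b3 / b4) b4^-1 a | a in swG G]%classic.
Proof.
move=> h2 h4; rewrite /gact invmx_anti // swG_image image_comp.
apply: eq_imagel => al _ /=.
by rewrite mulmxA mul_swap_mx mul_diag22 !mulNr !opprK.
Qed.

Lemma swe_fix m : swe m = m <-> (m p1, m p2) = (m p3, m p4).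
Proof.
split=> [e|[e1 e2]]; first by rewrite -{1 2}e !ffunE.
by apply/ffunP; elim/ord4P; rewrite !ffunE /swp /=.
Qed.

Lemma lin_equiv_Gequiv m G G' : lin_equiv m G G' -> Gequiv m G G'.
Proof.
move=> [c0 [k2 [c4 [k4 [k20 k40 h0 h4 ->]]]]].
exists (diag22 (c0 / k2) k2^-1 (c4 / k4) k4^-1); split; last first.
  by rewrite gact_diag22 ?invr_eq0 // !invrK !divfK.
apply: Ggroup_diag; split; rewrite ?invr_eq0 // => e1 e2.
  by rewrite h0 // mul0r.
by rewrite h4 // mul0r.
Qed.

Lemma swap_lin_equiv_Gequiv m G G' : swe m = m -> lin_equiv m (swG G) G' -> Gequiv m G G'.
Proof.
move=> /swe_fix em [c0 [k2 [c4 [k4 [k20 k40 h0 h4 ->]]]]].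
exists (diag22 (c0 / k2) k2^-1 (c4 / k4) k4^-1 *m swap_mx); split; last first.
  by rewrite gact_anti ?invr_eq0 // !invrK !divfK.
rewrite -anti_diag22; apply: (Ggroup_anti em); split; rewrite ?invr_eq0 // => e1 e2.
  by rewrite h0 // mul0r.
by rewrite h4 // mul0r.
Qed.

Lemma gact1 G : gact 1%:M G = G.
Proof.
rewrite /gact invmx1; apply/seteqP; split=> [_ [a Ga <-]|a Ga]; first by rewrite mulmx1.
by exists a => //; rewrite mulmx1.
Qed.

Lemma gactM g h G : g \in unitmx -> h \in unitmx -> gact (g *m h) G = gact g (gact h G).
Proof.
move=> ug uh; rewrite /gact image_comp; apply: eq_imagel => al _ /=.
have -> : invmx (g *m h) = invmx h *m invmx g.
  by apply: invmx_uniq; rewrite mulmxA -[g *m h *m _]mulmxA mulmxV // mulmx1 mulmxV.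
by rewrite mulmxA.
Qed.

Lemma gactV g G : g \in unitmx -> gact g (gact (invmx g) G) = G.
Proof. by move=> ug; rewrite -gactM ?unitmx_inv // mulmxV // gact1. Qed.
End Matrices.

Section Relation.
Variable F : closedFieldType.
Hypothesis char0 : [pchar F] =i pred0.
Implicit Types (G : set 'rV[F]_4) (m : Mvec).

Lemma xu_refl m G : subgrp G -> xu_isomorphic m G m G.
Proof.
move=> gG; have h := sw_niso (swe m) (swG_subgrp gG); rewrite sweK swGK in h.
apply: (iso_of_niso gG gG).
exact: niso_comp (lie_closed _ (swG_subgrp gG)) (lie_closed _ gG) (sw_niso m gG) h.
Qed.

Lemma xu_sym m m' G G' : subgrp G -> subgrp G' ->
  xu_isomorphic m G m' G' -> xu_isomorphic m' G' m G.
Proof.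
move=> gG gG' /(niso_of_iso gG gG')[f nf].
have [g [ng _ _]] := niso_inv (lie_closed m gG) (lie_closed m' gG') nf.
exact: iso_of_niso ng.
Qed.

Lemma xu_trans m m' m'' G G' G'' : subgrp G -> subgrp G' -> subgrp G'' ->
  xu_isomorphic m G m' G' -> xu_isomorphic m' G' m'' G'' -> xu_isomorphic m G m'' G''.
Proof.
move=> gG gG' gG'' /(niso_of_iso gG gG')[f nf] /(niso_of_iso gG' gG'')[g ng].
exact: iso_of_niso (niso_comp (lie_closed m' gG') (lie_closed m'' gG'') nf ng).
Qed.

Lemma xu_lin m G G' : subgrp G -> lin_equiv m G G' -> subgrp G' /\ xu_isomorphic m G m G'.
Proof.
move=> gG /(lin_equiv_niso char0 gG)[gG' [f nf]]; split=> //; exact: iso_of_niso nf.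
Qed.

Lemma xu_swap m G : subgrp G -> xu_isomorphic m G (swe m) (swG G).
Proof. by move=> gG; apply: iso_of_niso (sw_niso m gG) => //; apply: swG_subgrp. Qed.

Lemma gen_params_lin m G a1 a2 a3 a4 : gen_params m a1 a2 a3 a4 ->
  lin_equiv m G [set dlin (a1 / a2) a2^-1 (a3 / a4) a4^-1 a | a in G]%classic.
Proof.
case=> a20 a40 h1 h3; exists (a1 / a2), a2^-1, (a3 / a4), a4^-1.
split; rewrite ?invr_eq0 // => e1 e2; first by rewrite h1 // mul0r.
by rewrite h3 // mul0r.
Qed.

(** Only the generators require an argument: an antidiagonal one is a block swap
    followed by a diagonal one. *)
Lemma Ggroup_iso m (g : 'M[F]_(2 + 2)) : Ggroup m g -> [/\ g \in unitmx,
  (forall G, subgrp G -> subgrp (gact g G)),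
  forall G, subgrp G -> subgrp (gact (invmx g) G) &
  forall G, subgrp G -> xu_isomorphic m G m (gact g G)].
Proof.
elim=> {g} [a1 a2 a3 a4 gp|a1 a2 a3 a4 em gp||g h _ [ug sg sg' ig] _ [uh sh sh' ih]
  |g _ [ug sg sg' ig]].
- have [a20 a40 _ _] := gp.
  have [ud _] := mulmx1_unit (diag22K a1 a3 a20 a40).
  split=> // G gG; rewrite ?invmx_diag22 // gact_diag22 ?invr_eq0 //.
  + exact: dlin_subgrp.
  + exact: dlin_subgrp.
  + exact: (xu_lin gG (gen_params_lin _ gp)).2.
- have [a20 a40 _ _] := gp; have /swe_fix em' := em.
  have [ud _] := mulmx1_unit (diag22K a1 a3 a20 a40).
  have [us _] := mulmx1_unit (@swap_mxK F).
  rewrite anti_diag22; split=> [|G gG|G gG|G gG].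
  + by rewrite unitmx_mul ud.
  + by rewrite gact_anti //; apply: dlin_subgrp; apply: swG_subgrp.
  + rewrite invmx_anti // gactM //; last first.
      by rewrite -invmx_diag22 // unitmx_inv.
    rewrite gact_diag22 ?invr_eq0 // /gact (invmx_uniq (@swap_mxK F)).
    have -> : [set (al : 'rV[F]_(2 + 2)) *m swap_mx F | al in
        [set dlin (- a1 / a2 / a2^-1) a2^-1^-1 (- a3 / a4 / a4^-1) a4^-1^-1 a | a in G]]%classic
      = swG [set dlin (- a1 / a2 / a2^-1) a2^-1^-1 (- a3 / a4 / a4^-1) a4^-1^-1 a | a in G]%classic.
      by rewrite swG_image; apply: eq_imagel => al _; rewrite mul_swap_mx.
    by apply: swG_subgrp; apply: dlin_subgrp.
  + rewrite gact_anti //; have gS := swG_subgrp gG.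
    have [gD iD] := xu_lin gS (gen_params_lin (swG G) gp).
    apply: xu_trans iD => //; rewrite -{2}em'; exact: xu_swap.
- by split=> [|G gG|G gG|G gG]; rewrite ?unitmx1 ?invmx1 ?gact1 //; apply: xu_refl.
- have e : invmx (g *m h) = invmx h *m invmx g.
    by apply: invmx_uniq; rewrite mulmxA -[g *m h *m _]mulmxA mulmxV // mulmx1 mulmxV.
  split=> [|G gG|G gG|G gG].
  + by rewrite unitmx_mul ug.
  + by rewrite gactM //; apply/sg/sh.
  + by rewrite e gactM ?unitmx_inv //; apply/sh'/sg'.
  + rewrite gactM //; apply: xu_trans (ih _ gG) (ig _ (sh _ gG)) => //; last exact/sg/sh.
    exact: sh.
- split=> [|G gG|G gG|G gG]; rewrite ?unitmx_inv ?invmxK //; auto.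
  apply: xu_sym => //; first exact: sg'.
  by have := ig _ (sg' _ gG); rewrite gactV //; apply.
Qed.

Lemma swe_block m : block_swap m (swe m).
Proof. by split; rewrite ffunE. Qed.

Lemma xu_isomorphicP (m m' : Mvec) G G' : Omega G -> Omega G' ->
  (block_swap m m' -> m = m') ->
  (xu_isomorphic m G m' G' <-> m = m' /\ Gequiv m G G').
Proof.
move=> OG OG' hm; have gG := Omega_subgrp OG; have gG' := Omega_subgrp OG'.
split=> [/(niso_of_iso gG gG')[f nf]|[<- [g [Gg ->]]]]; last first.
  by have [_ _ _] := Ggroup_iso Gg; apply.
have [[em h]|[em h]] :=
  iso_lin_equiv char0 gG gG' (Omega_axis OG) (Omega_axis OG') nf.
  by split=> //; apply: lin_equiv_Gequiv.
have e : m = m' by apply: hm; rewrite -em; apply: swe_block.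
split=> //; rewrite em -e in h; apply: (swap_lin_equiv_Gequiv _ h).
by rewrite em.
Qed.
End Relation.

(** * Doubling of infinite sets *)

Section Doubling.
Variable T : pointedType.
Implicit Types (X : set T) (e : nat -> T).
Local Open Scope classical_set_scope.
Local Open Scope card_scope.

Definition inj_seq X : set (nat -> T) := [set e | (forall n, X (e n)) /\ injective e].

Lemma infinite_inj_seq X : infinite_set X -> exists e, inj_seq X e.
Proof.
move=> /infiniteP/pcard_leP[f]; exists f; split=> [n|n k]; first exact: (@funS _ _ _ _ f).
by apply: (@inj _ _ _ f); rewrite inE.
Qed.

Lemma countable_inj_seq X : infinite_set X -> countable X ->
  exists2 e : nat -> T, injective e & X = range e.
Proof.
move=> iX cX.
have /card_set_bijP[e [eX einj esur]] : [set: nat] #= X.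
  by rewrite card_eq_le; apply/andP; split=> //; apply/infiniteP.
exists e; first by move=> n k; apply: einj; rewrite inE.
by apply/seteqP; split=> [//|_ [n _ <-]]; apply: eX.
Qed.

(** An infinite set is a disjoint union of ranges of injective sequences: off
    one such range, a maximal disjoint family leaves a finite set, which that
    range absorbs. *)
Lemma sequence_partition X : infinite_set X -> exists E : set (nat -> T),
  [/\ E `<=` inj_seq X, trivIset E (fun e => range e) & X `<=` \bigcup_(e in E) range e].
Proof.
move=> iX; have [e0 [e0X e0inj]] := infinite_inj_seq iX.
have [E [EX Etriv Emax]] := ex_maximal_disjoint_subcollection
  (fun e : nat -> T => range e) (inj_seq (X `\` range e0)).
pose U := \bigcup_(e in E) range e; pose C := X `\` U.
have e0C n : C (e0 n).
  split=> // -[e Ee [k _ ek]]; have [h _] := EX _ Ee; have [_] := h k.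
  by apply; exists n.
have iC : infinite_set C.
  apply: (@sub_infinite_set _ (range e0)); first by move=> _ [n _ <-].
  apply/infiniteP/pcard_leP; apply/injfunPex; exists e0; first by move=> n _; exists n.
  by move=> n k _ _; apply: e0inj.
have fC : finite_set (C `\` range e0).
  apply: contrapT => /infinite_inj_seq[e [eC einj]].
  have nE : ~ E e.
    by move=> Ee; have [[_ nU] _] := eC 0%N; apply: nU; exists e => //; exists 0%N.
  apply: (Emax (E `|` [set e])).
  - by split=> [x Ex|h]; [left|apply: nE; apply: h; right].
  - move=> i [/EX//|->]; split=> // n; have [[Xe _] ne] := eC n; split=> //.
  - have dis i : E i -> ~ (range i `&` range e !=set0).
      move=> Ei [_ [[n _ <-] [k _ ek]]]; have [[_ nU] _] := eC k.
      by apply: nU; exists i => //; exists n.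
    move=> i j [Ei|->] [Ej|->] // h; first exact: Etriv.
      by case: (dis i).
    by rewrite setIC in h; case: (dis j).
have [c cinj cC] : exists2 e : nat -> T, injective e & C = range e.
  apply: countable_inj_seq => //.
  have -> : C = (C `\` range e0) `|` range e0.
    apply/seteqP; split=> [x Cx|x [[]//|[n _ <-]]//].
    by have [h|h] := pselect (range e0 x); [right|left].
  rewrite -bigcup2E; apply: bigcup_countable => // -[|[|i]] _ /=.
  - exact: finite_set_countable.
  - exact: (sub_countable (card_image_le _ _)) (countableP _).
  - exact: countable0.
have dis i : E i -> ~ (range i `&` range c !=set0).
  by move=> Ei [x [ix]]; rewrite -cC => -[_]; apply; exists i.
exists (E `|` [set c]); split.
- move=> i [/EX[h einj]|->]; split=> // n; first by have [] := h n.
  suff [//] : C (c n); by rewrite cC; exists n.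
- move=> i j [Ei|->] [Ej|->] // h; first exact: Etriv.
    by case: (dis i).
  by rewrite setIC in h; case: (dis j).
- move=> x Xx; have [[e Ee ex]|nU] := pselect (U x); first by exists e => //; left.
  by exists c; [right|rewrite -cC].
Qed.

(** Along each sequence of the partition, n goes to 2n and 2n + 1. *)
Lemma doubling X : infinite_set X -> exists f : T -> bool -> T,
  (forall x b, X x -> X (f x b)) /\
  (forall x y b c, X x -> X y -> f x b = f y c -> x = y /\ b = c).
Proof.
move=> /sequence_partition[E [EX Etriv EU]].
have /choice[p pP] : forall x, exists p : (nat -> T) * nat, X x -> E p.1 /\ p.1 p.2 = x.
  move=> x; have [Xx|nX] := pselect (X x); last by exists (fun=> x, 0%N).
  by have [e Ee [n _ en]] := EU _ Xx; exists (e, n).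
exists (fun x (b : bool) => (p x).1 ((p x).2.*2 + b)%N); split.
  by move=> x b /pP[/EX[h _] _]; apply: h.
move=> x y b c /pP[Ex ex] /pP[Ey ey] e.
have pe : (p x).1 = (p y).1.
  apply: Etriv => //; exists ((p x).1 ((p x).2.*2 + b)%N); split; first by eexists.
  by rewrite e; eexists.
have [_ einj] := EX _ Ex; rewrite -pe in e ey; move/einj: e => e.
have bc : b = c by move: (congr1 odd e); rewrite !oddD !odd_double; case: b c {e} => -[].
split=> //; rewrite -ex -ey; congr (_ _); apply: double_inj.
by move: e; rewrite bc => /addIn.
Qed.

(** Cantor-Bernstein, with the factor bool absorbed by doubling. *)
Lemma bij_of_double (U : pointedType) X (Y : set U) (f : T -> U) (g : U -> T * bool) :
  infinite_set X -> (forall x, X x -> Y (f x)) ->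
  (forall x y, X x -> X y -> f x = f y -> x = y) ->
  (forall y, Y y -> X (g y).1) ->
  (forall y z, Y y -> Y z -> g y = g z -> y = z) ->
  exists h, set_bij X Y h.
Proof.
move=> /doubling[d [dX dinj]] fX finj gY ginj.
apply/card_set_bijP; rewrite card_eq_le; apply/andP; split.
  apply/pcard_leP/injfunPex; exists f => // x y; rewrite !inE; exact: finj.
apply/pcard_leP/injfunPex; exists (fun y => d (g y).1 (g y).2).
  by move=> y /gY; apply: dX.
move=> y z; rewrite !inE => Yy Yz /(dinj _ _ _ _ (gY _ Yy) (gY _ Yz))[e1 e2].
by apply: ginj => //; rewrite [g y]surjective_pairing e1 e2 -surjective_pairing.
Qed.
End Doubling.

(** * The structure space *)

Section Structure.
Variable F : closedFieldType.
Hypothesis char0 : [pchar F] =i pred0.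
Implicit Types (G : set 'rV[F]_4) (m : Mvec).

Lemma Gequiv_refl m G : Gequiv m G G.
Proof. by exists 1%:M; split; [apply: Ggroup1|rewrite gact1]. Qed.

Lemma Gequiv_sym m G G' : subgrp G -> Gequiv m G G' -> Gequiv m G' G.
Proof.
move=> gG [g [Gg ->]]; have [ug _ _ _] := Ggroup_iso char0 Gg.
exists (invmx g); split; first exact: GgroupV.
by have := gactV G (g := invmx g); rewrite invmxK unitmx_inv => ->.
Qed.

Lemma Gequiv_trans m G G' G'' : Gequiv m G G' -> Gequiv m G' G'' -> Gequiv m G G''.
Proof.
move=> [g [Gg ->]] [h [Gh ->]].
have [ug _ _ _] := Ggroup_iso char0 Gg; have [uh _ _ _] := Ggroup_iso char0 Gh.
by exists (h *m g); split; [apply: GgroupM|rewrite gactM].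
Qed.

Lemma Gclass_eq m G G' : Omega G -> Omega G' ->
  Gclass m G = Gclass m G' <-> Gequiv m G G'.
Proof.
move=> OG OG'; split=> [e|h].
  by have [] : Gclass m G G' by rewrite e; split=> //; apply: Gequiv_refl.
have h' := Gequiv_sym (Omega_subgrp OG) h.
by apply/seteqP; split=> K [OK e]; split=> //; apply: Gequiv_trans e.
Qed.

Lemma iso_class_eq m G m' G' : Omega G -> Omega G' ->
  iso_class m G = iso_class m' G' <-> xu_isomorphic m G m' G'.
Proof.
move=> OG OG'; have gG := Omega_subgrp OG; have gG' := Omega_subgrp OG'.
split=> [e|h].
  have : iso_class m G (m', G') by rewrite e; exact: (conj OG' (xu_refl m' gG')).
  exact: proj2.
have h' := xu_sym gG gG' h.
apply/seteqP; split=> -[k K] [OK e]; have gK := Omega_subgrp OK.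
  exact: (conj OK (xu_trans gG' gG gK h' e)).
exact: (conj OK (xu_trans gG gG' gK h e)).
Qed.

(** Distinguishes the members of a pair of distinct swapped parameters. *)
Definition lex_le m : bool := ((m p1).*2 + m p2 <= (m p3).*2 + m p4)%N.

Lemma lex_le_swap m m' : lex_le m = lex_le m' -> block_swap m m' -> m = m'.
Proof.
rewrite /lex_le => h [e1 e2 e3 e4]; apply/ffunP; elim/ord4P;
move: h; rewrite ?e1 ?e2 ?e3 ?e4;
by case: (m p1); case: (m p2); case: (m p3); case: (m p4).
Qed.

(** Infinitely many algebras: the lattices of multiples of 1 / (n + 1) are pairwise
    inequivalent by Zlattice_inj. *)
Definition Zlattice n : set 'rV[F]_4 :=
  fun a => forall p, exists z : int, a 0 p *+ n.+1 = z%:~R.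

Lemma Zlattice_at n p z : Zlattice n (at_pos z p) <-> exists k : int, z *+ n.+1 = k%:~R.
Proof.
split=> [/(_ p)|[k e] q]; rewrite at_posE.
  by rewrite eqxx mulr1.
by case: eqP => _; [exists k; rewrite mulr1|exists 0; rewrite mulr0 mul0rn].
Qed.

Lemma Zlattice_Omega n : Omega (Zlattice n).
Proof.
have one p : Zlattice n (at_pos 1 p).
  by apply/Zlattice_at; exists n.+1.
have gL : add_subgroup (Zlattice n).
  split=> [p|a b La Lb p]; first by exists 0; rewrite mxE mul0rn.
  have [z ez] := La p; have [w ew] := Lb p; exists (z - w).
  by rewrite !mxE mulrnDl mulNrn ez ew rmorphB.
have add a b : Zlattice n a -> Zlattice n b -> Zlattice n (a + b).
  move=> La Lb; rewrite -[b]opprK; apply: gL.2 => //; rewrite -[- b]sub0r.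
  by apply: gL.2 => //; apply: gL.1.
split=> //.
- exact: add.
- move=> p e; have : [set (0 : 'rV[F]_4)]%classic (at_pos 1 p) by rewrite -e; split=> //; exists 1.
  by move/rowP/(_ p)/eqP; rewrite at_posE eqxx mulr1 mxE oner_eq0.
- move=> e; have : (set0 : set 'rV[F]_4)%classic (at_pos 1 p1) by rewrite -e; split=> //; exists 0; rewrite // /at_pos scale0r addr0.
  by [].
- move=> e; have : (set0 : set 'rV[F]_4)%classic (at_pos 1 p3) by rewrite -e; split=> //; exists 0; rewrite // /at_pos scale0r addr0.
  by [].
Qed.

Lemma swG_Zlattice n : swG (Zlattice n) = Zlattice n.
Proof.
apply/funext => a; apply/propext; split=> h p; last by rewrite swvE.
by have := h (swp p); rewrite swvE swpK.
Qed.

(** A linear equivalence changes the first coordinate by a multiple of the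
    second one only, so that it fixes the first axis pointwise. *)
Lemma lin_equiv_axis m G G' z : lin_equiv m G G' -> G (at_pos z p1) <-> G' (at_pos z p1).
Proof.
move=> [c0 [k2 [c4 [k4 [k20 k40 _ _ ->]]]]].
have e : dlin c0 k2 c4 k4 (at_pos z p1) = at_pos z p1.
  by apply: rV4P; rewrite !dlinE !rvE /=; ring.
split=> [h|[a Ga ea]]; first by exists (at_pos z p1).
by rewrite -(can_inj (dlinK c0 c4 k20 k40) (etrans ea (esym e))).
Qed.

Lemma Zlattice_inj m n k : xu_isomorphic m (Zlattice n) m (Zlattice k) -> n = k.
Proof.
have On := Zlattice_Omega n; have Ok := Zlattice_Omega k.
move=> /(niso_of_iso (Omega_subgrp On) (Omega_subgrp Ok))[f nf].
have ax z : Zlattice n (at_pos z p1) <-> Zlattice k (at_pos z p1).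
  have [[_ h]|[_ h]] := iso_lin_equiv char0 (Omega_subgrp On) (Omega_subgrp Ok)
    (Omega_axis On) (Omega_axis Ok) nf; first exact: lin_equiv_axis h.
  by rewrite -[in X in X <-> _]swG_Zlattice; apply: lin_equiv_axis h.
have dv i j : Zlattice j (at_pos (i.+1%:R)^-1 p1) -> (i.+1 %| j.+1)%N.
  move=> /Zlattice_at[z]; rewrite -[LHS]mulr_natr => e.
  have i0 : i.+1%:R != 0 :> F by rewrite natrF_eq0.
  have /eqP : (j.+1%:Z - z * i.+1%:Z)%:~R = 0 :> F.
    by rewrite rmorphB rmorphM /= -e mulrAC mulVf // mul1r subrr.
  rewrite (intrF_eq0 char0) subr_eq0 => /eqP ej.
  by have : (i.+1 %| j.+1%:Z)%Z by rewrite ej dvdz_mull.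
have self i : Zlattice i (at_pos (i.+1%:R)^-1 p1).
  by apply/Zlattice_at; exists 1; rewrite -[LHS]mulr_natr mulVf // natrF_eq0.
apply: succn_inj; apply/eqP; rewrite eqn_dvd; apply/andP; split; apply: dv.
  by apply/ax.
by apply/ax.
Qed.

Lemma iso_classes_infinite : ~ finite_set (iso_classes F).
Proof.
apply/infiniteP/pcard_leP/injfunPex.
exists (fun n => iso_class [ffun=> false] (Zlattice n)).
  by move=> n _; exists [ffun=> false], (Zlattice n); split=> //; apply: Zlattice_Omega.
move=> n k _ _ /iso_class_eq h; apply: Zlattice_inj (h _ _); exact: Zlattice_Omega.
Qed.

HB.instance Definition _ := Choice.on Mvec.
HB.instance Definition _ := isPointed.Build Mvec [ffun=> false].

(** A class is determined by the parameters of a representative modulo the group.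
    Conversely, the isomorphism class and lex_le m together determine the
    parameters modulo the group, since the latter decides between m and its swap. *)
Lemma structure_bijection : exists f, set_bij (iso_classes F) (structure_space F) f.
Proof.
have /choice[r rP] : forall C, exists r : Mvec * set 'rV[F]_4, iso_classes F C ->
    Omega r.2 /\ C = iso_class r.1 r.2.
  move=> C; have [[m [G [OG ->]]]|nC] := pselect (iso_classes F C); last first.
    by exists ([ffun=> false], set0%classic).
  by exists (m, G).
have /choice[t tP] : forall y : Mvec * set (set 'rV[F]_4), exists G,
    structure_space F y -> Omega G /\ y = (y.1, Gclass y.1 G).
  move=> y; have [[G OG e]|nY] := pselect (structure_space F y); last by exists set0%classic.
  by exists G => _; split=> //; rewrite [LHS]surjective_pairing e.
apply: (@bij_of_double _ _ _ _ (fun C => ((r C).1, Gclass (r C).1 (r C).2))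
  (fun y => (iso_class y.1 (t y), lex_le y.1))).
- exact: iso_classes_infinite.
- by move=> C /rP[OC _]; exists (r C).2.
- move=> C C' /rP[OC eC] /rP[OC' eC'] [em]; rewrite -em => /(Gclass_eq _ OC OC') hG.
  apply: etrans eC (etrans _ (esym eC')); rewrite -em.
  apply: (iso_class_eq _ _ OC OC').2.
  exact: (xu_isomorphicP char0 OC OC' (fun _ => erefl _)).2 (conj (erefl _) hG).
- by move=> y /tP[Oy _]; exists y.1, (t y).
- move=> y y' /tP[Oy ey] /tP[Oy' ey'] e.
  have h := (iso_class_eq _ _ Oy Oy').1 (congr1 fst e).
  have [em hG] := (xu_isomorphicP char0 Oy Oy' (lex_le_swap (congr1 snd e))).1 h.
  by rewrite ey ey' -em; congr pair; apply/Gclass_eq.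
Qed.
End Structure.

Theorem theorem3p3 (F : closedFieldType) (char0 : [pchar F] =i pred0) :
  (forall (m m' : Mvec) (Gam Gam' : set 'rV[F]_4),
     Omega Gam -> Omega Gam' -> (block_swap m m' -> m = m') ->
     (xu_isomorphic m Gam m' Gam' <-> m = m' /\ Gequiv m Gam Gam'))
  /\ exists f : set (Mvec * set 'rV[F]_4) -> Mvec * set (set 'rV[F]_4),
       set_bij (iso_classes F) (structure_space F) f.
Proof.
by split; [move=> m m' G G'; apply: xu_isomorphicP|apply: structure_bijection].
Qed.
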